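(* Let $\mathcal F$ be a family of ordered pairs $(g,f)$ of non-negative locally integrable functions on $\mathbb{R}^n$. Assume that for some $1<p_1<\infty$ and every $w\in A_{p_1}$ we have $$\|g|L_{p_1,w}(\mathbb{R}^n)\|\le c_1\|f|L_{p_1,w}(\mathbb{R}^n)\|\qquad\text{for all }(g,f)\in\mathcal F.$$ Then for every $1<p<\infty$, every $-\frac np\le r<0$ and every $w\in A_p$ we have $$\|g|L^r_p(w,\mathbb{R}^n)\|\le c_2\|f|L^r_p(w,\mathbb{R}^n)\|\qquad\text{for all }(g,f)\in\mathcal F.$$ The constants $c_1$ and $c_2$ do not depend on $(g,f)$ but may depend on $w$, $p_1$ and $p$.
   Context: $p'=p/(p-1)$; $w(M)=\int_M w(x)\,dx$. $A_p$ ($1<p<\infty$): $w\in L_1^{\mathrm{loc}}(\mathbb{R}^n)$ with $w>0$ a.e. belongs to $A_p$ if $[w]_{A_p}=\sup_Q \frac{w(Q)}{|Q|}\big(\frac{w^{1-p'}(Q)}{|Q|}\big)^{p-1}<\infty$, the supremum over all cubes with sides parallel to the axes. $\|f|L_{p,w}(M)\|=(\int_M|f(x)|^pw(x)\,dx)^{1/p}$. Weighted Morrey norm ($1<p<\infty$, $-\frac np\le r<0$, $w\in A_p$): $\|f|L^r_p(w,\mathbb{R}^n)\|=\sup_{J\in\mathbb{Z},M\in\mathbb{Z}^n}w(Q_{J,M})^{-(\frac1p+\frac rn)}\|f|L_{p,w}(Q_{J,M})\|$, where $Q_{J,M}=2^{-J}(M+[-1,1]^n)$. Norms may take the value $+\infty$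 (then inequalities with right-hand side $+\infty$ are trivial). *)

(* Defs.v *)
From HB Require Import structures.
From mathcomp Require Import all_boot all_order all_algebra.
From mathcomp Require Import all_classical all_reals all_analysis.
From mathcomp Require Import measurable_realfun.

Set Implicit Arguments.
Unset Strict Implicit.
Unset Printing Implicit Defensive.

Import Order.TTheory GRing.Theory Num.Theory.
Import numFieldNormedType.Exports.

Local Open Scope classical_set_scope.
Local Open Scope ring_scope.

Section integral_ae.
Import HBNNSimple.
Local Open Scope ereal_scope.
Context d (T : measurableType d) (R : realType).
Variable m : {measure set T -> \bar R}.

Let le_integral_ae (f g : T -> \bar R) :
  (forall x, 0 <= f x) -> (forall x, 0 <= g x) ->
  {ae m, forall x, f x = g x} -> \int[m]_x f x <= \int[m]_x g x.
Proof.
move=> f0 g0 [N [mN N0 subN]].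
rewrite [leLHS]ge0_integralTE// [leRHS]ge0_integralTE//.
apply: ge_ereal_sup => _ [h /= hf <-].
have mNc : measurable (~` N) by exact: measurableC.
have projE x : proj_nnsfun h mNc x = (h \_ (~` N)) x.
  by rewrite (mrestrict h mNc).
apply: ereal_sup_ubound; exists (proj_nnsfun h mNc).
  move=> x; rewrite projE /patch; case: ifPn => [|_]; last exact: g0.
  rewrite inE => Nx; rewrite (le_trans (hf x))//.
  suff -> : f x = g x by [].
  by apply: contrapT => fg; apply: Nx; exact: subN.
rewrite -!integralT_nnsfun.
apply: ge0_ae_eq_integral => //.
- exact/measurable_EFinP.
- exact/measurable_EFinP.
- by move=> x _; rewrite lee_fin.
- by move=> x _; rewrite lee_fin.
exists N; split => // x /= /not_implyP[_ hx]; apply: contrapT => Nx; apply: hx.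
by have /= -> := projE x; rewrite patchT// inE.
Qed.

Lemma eq_integral_ae D (f g : T -> \bar R) : {ae m, forall x, f x = g x} ->
  \int[m]_(x in D) f x = \int[m]_(x in D) g x.
Proof.
move=> fg; rewrite integral_mkcond [RHS]integral_mkcond.
rewrite integralE [RHS]integralE; congr (_ - _).
all: apply/eqP; rewrite eq_le !le_integral_ae//.
all: by apply: filterS fg => x fgx; rewrite ?(funeposE, funenegE) /patch fgx.
Qed.

End integral_ae.

(* Points of R^n are tuples, with the library's product sigma-algebra (that is,
   the Borel sigma-algebra of R^n). *)
Notation Rn R n := (n.-tuple (measurableTypeR R)).

Section lebesgue_Rn.
Context {R : realType}.

Definition Rn_cons n (x : measurableTypeR R * Rn R n) : Rn R n.+1 :=
  [the n.+1.-tuple _ of x.1 :: x.2].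

Lemma measurable_Rn_cons n : measurable_fun [set: _] (@Rn_cons n).
Proof. exact: measurable_cons. Qed.

Section step.
Local Open Scope ereal_scope.
Variables (n : nat) (m : {sigma_finite_measure set (Rn R n) -> \bar R}).

(* The image of the product measure under R x R^n ~ R^(n+1). *)
Definition lebesgue_Rn_step : set (Rn R n.+1) -> \bar R :=
  pushforward (@lebesgue_measure R \x m) (@Rn_cons n).

Let step0 : lebesgue_Rn_step set0 = 0.
Proof. by rewrite /lebesgue_Rn_step /pushforward preimage_set0 measure0. Qed.

Let step_ge0 A : 0 <= lebesgue_Rn_step A.
Proof. by rewrite /lebesgue_Rn_step /pushforward measure_ge0. Qed.

Let mpre A : measurable A -> measurable (@Rn_cons n @^-1` A).
Proof. by move=> mA; rewrite -[X in measurable X]setTI; exact: measurable_Rn_cons. Qed.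

Let step_sigma_additive : semi_sigma_additive lebesgue_Rn_step.
Proof.
move=> F mF tF mUF; rewrite /lebesgue_Rn_step /pushforward preimage_bigcup.
apply: measure_semi_sigma_additive.
- by move=> k; exact: mpre.
- apply/trivIsetP => /= i j _ _ ij; rewrite -preimage_setI.
  by move/trivIsetP : tF => /(_ _ _ _ _ ij) ->//; rewrite preimage_set0.
- by rewrite -preimage_bigcup; exact: mpre.
Qed.

HB.instance Definition _ := isMeasure.Build _ _ _ lebesgue_Rn_step
  step0 step_ge0 step_sigma_additive.

Definition Rn_uncons (t : Rn R n.+1) : measurableTypeR R * Rn R n :=
  (thead t, [tuple of behead t]).

Let Rn_consK : cancel (@Rn_cons n) Rn_uncons.
Proof.
by move=> [x t]; congr pair; exact/val_inj.
Qed.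

Let Rn_unconsK : cancel Rn_uncons (@Rn_cons n).
Proof. by move=> t; rewrite [RHS]tuple_eta; exact/val_inj. Qed.

Let measurable_Rn_uncons : measurable_fun [set: _] Rn_uncons.
Proof.
apply/measurable_fun_pairP; split => /=; first exact: measurable_tnth.
exact: measurable_behead.
Qed.

Let step_sigma_finite : sigma_finite setT lebesgue_Rn_step.
Proof.
have /sigma_finiteP[F [FT ndF Foo]] := sigma_finiteT (@lebesgue_measure R).
have /sigma_finiteP[G [GT ndG Goo]] := sigma_finiteT m.
exists (fun k => Rn_uncons @^-1` (F k `*` G k)).
  rewrite -preimage_bigcup (_ : \bigcup_k _ = setT) ?preimage_setT//.
  rewrite -setXTT FT GT predeqE => -[x y]; split.
    by move=> [k _ []/= ? ?]; split; exists k.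
  move=> [/= [k _ Fkx] [l _ Gly]]; exists (maxn k l) => //; split.
  - by move: x Fkx; exact/subsetPset/ndF/leq_maxl.
  - by move: y Gly; exact/subsetPset/ndG/leq_maxr.
move=> k; have [mF Fk] := Foo k; have [mG Gk] := Goo k; split.
  rewrite -[X in measurable X]setTI; apply: measurable_Rn_uncons => //.
  exact: measurableX.
rewrite /lebesgue_Rn_step /pushforward -comp_preimage.
rewrite (_ : _ \o _ = id); last by apply/funext => x; exact: Rn_consK.
by rewrite preimage_id product_measure1E// lte_mul_pinfty// ge0_fin_numE.
Qed.

HB.instance Definition _ := Measure_isSigmaFinite.Build _ _ _ lebesgue_Rn_step
  step_sigma_finite.

End step.

Fixpoint lebesgue_Rn n : {sigma_finite_measure set (Rn R n) -> \bar R} :=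
  match n with
  | 0 => @dirac _ (Rn R 0) [tuple] R
  | k.+1 => lebesgue_Rn_step (lebesgue_Rn k)
  end.

Lemma lebesgue_Rn_box n (A : 'I_n -> set (measurableTypeR R)) :
  (forall i, measurable (A i)) ->
  lebesgue_Rn n [set x | forall i, A i (tnth x i)] =
  (\prod_(i < n) @lebesgue_measure R (A i))%E.
Proof.
elim: n A => [|n IH] A mA.
  rewrite big_ord0 /= diracE mem_set//; first by move=> [].
rewrite big_ord_recl /= /lebesgue_Rn_step /pushforward.
have mB : measurable [set x : Rn R n | forall i, A (lift ord0 i) (tnth x i)].
  rewrite (_ : [set x | _] = \bigcap_(i in [set: 'I_n])
      ((@tnth n (measurableTypeR R) ^~ i) @^-1` A (lift ord0 i))); last first.
    by apply/seteqP; split => [x Ax i _|x Ax i]; [exact: Ax|exact: (Ax i I)].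
  apply: fin_bigcap_measurable => // i _.
  by rewrite -[X in measurable X]setTI; exact: measurable_tnth.
rewrite (_ : _ @^-1` _ =
    A ord0 `*` [set x : Rn R n | forall i, A (lift ord0 i) (tnth x i)]).
  by rewrite product_measure1E// (IH (fun i => A (lift ord0 i))).
apply/seteqP; split => [[x t] /= H|[x t] /= [H0 H] i].
  split; first by have := H ord0.
  by move=> i; have := H (lift ord0 i); rewrite tnthS.
case: (unliftP ord0 i) => [j ->|->]; last exact: H0.
by rewrite /Rn_cons tnthS; exact: H.
Qed.

End lebesgue_Rn.

Section weighted_Morrey.
Context {R : realType} {n : nat}.
Implicit Types (f w : Rn R n -> R) (M : set (Rn R n)) (p r : R).

Local Notation mu := (@lebesgue_Rn R n).

(* mu is defined on the Borel sets; a function is Lebesgue measurable iff it is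
   almost everywhere equal to a Borel one.  The library's integral is defined
   for every function and only depends on its almost everywhere class (see
   eq_integral_ae), so on such functions it is the Lebesgue integral. *)
Definition Lebesgue_measurable f :=
  exists2 g : Rn R n -> R,
    measurable_fun setT g & {ae mu, forall x, f x = g x}.

(* Tuples carry no topology in the library: compactness is that of the
   corresponding set of row vectors. *)
Definition compact_Rn (K : set (Rn R n)) :=
  compact ((fun x => (\row_i (tnth x i : R)) : 'rV[R]_n) @` K).

Definition L1loc f := Lebesgue_measurable f /\
  forall K, compact_Rn K -> (\int[mu]_(x in K) (`|f x|)%:E < +oo)%E.

Definition wmeas w M : \bar R := (\int[mu]_(x in M) (w x)%:E)%E.

(* c + h [-1, 1]^n *)
Definition cube (c : Rn R n) (h : R) : set (Rn R n) :=
  [set x : Rn R n | forall i, `|(tnth x i : R) - tnth c i| <= h].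

(* 2^-J (M + [-1, 1]^n) *)
Definition dyadic_cube (J : int) (M : n.-tuple int) : set (Rn R n) :=
  cube [tuple 2 ^ (- J) * (tnth M i)%:~R | i < n] (2 ^ (- J)).

Definition conj_exp p : R := p / (p - 1).

Definition Ap_const p w : \bar R :=
  ereal_sup [set (wmeas w (cube c h) / mu (cube c h) *
    (wmeas (fun x => w x `^ (1 - conj_exp p))%R (cube c h) / mu (cube c h))
      `^ (p - 1))%E | c in setT & h in [set h : R | 0 < h]].

Definition Ap p w :=
  [/\ L1loc w, {ae mu, forall x, 0 < w x} & (Ap_const p w < +oo)%E].

Definition wLnorm p w M f : \bar R :=
  ((\int[mu]_(x in M) (`|f x| `^ p * w x)%:E) `^ p^-1)%E.

Definition Morrey_norm p r w f : \bar R :=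
  ereal_sup [set (wmeas w (dyadic_cube J M) `^ (- (p^-1 + r / n%:R))
    * wLnorm p w (dyadic_cube J M) f)%E
    | J in [set: int] & M in [set: n.-tuple int]].

End weighted_Morrey.

(* Main.v *)
Require Import Defs.
From mathcomp Require Import all_boot all_order all_algebra.
From mathcomp Require Import all_classical all_reals all_analysis.
From mathcomp Require Import measurable_realfun ring lra.
Set Implicit Arguments.
Unset Strict Implicit.
Unset Printing Implicit Defensive.
Import Order.TTheory GRing.Theory Num.Theory.
Import numFieldNormedType.Exports.
Local Open Scope classical_set_scope.
Local Open Scope ring_scope.

(** The proof is an extrapolation argument in which the constant [c1 w] may depend
    on the weight in an uncontrolled way; uniformity is recovered by packing a
    whole sequence of hypothetical counterexamples into a single weight.

    From [p1] to [p], all [A_p] weights: if no constant worked for [w] in [A_p],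
    pairs [(g_k, f_k)] violating the inequality with fast growing constants
    could be rescaled so that [f = sum 2^-k f_k] is in [L_p(w)] and the functions
    dual to the [g_k] sum up to some [u] in [L_p'(sigma)], where
    [sigma = w^(1-p')].  The Rubio de Francia algorithm yields A_1-type majorants
    [h] of [f] and [v] of [u]; then [h^(1-p1) v] is in [A_p1], and the hypothesis
    for this one weight contradicts the choice of the pairs.

    From [L_p] to Morrey spaces: put [b = 1 + p r / n] in [[0, 1)] and [b < e < 1].
    For a dyadic cube [Q] with successive enlargements [Q_0 = Q, Q_1, ...], the
    function [phi_Q = sum_k (w(Q) / w(Q_k))^e 1_(Q_k)] satisfies an A_1 condition
    relative to [w], is at least 1 on [Q], and [int f^p phi_Q w] is at most
    [C w(Q)^b] times the [p]-th power of the Morrey norm of [f], because [w(Q_k)]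
    grows geometrically.  If the Morrey inequality failed along pairs
    [(g_k, f_k)] and cubes [Q^k], the [A_p] weight
    [w sum_k 2^-k w(Q^k)^(-b) phi_(Q^k)] would contradict the [L_p] inequality.

    Muckenhoupt's theorem, needed by the Rubio de Francia algorithm, is proved
    following Lerner, from Vitali's lemma and the maximal theorem for doubling
    weights.  Hoelder's and Minkowski's inequalities are replaced throughout by
    pointwise case distinctions, which lose harmless constants. *)

(** * Elementary inequalities *)

(** Extrapolation usually chooses a weight for each pair, with constants that depend only on the A_p
    characteristic. Here a single weight must serve infinitely many pairs. The weight [h^(1-p1) v]
    does, because everything is compared with one finite number, int h v: pointwise g v <= h v +
    g^p1 h^(1-p1) v, while f <= h gives f^p1 h^(1-p1) v <= h v. The resulting bound does not see the
    index k, whereas the pairings of the rescaled g_k with their dual functions grow like 4^k.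

    In the Morrey step the two bounds on e are two convergence conditions: e > b makes the integrals
    of f^p w over the enlargements of Q summable against the coefficients of phi_Q, and e < 1 makes
    coefficient times w-mass grow geometrically, which gives the A_1 condition.

    The analysis is done for an abstract countable family of cells, so that maximal functions are
    countable suprema. The cubes of the Morrey norm are such a family: their half-side equals the
    lattice spacing, so they overlap, and every cube lies in one of them of comparable size. Hence
    A_p over cells and A_p over all cubes agree up to null sets. *)

Section elementary_inequalities.
Context {R : realType}.
Implicit Types a b g h p q t w B : R.

Lemma conj_exp_gt1 p : 1 < p -> 1 < conj_exp p.
Proof.
move=> p1; rewrite /conj_exp ltr_pdivlMr ?mul1r; last lra.
by rewrite ltrBlDr ltrDl.
Qed.

Lemma conj_expK p : 1 < p -> conj_exp (conj_exp p) = p.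
Proof. by move=> p1; rewrite /conj_exp; field; lra. Qed.

Lemma conj_exp_mul p : 1 < p -> (1 - conj_exp p) * (p - 1) = - 1.
Proof. by move=> p1; rewrite /conj_exp; field; lra. Qed.

Lemma conj_exp_mulp p : 1 < p -> (p - 1) * conj_exp p = p.
Proof. by move=> p1; rewrite /conj_exp; field; lra. Qed.

Lemma powRsubK a p : 0 <= a -> 0 < p -> a `^ (p - 1) * a = a `^ p.
Proof. by move=> a0 p0; rewrite mulrC mulr_powRB1. Qed.

Lemma powR_invr a p : 0 <= a -> a^-1 `^ p = (a `^ p)^-1.
Proof. by move=> a0; rewrite -powR_inv1// -powRrM mulN1r powRN. Qed.

Lemma powR_div a b p : 0 <= a -> 0 <= b -> (a / b) `^ p = a `^ p / b `^ p.
Proof. by move=> a0 b0; rewrite powRM ?invr_ge0// powR_invr. Qed.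

(** Stands in for Hoelder's inequality in [Muck_subset]: at t w(x), integrated over a set E, it
    bounds the measure of E by its w- and sigma-measures with a free parameter t. *)
Lemma le_add1_powRN t p : 1 < p -> 0 < t -> 1 <= t + t `^ (1 - conj_exp p).
Proof.
move=> p1 t0; have [t1|t1] := leP 1 t; first by rewrite ler_wpDr// powR_ge0.
rewrite ler_wpDl ?(ltW t0)//.
rewrite -[leLHS](powRr0 t); apply: ger_powR; first by rewrite t0 ltW.
by have := conj_exp_gt1 p1; lra.
Qed.

(** Discrete form of d(t^q) = q' t d(t^(q-1)), obtained from Young's inequality for a b^(q-1). It
    turns an increment of the q-th power into a level times an increment of the (q-1)-th power, and
    the weak-type estimate bounds level times measure. *)
Lemma powR_sub_le a b q : 1 < q -> 0 <= b -> b <= a ->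
  a `^ q - b `^ q <= conj_exp q * (a `^ (q - 1) - b `^ (q - 1)) * a.
Proof.
move=> q1 b0 ba; have a0 : 0 <= a by exact: le_trans ba.
have q0 : 0 < q by lra.
have c1 := conj_exp_gt1 q1.
have := @conjugate_powR _ a (b `^ (q - 1)) q (conj_exp q) a0 (powR_ge0 _ _) q0.
rewrite -powRrM conj_exp_mulp// => /(_ _ _)H.
have {}H : a * b `^ (q - 1) <= a `^ q / q + b `^ q / conj_exp q.
  apply: H; first lra.
  by rewrite /conj_exp; field; lra.
have {}H : conj_exp q * (a * b `^ (q - 1)) <=
    (conj_exp q - 1) * a `^ q + b `^ q.
  rewrite (_ : _ + _ = conj_exp q * (a `^ q / q + b `^ q / conj_exp q)); last first.
    by rewrite /conj_exp; field; lra.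
  by rewrite ler_pM2l//; lra.
have -> : conj_exp q * (a `^ (q - 1) - b `^ (q - 1)) * a =
    conj_exp q * a `^ q - conj_exp q * (a * b `^ (q - 1)).
  by rewrite -(powRsubK a0 q0); ring.
move: (a `^ q) (b `^ q) (conj_exp q * _) H => x y z; lra.
Qed.

(** Young's inequality with constant 1, by comparing v with h^(p-1) w. It makes h v integrable for h
    in L_p(w) and v in L_p'(sigma). *)
Lemma mul_le_powR_weight h v w p : 1 < p -> 0 < h -> 0 < v -> 0 < w ->
  h * v <= h `^ p * w + v `^ conj_exp p * w `^ (1 - conj_exp p).
Proof.
move=> p1 h0 v0 w0; have p0 : 0 < p by lra.
have c1 := conj_exp_gt1 p1.
have [vh|vh] := leP v (h `^ (p - 1) * w).
  rewrite ler_wpDr ?mulr_ge0 ?powR_ge0//.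
  by rewrite -(mulr_powRB1 (ltW h0) p0) -mulrA ler_wpM2l// ltW.
rewrite ler_wpDl ?mulr_ge0 ?powR_ge0 ?(ltW w0)//.
rewrite -[v `^ _]powRsubK ?(ltW v0)//; last lra.
rewrite mulrAC ler_wpM2r ?(ltW v0)//.
have -> : v `^ (conj_exp p - 1) * w `^ (1 - conj_exp p) =
    (v * w^-1) `^ (conj_exp p - 1).
  rewrite powRM ?invr_ge0 ?ltW//; congr (_ * _).
  by rewrite -powR_inv1 ?ltW// -powRrM; congr (_ `^ _); lra.
have hK : (h `^ (p - 1)) `^ (conj_exp p - 1) = h.
  rewrite -powRrM mulrBr conj_exp_mulp// mulr1 opprB addrCA subrr addr0.
  by rewrite powRr1// ltW.
rewrite -{1}hK; apply: ge0_ler_powR; first lra.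
- by rewrite nnegrE powR_ge0.
- by rewrite nnegrE mulr_ge0// ?invr_ge0 ltW.
by rewrite ler_pdivlMr// ltW.
Qed.

Lemma le_add_powR_mul g h p : 1 < p -> 0 <= g -> 0 < h ->
  g <= h + g `^ p * h `^ (1 - p).
Proof.
move=> p1 g0 h0; have [gh|hg] := leP g h.
  by rewrite ler_wpDr// mulr_ge0// powR_ge0.
rewrite ler_wpDl ?(ltW h0)//.
rewrite -mulr_powRB1//; last lra.
rewrite -mulrA ler_peMr//.
rewrite (_ : h `^ (1 - p) = (h `^ (p - 1))^-1); last by rewrite -powRN opprB.
rewrite ler_pdivlMr ?powR_gt0// mul1r.
by apply: ge0_ler_powR; rewrite ?nnegrE ?(ltW hg) ?(ltW h0)//; lra.
Qed.

Local Open Scope ereal_scope.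

Lemma le_poweR (x y : \bar R) r : (0 <= r)%R -> 0 <= x -> x <= y -> x `^ r <= y `^ r.
Proof.
move=> r0 x0 xy; apply: gt0_ler_poweR => //.
- by rewrite in_itv/= x0 leey.
- by rewrite in_itv/= (le_trans x0 xy) leey.
Qed.

(** Split at g = 2 B f. The coefficient 1/2 is what allows the g-term to be absorbed in
    [gmax_bound]. *)
Lemma young_absorb (f : \bar R) g q B : (1 < q)%R -> (0 < B)%R -> (0 <= g)%R -> 0 <= f ->
  B%:E * (f * (g `^ (q - 1))%:E) <=
  (2^-1 * g `^ q)%:E + (B * (2 * B) `^ (q - 1))%:E * f `^ q.
Proof.
move=> q1 B0 g0; have q0 : (0 < q)%R by lra.
have c0 : (0 < B * (2 * B) `^ (q - 1))%R by rewrite mulr_gt0 ?powR_gt0; lra.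
case: f => [f||//].
  rewrite lee_fin => f0; rewrite poweR_EFin -!EFinM -EFinD lee_fin.
  have [gf|fg] := leP g (2 * B * f)%R.
    rewrite ler_wpDl ?mulr_ge0 ?powR_ge0//.
    have -> : (B * (2 * B) `^ (q - 1) * f `^ q = B * (f * (2 * B * f) `^ (q - 1)))%R.
      rewrite [((2 * B * f) `^ _)%R]powRM//; last by rewrite mulr_ge0// ltW.
      by rewrite -(mulr_powRB1 f0 q0); ring.
    rewrite (ler_pM2l B0) ler_wpM2l//; apply: ge0_ler_powR => //; first lra.
    by rewrite nnegrE !mulr_ge0// ltW.
  rewrite ler_wpDr ?mulr_ge0 ?powR_ge0 ?(ltW B0)//.
  rewrite -(powRsubK g0 q0).
  have := ler_wpM2r (powR_ge0 g (q - 1)) (ltW fg); lra.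
move=> _; rewrite eqy_poweR//.
by rewrite gt0_muley ?lte_fin// addey ?leey.
Qed.

Lemma sum_geometric_le (x c : R) n : (0 <= x < 1)%R -> (0 <= c)%R ->
  (\sum_(0 <= k < n) (c * x ^+ k) <= c / (1 - x))%R.
Proof.
move=> /andP[x0 x1] c0; have [->|xn0] := eqVneq x 0%R.
  case: n => [|n]; first by rewrite big_geq// subr0 divr1.
  rewrite big_nat_recl//= expr0 mulr1 big1 ?addr0 ?subr0 ?divr1// => i _.
  by rewrite exprS mul0r mulr0.
have := @geometric_le_lim R n c x c0.
by rewrite lt_def xn0 x0 ger0_norm// => /(_ isT x1).
Qed.

Lemma nneseries_geometric_bound (x c : R) : (0 <= x < 1)%R -> (0 <= c)%R ->
  \sum_(k <oo) (c * x ^+ k)%:E <= (c / (1 - x))%:E.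
Proof.
move=> xx c0; have /andP[x0 x1] := xx; apply: lime_le.
  by apply: is_cvg_nneseries => n _ _; rewrite lee_fin mulr_ge0// exprn_ge0.
by apply: nearW => n; rewrite sumEFin lee_fin sum_geometric_le.
Qed.

Lemma nneseries_half (c : R) : (0 <= c)%R ->
  \sum_(k <oo) (c * 2^-1 ^+ k)%:E <= (2 * c)%:E.
Proof.
move=> c0; apply: (le_trans (nneseries_geometric_bound _ c0)).
  by apply/andP; split; lra.
rewrite lee_fin (_ : (1 - 2^-1 = 2^-1 :> R)%R); last by field.
by rewrite invrK mulrC.
Qed.

Lemma nneseries_term_le (u : nat -> \bar R) k : (forall i, 0 <= u i) ->
  u k <= \sum_(i <oo) u i.
Proof.
move=> u0; rewrite (@nneseriesD1 _ u k xpredT)//.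
by rewrite leeDl// nneseries_ge0.
Qed.

(** Replaces Minkowski's inequality: with S the sum of the v_k^q, each v_k is at most S^(1/q), and
    the weights 2^-k add up to 2. *)
Lemma poweR_nneseries_half_le (v : nat -> \bar R) q : (0 < q)%R -> (forall k, 0 <= v k) ->
  (\sum_(k <oo) (2^-1 ^+ k)%:E * v k) `^ q <= (2 `^ q)%:E * \sum_(k <oo) v k `^ q.
Proof.
move=> q0 v0; set S := \sum_(k <oo) v k `^ q.
have S0 : 0 <= S by apply: nneseries_ge0 => *; exact: poweR_ge0.
have vS k : v k <= S `^ q^-1.
  rewrite -[v k]poweRe1// -(mulfV (lt0r_neq0 q0)) poweRrM.
  apply: le_poweR; rewrite ?invr_ge0 ?(ltW q0) ?poweR_ge0//.
  by apply: (@nneseries_term_le (fun k => v k `^ q)) => *; exact: poweR_ge0.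
have -> : (2 `^ q)%:E * S = (2%:E * S `^ q^-1) `^ q.
  by rewrite poweRM ?poweR_ge0// poweR_EFin -poweRrM mulVf ?gt_eqF// poweRe1.
apply: le_poweR; first exact: ltW.
  by apply: nneseries_ge0 => k _ _; rewrite mule_ge0// lee_fin exprn_ge0.
have := poweR_ge0 S q^-1; case: (S `^ q^-1) vS => [s vS|_ _|//].
  rewrite lee_fin => s0.
  apply: le_trans (nneseries_half s0); apply: lee_nneseries => [k _ _|k _].
    by rewrite mule_ge0// lee_fin exprn_ge0.
  by rewrite mulrC EFinM lee_wpmul2l// lee_fin exprn_ge0.
by rewrite gt0_muley ?lte_fin// leey.
Qed.

End elementary_inequalities.

(** * Covering bases and Muckenhoupt weights *)

Section nonneg_integrals.
Local Open Scope ereal_scope.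
Context d (T : measurableType d) (R : realType) (mu : {measure set T -> \bar R}).
Implicit Types (f g : T -> \bar R) (w : T -> R) (A B : set T) (c p : R).

Lemma le_integralT f g : measurable_fun setT f -> measurable_fun setT g ->
  (forall x, 0 <= f x) -> (forall x, f x <= g x) ->
  \int[mu]_x f x <= \int[mu]_x g x.
Proof. by move=> mf mg f0 fg; apply: ge0_le_integral. Qed.

Lemma ge0_integral_le (A B : set T) f : measurable A -> measurable B ->
  measurable_fun setT f -> (forall x, 0 <= f x) -> A `<=` B ->
  \int[mu]_(x in A) f x <= \int[mu]_(x in B) f x.
Proof.
move=> mA mB mf f0 AB; apply: ge0_subset_integral => //.
exact: measurable_funS mf.
Qed.

Lemma integralZT c f : measurable_fun setT f -> (forall x, 0 <= f x) ->
  (0 <= c)%R -> \int[mu]_x (c%:E * f x) = c%:E * \int[mu]_x f x.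
Proof. by move=> mf f0 c0; rewrite ge0_integralZl_EFin. Qed.

Lemma integralDT f g : measurable_fun setT f -> measurable_fun setT g ->
  (forall x, 0 <= f x) -> (forall x, 0 <= g x) ->
  \int[mu]_x (f x + g x) = \int[mu]_x f x + \int[mu]_x g x.
Proof. by move=> mf mg f0 g0; rewrite ge0_integralD. Qed.

Lemma measurable_poweRT f p : measurable_fun setT f ->
  measurable_fun setT (fun x => f x `^ p).
Proof.
move=> mf.
exact: (@measurableT_comp _ _ _ _ _ _ (@poweR R ^~ p)) (measurable_poweR _) mf.
Qed.

Lemma measurable_powRT w p : measurable_fun setT w ->
  measurable_fun setT (fun x => w x `^ p)%R.
Proof. by move=> mw; exact: (@measurableT_comp _ _ _ _ _ _ (@powR R ^~ p)). Qed.

Lemma measurable_invT w : (forall x, 0 < w x)%R -> measurable_fun setT w ->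
  measurable_fun setT (fun x => (w x)^-1)%R.
Proof.
move=> w0 mw.
rewrite (_ : (fun x => _) = (fun x => w x `^ (- 1))%R); first exact: measurable_powRT.
by apply/funext => x; rewrite powR_inv1// ltW.
Qed.

Lemma measurable_wprod f w : measurable_fun setT f -> measurable_fun setT w ->
  measurable_fun setT (fun x => f x * (w x)%:E).
Proof.
by move=> mf mw; apply: emeasurable_funM => //; exact/measurable_EFinP.
Qed.

Definition wvol w A := \int[mu]_(x in A) (w x)%:E.

Lemma wvol_ge0 w A : (forall x, 0 <= w x)%R -> 0 <= wvol w A.
Proof. by move=> w0; apply: integral_ge0 => x _; rewrite lee_fin. Qed.

Lemma wvol_le w A B : measurable_fun setT w -> (forall x, 0 <= w x)%R ->
  measurable A -> measurable B -> A `<=` B -> wvol w A <= wvol w B.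
Proof.
by move=> mw w0 mA mB AB; apply: ge0_integral_le => //; exact/measurable_EFinP.
Qed.

Lemma wvolZ w A c : measurable_fun setT w -> (forall x, 0 <= w x)%R ->
  measurable A -> (0 <= c)%R ->
  c%:E * wvol w A = wvol (fun x => c * w x)%R A.
Proof.
move=> mw w0 mA c0; rewrite /wvol -ge0_integralZl_EFin//.
  by move=> x _; rewrite lee_fin.
by apply: measurable_funTS; exact/measurable_EFinP.
Qed.

Lemma wvol_gt0 w A : measurable_fun setT w -> (forall x, 0 < w x)%R ->
  measurable A -> 0 < mu A -> 0 < wvol w A.
Proof.
move=> mw w0 mA A0; rewrite lt_def wvol_ge0 ?andbT; last by move=> x; exact: ltW.
apply/eqP => /= wA0; move: A0; apply/negP; rewrite -leNgt.
have /ae_eq_integral_abs : \int[mu]_(x in A) `|(w x)%:E| = 0.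
  rewrite -[RHS]wA0; apply: eq_integral => x _.
  by rewrite gee0_abs// lee_fin ltW.
move=> /(_ mA _)[|N [mN N0 AN]].
  by apply: measurable_funTS; exact/measurable_EFinP.
rewrite -N0 le_measure ?inE// => x Ax; apply: AN => /= /(_ Ax)[wx].
by have := w0 x; rewrite wx ltxx.
Qed.

End nonneg_integrals.

Section covering_basis.
Context d (T : measurableType d) (R : realType) (mu : {measure set T -> \bar R}).

(* [enl i] plays the role of the enlarged cube 3Q of Vitali's lemma, and
   [cell_reach] makes the iterated enlargements of any cell exhaust the space. *)
Record covering_basis := CoveringBasis {
  cell :> nat -> set T ;
  enl : nat -> nat ;
  vol : nat -> R ;
  dilation : R ;
  measurable_cell : forall i, measurable (cell i) ;
  vol_gt0 : forall i, 0 < vol i ;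
  mu_cell : forall i, mu (cell i) = (vol i)%:E ;
  dilation_gt1 : 1 < dilation ;
  vol_enl : forall i, vol (enl i) = dilation * vol i ;
  cell_engulf : forall i j, vol j <= vol i -> cell i `&` cell j !=set0 ->
    cell j `<=` cell (enl i) ;
  cell_reach : forall i x, exists2 j, cell j x & cell i `&` cell j !=set0
}.

Variable Q : covering_basis.
Implicit Types (w : T -> R) (p : R).

Definition dual_weight p w x := w x `^ (1 - conj_exp p).

(** The A_p condition over the cells, cleared of denominators. The integrals are extended reals
    here; [Muck_fin] shows that they are finite. *)
Definition Muck p w := [/\ measurable_fun setT w, forall x, 0 < w x &
  exists K : R, forall i,
    (wvol mu w (Q i) * wvol mu (dual_weight p w) (Q i) `^ (p - 1) <=
     (K * vol Q i `^ p)%:E)%E].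

Definition rvol w i : R := fine (wvol mu w (Q i)).

Lemma cell_nonempty i : Q i !=set0.
Proof.
apply/set0P/eqP => Q0; have := mu_cell Q i.
by rewrite Q0 measure0 => -[]/eqP; rewrite lt_eqF// vol_gt0.
Qed.

Lemma cell_enl i : Q i `<=` Q (enl Q i).
Proof. by apply: cell_engulf => //; rewrite setIid; exact: cell_nonempty. Qed.

Lemma vol_iter k i : vol Q (iter k (enl Q) i) = dilation Q ^+ k * vol Q i.
Proof. by elim: k => [|k IH]; rewrite ?mul1r// iterS vol_enl IH exprS mulrA. Qed.

Lemma cell_iter_le i k l : (k <= l)%N ->
  Q (iter k (enl Q) i) `<=` Q (iter l (enl Q) i).
Proof.
move=> /subnK <-; elim: (l - k)%N => [//|m IH]; rewrite addSn iterS.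
exact: subset_trans (@cell_enl _).
Qed.

Lemma vol_iter_large i (x : R) : exists k, x <= vol Q (iter k (enl Q) i).
Proof.
have r1 := dilation_gt1 Q; have v0 := vol_gt0 Q i.
have r10 : 0 < dilation Q - 1 by lra.
have [k xk] : exists k : nat, x / vol Q i / (dilation Q - 1) <= k%:R.
  exists (Num.bound `|x / vol Q i / (dilation Q - 1)|).
  exact: le_trans (ler_norm _) (ltW (archi_boundP _)).
exists k; rewrite vol_iter -ler_pdivrMr//.
rewrite ler_pdivrMr// in xk; apply: (le_trans xk).
have : 1 + k%:R * (dilation Q - 1) <= dilation Q ^+ k.
  elim: {xk} k => [|k IH]; first by rewrite mul0r addr0 expr0.
  rewrite exprS; apply: le_trans (ler_wpM2l (_ : 0 <= dilation Q) IH); last lra.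
  rewrite -natr1; have : 0 <= k%:R * (dilation Q - 1) * (dilation Q - 1).
    by rewrite !mulr_ge0 ?(ltW r10).
  lra.
lra.
Qed.

(** Some cell j contains x and meets cell i. Once an enlargement of i is at least as large as j, the
    next one engulfs j. *)
Lemma cell_iter_cover i x : exists k, Q (iter k (enl Q) i) x.
Proof.
have [j Qjx ij] := cell_reach Q i x.
have [k jk] := vol_iter_large i (vol Q j).
exists k.+1; rewrite iterS; apply: (cell_engulf jk _ Qjx).
by have [y [Qiy Qjy]] := ij; exists y; split => //; exact: (@cell_iter_le i 0 k).
Qed.

End covering_basis.

(** * Duality, doubling and growth of Muckenhoupt weights *)

Section Muckenhoupt_weights.
Context d (T : measurableType d) (R : realType) (mu : {measure set T -> \bar R}).
Variable Q : covering_basis mu.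
Implicit Types (w : T -> R) (p : R).

Lemma dual_weight_gt0 p w x : 0 < w x -> 0 < dual_weight p w x.
Proof. exact: powR_gt0. Qed.

Lemma measurable_dual_weight p w : measurable_fun setT w ->
  measurable_fun setT (dual_weight p w).
Proof.
exact: measurable_powRT.
Qed.

Lemma dual_weightK p w : 1 < p -> (forall x, 0 < w x) ->
  dual_weight (conj_exp p) (dual_weight p w) = w.
Proof.
move=> p1 w0; apply/funext => x; rewrite /dual_weight -powRrM conj_expK//.
rewrite (_ : _ * _ = 1) ?powRr1 ?(ltW (w0 x))//.
by have := conj_exp_mul p1; lra.
Qed.

Lemma wvol_cell_gt0 w i : measurable_fun setT w -> (forall x, 0 < w x) ->
  (0 < wvol mu w (Q i))%E.
Proof.
move=> mw w0; apply: wvol_gt0 => //; first exact: measurable_cell.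
by rewrite mu_cell lte_fin vol_gt0.
Qed.

(** The dual integral is positive, so an infinite factor would make the product infinite. *)
Lemma Muck_fin p w i : 1 < p -> Muck Q p w -> (wvol mu w (Q i) < +oo)%E.
Proof.
move=> p1 [mw w0 [K /(_ i)]]; rewrite ltey; apply: contraTneq => ->.
rewrite gt0_mulye; last first.
  apply: poweR_gt0; apply: wvol_cell_gt0; first exact: measurable_dual_weight.
  by move=> x; exact: dual_weight_gt0.
by rewrite -ltNge ltry.
Qed.

(** The condition for p, raised to the power p' - 1 = 1/(p - 1), is the condition for p' with the
    two integrals exchanged. *)
Lemma Muck_dual p w : 1 < p -> Muck Q p w ->
  Muck Q (conj_exp p) (dual_weight p w).
Proof.
move=> p1 Mw; have [mw w0 [K HK]] := Mw.
have c1 := conj_exp_gt1 p1.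
split; [exact: measurable_dual_weight|by move=> x; exact: dual_weight_gt0|].
exists (K `^ (conj_exp p - 1)) => i; rewrite dual_weightK//.
have s0 : (0 < wvol mu (dual_weight p w) (Q i))%E.
  apply: wvol_cell_gt0; first exact: measurable_dual_weight.
  by move=> x; exact: dual_weight_gt0.
have W0 := wvol_cell_gt0 i mw w0.
have v0 := vol_gt0 Q i.
have K0 : 0 <= K.
  have := le_trans (mule_ge0 (ltW W0) (poweR_ge0 _ _)) (HK i).
  by rewrite lee_fin pmulr_lge0// powR_gt0.
have e1 : (p - 1) * (conj_exp p - 1) = 1.
  by rewrite mulrBr conj_exp_mulp//; lra.
have H : ((wvol mu w (Q i) * wvol mu (dual_weight p w) (Q i) `^ (p - 1)) `^ (conj_exp p - 1) <=
  (K * vol Q i `^ p)%:E `^ (conj_exp p - 1))%E.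
  apply: le_poweR => //; first lra.
  by rewrite mule_ge0 ?poweR_ge0// ltW.
move: H; rewrite poweRM ?poweR_ge0 ?(ltW W0)// -poweRrM e1 poweRe1 ?(ltW s0)//.
rewrite muleC poweR_EFin powRM ?powR_ge0// -powRrM.
rewrite (_ : p * (conj_exp p - 1) = conj_exp p)//.
by rewrite /conj_exp; field; lra.
Qed.

Lemma wvol_rvol p w i : 1 < p -> Muck Q p w -> wvol mu w (Q i) = (rvol Q w i)%:E.
Proof.
move=> p1 Mw; rewrite /rvol fineK// ge0_fin_numE ?(Muck_fin i p1 Mw)//.
by case: Mw => _ w0 _; apply: wvol_ge0 => x; exact: ltW.
Qed.

Lemma rvol_gt0 p w i : 1 < p -> Muck Q p w -> 0 < rvol Q w i.
Proof.
move=> p1 Mw; rewrite -lte_fin -(wvol_rvol i p1 Mw).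
by case: Mw => mw w0 _; exact: wvol_cell_gt0.
Qed.

Lemma Muck_rvol p w : 1 < p -> Muck Q p w -> exists2 K : R, 0 < K &
  forall i, rvol Q w i * rvol Q (dual_weight p w) i `^ (p - 1) <= K * vol Q i `^ p.
Proof.
move=> p1 Mw; have [mw w0 [K HK]] := Mw.
have H i : rvol Q w i * rvol Q (dual_weight p w) i `^ (p - 1) <= K * vol Q i `^ p.
  have := HK i; rewrite (wvol_rvol i p1 Mw).
  rewrite (wvol_rvol i (conj_exp_gt1 p1) (Muck_dual p1 Mw)).
  by rewrite poweR_EFin -EFinM lee_fin.
exists K => //; rewrite -(pmulr_lgt0 _ (powR_gt0 p (vol_gt0 Q 0))).
apply: lt_le_trans (H 0%N).
rewrite mulr_gt0 ?(rvol_gt0 _ p1 Mw)// powR_gt0//.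
exact: (rvol_gt0 _ (conj_exp_gt1 p1) (Muck_dual p1 Mw)).
Qed.

(** A subset with a fixed share of the volume of a cell carries a fixed share of its weight.
    Doubling and growth both follow. *)
Lemma Muck_subset p w : 1 < p -> Muck Q p w -> exists2 K : R, 0 < K &
  forall i E a, measurable E -> E `<=` Q i -> mu E = a%:E ->
    a `^ p * rvol Q w i <= K * vol Q i `^ p * fine (wvol mu w E).
Proof.
move=> p1 Mw; have [K K0 HK] := Muck_rvol p1 Mw.
have [mw w0 _] := Mw; set s := dual_weight p w in HK *.
have ms : measurable_fun setT s by exact: measurable_dual_weight.
have s0 x : 0 < s x by exact: dual_weight_gt0.
have Ms := Muck_dual p1 Mw.
exists (2 `^ p * K); first by rewrite mulr_gt0// powR_gt0.
move=> i E a mE EQ Ea; have mQ := measurable_cell Q i.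
have wE0 : (0 <= wvol mu w E)%E by apply: wvol_ge0 => x; exact: ltW.
have [->|a0] := eqVneq a 0.
  rewrite powR0 ?mul0r; last lra.
  by rewrite !mulr_ge0 ?powR_ge0 ?fine_ge0// ltW.
have {}a0 : 0 < a.
  by rewrite lt_def a0/= -lee_fin -Ea measure_ge0.
have wEW : (wvol mu w E <= (rvol Q w i)%:E)%E.
  by rewrite -(wvol_rvol i p1 Mw); apply: wvol_le => // x; exact: ltW.
have wEf : wvol mu w E \is a fin_num.
  by rewrite ge0_fin_numE// (le_lt_trans wEW)// ltry.
have sES : (wvol mu s E <= (rvol Q s i)%:E)%E.
  rewrite -(wvol_rvol i (conj_exp_gt1 p1) Ms).
  by apply: wvol_le => // x; exact: ltW.
set S := rvol Q s i in sES *; set W := rvol Q w i in HK wEW *.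
have S0 : 0 < S by exact: (rvol_gt0 _ (conj_exp_gt1 p1) Ms).
have W0 : 0 < W by exact: (rvol_gt0 _ p1 Mw).
(* With this t the sigma-term is at most t^(1-p') S = a/2, so it can be subtracted from the left
   side a. *)
set t := (2 * S / a) `^ (p - 1).
have t0 : 0 < t by rewrite powR_gt0// divr_gt0// mulr_gt0.
have tE : t `^ (1 - conj_exp p) = a / (2 * S).
  rewrite /t -powRrM [(p - 1) * _]mulrC conj_exp_mul// powR_inv1 ?invf_div//.
  by rewrite divr_ge0// ?mulr_ge0// ltW.
have H : (a%:E <= t%:E * wvol mu w E + (a / (2 * S))%:E * wvol mu s E)%E.
  have mE' u : measurable_fun setT u -> measurable_fun E (EFin \o u).
    by move=> mu'; apply: measurable_funTS; exact/measurable_EFinP.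
  have tS0 : 0 <= a / (2 * S) by rewrite divr_ge0// ?mulr_ge0// ltW.
  rewrite /wvol -ge0_integralZl_EFin ?(ltW t0)//; first last.
  - exact: mE'.
  - by move=> x _; rewrite lee_fin ltW.
  rewrite -ge0_integralZl_EFin//; first last.
  - exact: mE'.
  - by move=> x _; rewrite lee_fin ltW.
  rewrite -ge0_integralD//; first last.
  - by apply: measurable_funTS; apply/measurable_EFinP; exact: measurable_funM.
  - by move=> x _; rewrite lee_fin mulr_ge0// ?divr_ge0// ?mulr_ge0// ltW.
  - by apply: measurable_funTS; apply/measurable_EFinP; exact: measurable_funM.
  - by move=> x _; rewrite lee_fin mulr_ge0// ltW.
  rewrite -[leLHS]mul1e -Ea -integral_cst//; apply: ge0_le_integral => //=.
  - by apply: measurable_funTS; apply: emeasurable_funD; apply/measurable_EFinP; exact: measurable_funM.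
  - move=> x _; rewrite lee_fin; have := le_add1_powRN p1 (mulr_gt0 t0 (w0 x)).
    by rewrite [(t * _) `^ _]powRM ?(ltW t0) ?(ltW (w0 x))// tE.
have {}H : a / 2 <= t * fine (wvol mu w E).
  have : (a%:E <= t%:E * wvol mu w E + (a / 2)%:E)%E.
    apply: (le_trans H); rewrite leeD2l//.
    apply: (le_trans (lee_wpmul2l _ sES)).
      by rewrite lee_fin divr_ge0// ?mulr_ge0// ltW.
    by rewrite -EFinM lee_fin invfM mulrA divfK ?gt_eqF.
  rewrite -(fineK wEf) -EFinM -EFinD lee_fin; lra.
have ta : t * a `^ (p - 1) = (2 * S) `^ (p - 1).
  rewrite -powRM ?divfK ?gt_eqF ?(ltW a0)//.
  by rewrite divr_ge0// ?mulr_ge0// ltW.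
have p0 : 0 < p by lra.
have e2 : 2 `^ p = 2 * 2 `^ (p - 1) :> R by rewrite mulr_powRB1.
rewrite -(mulr_powRB1 (ltW a0) p0) e2.
have := ler_wpM2r (powR_ge0 a (p - 1)) H.
rewrite [t * _ * _]mulrAC ta powRM ?(ltW S0)// => {}H.
have := ler_wpM2r (ltW W0) H => {}H.
have := ler_wpM2l (_ : 0 <= 2 * 2 `^ (p - 1) * fine (wvol mu w E)) (HK i).
move=> /(_ _) HK'.
have {HK'} : 2 * 2 `^ (p - 1) * fine (wvol mu w E) * (W * S `^ (p - 1)) <=
   2 * 2 `^ (p - 1) * fine (wvol mu w E) * (K * vol Q i `^ p).
  by apply: HK'; rewrite !mulr_ge0 ?powR_ge0// fine_ge0.
move: (powR a _) (powR 2 _) (powR S _) (powR (vol _ _) _) (fine _) H => x1 x2 x3 x4 x5.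
nra.
Qed.

Lemma Muck_doubling p w : 1 < p -> Muck Q p w ->
  exists2 C : R, 0 < C & forall i, rvol Q w (enl Q i) <= C * rvol Q w i.
Proof.
move=> p1 Mw; have [K K0 HK] := Muck_subset p1 Mw.
have D0 : 0 < dilation Q by have := dilation_gt1 Q; lra.
exists (K * dilation Q `^ p); first by rewrite mulr_gt0// powR_gt0.
move=> i; have := HK (enl Q i) (Q i) (vol Q i) (measurable_cell _ _) (@cell_enl _ _ _ _ Q i) (mu_cell _ _).
have v0 := vol_gt0 Q i.
rewrite vol_enl [(dilation Q * _) `^ _]powRM ?(ltW D0) ?(ltW v0)// -/(rvol Q w i).
have vp0 : 0 < vol Q i `^ p by rewrite powR_gt0.
by rewrite mulrA [X in _ <= X * _]mulrC -!mulrA (ler_pM2l vp0).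
Qed.

(** [Muck_subset] is applied to the enlarged cell minus the cell: its share of the volume is (D -
    1)/D with D the dilation, so it carries at least the share z of the weight. *)
Lemma Muck_growth p w : 1 < p -> Muck Q p w ->
  exists2 x : R, 0 < x < 1 & forall i, rvol Q w i <= x * rvol Q w (enl Q i).
Proof.
move=> p1 Mw; have [K K0 HK] := Muck_subset p1 Mw.
have D1 := dilation_gt1 Q; have D0 : 0 < dilation Q by lra.
have [mw w0 _] := Mw.
pose z := (dilation Q - 1) `^ p / (K * dilation Q `^ p).
have z0 : 0 < z by rewrite divr_gt0 ?mulr_gt0 ?powR_gt0//; lra.
have H i : rvol Q w i <= (1 - z) * rvol Q w (enl Q i).
  have mi := measurable_cell Q i; have me := measurable_cell Q (enl Q i).
  have mE : measurable (Q (enl Q i) `\` Q i) by exact: measurableD.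
  have Ea : mu (Q (enl Q i) `\` Q i) = ((dilation Q - 1) * vol Q i)%:E.
    have eoo : (mu (Q (enl Q i)) < +oo)%E by rewrite mu_cell ltry.
    have -> : mu (Q (enl Q i) `\` Q i) =
        (mu (Q (enl Q i)) - mu (Q (enl Q i) `&` Q i))%E := measureD me mi eoo.
    rewrite setIidr; last exact: (@cell_enl _ _ _ _ Q).
    by rewrite !(mu_cell Q) vol_enl -EFinB mulrBl mul1r.
  have := HK (enl Q i) _ _ mE (@subDsetl _ _ _) Ea.
  have v0 := vol_gt0 Q i.
  have vp0 : 0 < vol Q i `^ p by rewrite powR_gt0.
  rewrite vol_enl [(dilation Q * _) `^ _]powRM ?(ltW D0) ?(ltW v0)//.
  rewrite [((dilation Q - 1) * _) `^ _]powRM ?(ltW v0)//; last lra.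
  have -> : fine (wvol mu w (Q (enl Q i) `\` Q i)) =
      rvol Q w (enl Q i) - rvol Q w i.
    have : wvol mu w (Q (enl Q i)) = (wvol mu w (Q (enl Q i) `\` Q i) + wvol mu w (Q i))%E.
      rewrite /wvol -ge0_integral_setU//.
      - by rewrite setUC setDUK//; exact: (@cell_enl _ _ _ _ Q).
      - by apply: measurable_funTS; exact/measurable_EFinP.
      - by move=> x _; rewrite lee_fin ltW.
      - by apply/disj_setPS => x [[_ Qx] /Qx].
    rewrite (wvol_rvol _ p1 Mw) (wvol_rvol _ p1 Mw) => /eqP.
    have : (wvol mu w (Q (enl Q i) `\` Q i) <= (rvol Q w (enl Q i))%:E)%E.
      rewrite -(wvol_rvol _ p1 Mw); apply: wvol_le => // x.
      exact: ltW.
    have : (0 <= wvol mu w (Q (enl Q i) `\` Q i))%E.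
      by apply: wvol_ge0 => x; exact: ltW.
    case: (wvol _ _ _) => // r _ _ /eqP[->]/=; lra.
  rewrite /z.
  set A := (dilation Q - 1) `^ p; set B := dilation Q `^ p; set V := vol Q i `^ p.
  have B0 : 0 < B by exact: powR_gt0.
  move=> HH; have {}HH : A * rvol Q w (enl Q i) <= K * B * (rvol Q w (enl Q i) - rvol Q w i).
    by rewrite -(ler_pM2r (vp0 : 0 < V)); clearbody A B V; lra.
  rewrite mulrBl mul1r lerBrDr -lerBrDl.
  by rewrite mulrAC ler_pdivrMr ?mulr_gt0// [leRHS]mulrC.
exists (1 - z) => //; apply/andP; split; last lra.
have := lt_le_trans (rvol_gt0 0%N p1 Mw) (H 0%N).
by rewrite pmulr_lgt0// (rvol_gt0 _ p1 Mw).
Qed.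

End Muckenhoupt_weights.

(** * Maximal operators *)

Section maximal_operator.
Context d (T : measurableType d) (R : realType) (mu : {measure set T -> \bar R}).
Variable Q : covering_basis mu.
Implicit Types (f : T -> \bar R) (v : T -> R) (s t : seq nat).

(** All that the maximal theorem asks of the measure v dx; it is applied to both w and sigma. *)
Definition doubling v := [/\ measurable_fun setT v, forall x, 0 < v x,
  forall i, wvol mu v (Q i) = (rvol Q v i)%:E, forall i, 0 < rvol Q v i &
  exists2 C : R, 0 < C & forall i, rvol Q v (enl Q i) <= C * rvol Q v i].

Lemma Muck_is_doubling p v : 1 < p -> Muck Q p v -> doubling v.
Proof.
move=> p1 Mv; have [mv v0 _] := Mv; split=> //.
- by move=> i; exact: wvol_rvol p1 Mv.
- by move=> i; exact: rvol_gt0 p1 Mv.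
- exact: Muck_doubling p1 Mv.
Qed.

Definition cells s := \big[setU/set0]_(i <- s) Q i.

Lemma cellsP s x : cells s x <-> exists2 i, i \in s & Q i x.
Proof.
rewrite /cells; elim: s => [|i s IH]; first by rewrite big_nil; split=> // -[].
rewrite big_cons; split=> [[Qx|/IH[j js Qx]]|[j]].
- by exists i => //; rewrite mem_head.
- by exists j => //; rewrite inE js orbT.
by rewrite inE => /orP[/eqP->|js Qx]; [left|right; apply/IH; exists j].
Qed.

Lemma measurable_cells s : measurable (cells s).
Proof. by apply: bigsetU_measurable => i _; exact: measurable_cell. Qed.

(** Greedy selection from the largest cell to the smallest, as a recursion on an increasing list:
    the head is the smallest, so any selected cell that it meets engulfs it after enlargement. *)
Lemma vitali_sorted s : sorted (fun i j => vol Q i <= vol Q j) s ->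
  exists t, [/\ {subset t <= s}, uniq t, trivIset [set` t] Q &
    forall i, i \in s -> exists2 j, j \in t & Q i `<=` Q (enl Q j)].
Proof.
elim: s => [|i s IH].
  by move=> _; exists [::]; split=> // i j /=; rewrite in_nil.
move=> /= is_; have [t [ts ut tt tc]] := IH (path_sorted is_).
have /allP imin := order_path_min (fun b a c => @le_trans _ _ (vol Q b) (vol Q a) (vol Q c)) is_.
have [[j [jt ij]]|meets] := pselect (exists j, j \in t /\ Q j `&` Q i !=set0).
  exists t; split=> //.
    by move=> k /ts ks; rewrite inE ks orbT.
  move=> k; rewrite inE => /orP[/eqP->|/tc//].
  by exists j => //; apply: cell_engulf ij; apply: imin; exact: ts.
have Qdisj j : j \in t -> Q j `&` Q i = set0.
  move=> jt; apply: contrapT => /eqP/set0P ij; apply: meets; exists j; split=> //.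
exists (i :: t); split.
- by move=> k; rewrite !inE => /orP[->//|/ts ->]; rewrite orbT.
- rewrite /= ut andbT; apply/negP => /Qdisj; rewrite setIid.
  by apply/eqP/set0P; exact: cell_nonempty.
- apply/trivIsetP => k l /=; rewrite !inE => /orP[/eqP->|kt] /orP[/eqP->|lt].
  + by rewrite eqxx.
  + by rewrite setIC => _; exact: Qdisj.
  + by move=> _; exact: Qdisj.
  + by move/trivIsetP : tt; apply.
- move=> k; rewrite inE => /orP[/eqP->|/tc[j jt kj]].
    by exists i; [rewrite mem_head|exact: cell_enl].
  by exists j => //; rewrite inE jt orbT.
Qed.

Lemma vitali_cells s :
  exists t, [/\ {subset t <= s}, uniq t, trivIset [set` t] Q &
    forall i, i \in s -> exists2 j, j \in t & Q i `<=` Q (enl Q j)].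
Proof.
have [|t [ts ut tt tc]] := @vitali_sorted (sort (fun i j => vol Q i <= vol Q j) s).
  by apply: sort_sorted => i j; exact: le_total.
exists t; split=> //; first by move=> i /ts; rewrite mem_sort.
by move=> i si; apply: tc; rewrite mem_sort.
Qed.

Definition wint v f (A : set T) : \bar R := (\int[mu]_(x in A) (f x * (v x)%:E))%E.

Local Open Scope ereal_scope.

Lemma wvol_bigcup_le v s (A : nat -> set T) : measurable_fun setT v ->
  (forall x, 0 < v x)%R -> (forall i, measurable (A i)) ->
  wvol mu v (\big[setU/set0]_(i <- s) A i) <= \sum_(i <- s) wvol mu v (A i).
Proof.
move=> mv v0 mA; elim: s => [|i s IH].
  by rewrite !big_nil /wvol integral_set0.
rewrite !big_cons; set U := \big[setU/set0]_(j <- s) A j in IH *.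
have mU : measurable U by exact: bigsetU_measurable.
have -> : A i `|` U = A i `|` (U `\` A i) by rewrite setUDr setDv setD0.
rewrite /wvol ge0_integral_setU//.
- rewrite leeD2l//; apply: le_trans IH; apply: wvol_le => //.
  + by move=> x; exact: ltW.
  + by apply: measurableD.
- by apply: measurableD.
- by apply: measurable_funTS; exact/measurable_EFinP.
- by move=> x _; rewrite lee_fin ltW.
- by apply/disj_setPS => x [Ax [_ /(_ Ax)]].
Qed.

Section strong_type.
Variables (v : T -> R) (C q : R).
Hypotheses (mv : measurable_fun setT v) (v0 : forall x, (0 < v x)%R).
Hypotheses (vfin : forall i, wvol mu v (Q i) = (rvol Q v i)%:E).
Hypotheses (rv0 : forall i, (0 < rvol Q v i)%R) (C0 : (0 < C)%R).
Hypothesis vC : forall i, (rvol Q v (enl Q i) <= C * rvol Q v i)%R.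
Hypothesis q1 : (1 < q)%R.

Let q0 : (0 < q)%R. Proof. by have := q1; lra. Qed.
Let qq0 : (0 < q - 1)%R. Proof. by have := q1; lra. Qed.

Section one_function.
Variable f : T -> \bar R.
Hypotheses (mf : measurable_fun setT f) (f0 : forall x, 0 <= f x).

Let fv0 x : 0 <= f x * (v x)%:E.
Proof. by rewrite mule_ge0// lee_fin ltW. Qed.

Let wint_ge0 A : 0 <= wint v f A.
Proof. by apply: integral_ge0 => x _. Qed.

(** The Vitali subfamily costs the doubling constant once, and its disjointness keeps the integral
    of f on the union of the given cells. This localisation lets the layers be summed against f in
    [layer_int_le]. *)
Lemma weak_type s (a : R) : (0 <= a)%R ->
  (forall i, i \in s -> (a * rvol Q v i)%:E <= wint v f (Q i)) ->
  a%:E * wvol mu v (cells s) <= C%:E * wint v f (cells s).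
Proof.
move=> a0 Ha; have [t [ts ut tt tc]] := vitali_cells s.
have sub : cells s `<=` \big[setU/set0]_(j <- t) Q (enl Q j).
  move=> x /cellsP[i /tc[j jt ij] Qx]; rewrite -bigcup_seq.
  by exists j => //; exact: ij.
have mE i : measurable (Q (enl Q i)) by exact: measurable_cell.
have H1 : wvol mu v (cells s) <= \sum_(j <- t) wvol mu v (Q (enl Q j)).
  apply: le_trans (wvol_bigcup_le _ mv v0 mE); apply: wvol_le => //.
  - by move=> x; exact: ltW.
  - exact: measurable_cells.
  - exact: bigsetU_measurable.
have H2 : a%:E * wvol mu v (cells s) <= C%:E * \sum_(j <- t) wint v f (Q j).
  apply: (le_trans (lee_wpmul2l _ H1)); rewrite ?lee_fin//.
  rewrite !ge0_sume_distrr//; last first.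
    by move=> i _; apply: wvol_ge0 => x; exact: ltW.
  rewrite big_seq [leRHS]big_seq; apply: lee_sum => i /ts it.
  rewrite vfin -EFinM; apply: (@le_trans _ _ (C%:E * (a * rvol Q v i)%:E)).
    by rewrite -EFinM lee_fin mulrCA ler_wpM2l.
  by rewrite lee_wpmul2l ?lee_fin ?(ltW C0)//; exact: Ha.
apply: (le_trans H2); rewrite lee_wpmul2l ?lee_fin ?(ltW C0)//.
rewrite /wint -ge0_integral_bigsetU//; last 2 first.
- exact: measurable_cell.
- by apply: measurable_funTS; exact: measurable_wprod.
apply: ge0_integral_le => //.
- by apply: bigsetU_measurable => i _; exact: measurable_cell.
- exact: measurable_cells.
- exact: measurable_wprod.
by move=> x /cellsP[i /ts it Qx]; apply/cellsP; exists i.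
Qed.

Section levels.
Variable a : nat -> R.
Hypothesis a0 : forall i, (0 <= a i)%R.

(* [layer e s b] is [(gmax s)^e - b^e] on the union of the cells of [s] when
   [s] is sorted by increasing levels [a i >= b]: a discrete layer-cake
   decomposition, whose terms are controlled by the weak-type estimate. *)
Fixpoint layer (e : R) s (b : R) (x : T) : R :=
  if s is i :: s' then
    layer e s' (a i) x + (a i `^ e - b `^ e) * \1_(cells s) x
  else 0%R.

Definition gmax s x : R := \big[Num.max/0%R]_(i <- s) (a i * \1_(Q i) x)%R.

Lemma gmax_ge0 s x : (0 <= gmax s x)%R.
Proof. by rewrite /gmax; elim: s => [|i s IH]; rewrite ?big_nil// big_cons le_max IH orbT. Qed.

Lemma gmax_ge s i x : i \in s -> (a i * \1_(Q i) x <= gmax s x)%R.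
Proof.
rewrite /gmax; elim: s => [//|j s IH]; rewrite inE big_cons le_max.
by move=> /orP[/eqP->|/IH->]; rewrite ?lexx ?orbT.
Qed.

Lemma gmax_notin s x : ~ cells s x -> gmax s x = 0%R.
Proof.
elim: s => [_|i s IH sx]; first by rewrite /gmax big_nil.
rewrite /gmax big_cons -/(gmax s x) IH; last first.
  by move=> /cellsP[j js Qx]; apply: sx; apply/cellsP; exists j => //; rewrite inE js orbT.
rewrite indicE memNset ?mulr0 ?maxxx// => Qx.
by apply: sx; apply/cellsP; exists i => //; rewrite mem_head.
Qed.

(** The head has the lowest level: on the union of the tail it does not change [gmax] and the
    increments telescope; elsewhere in its own cell [gmax] is [a i]. *)
Lemma layerE e s b x : (0 < e)%R -> sorted (fun i j => a i <= a j)%R s ->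
  layer e s b x = ((gmax s x `^ e - b `^ e) * \1_(cells s) x)%R.
Proof.
move=> e0; elim: s b => [|i s IH] b.
  by move=> _; rewrite /cells big_nil indic0 mulr0.
move=> /= is_; rewrite IH ?(path_sorted is_)//.
have /allP imin := order_path_min (fun b a' c => @le_trans _ _ (a b) (a a') (a c)) is_.
rewrite !indicE; have [xs|xs] := boolP (x \in cells s); last first.
  rewrite mulr0 add0r; have [xis|] := boolP (x \in cells _); last by rewrite !mulr0.
  rewrite !mulr1; congr (_ `^ _ - _)%R.
  have Qx : Q i x.
    move: xis xs; rewrite inE notin_setE => /cellsP[j]; rewrite inE => /orP[/eqP->//|js Qx].
    by move=> /(_ _)/[!cellsP]; case; exists j.
  rewrite /gmax big_cons -/(gmax s x) gmax_notin; last by rewrite notin_setE in xs.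
  by rewrite indicE mem_set// mulr1 max_l.
have -> : x \in cells (i :: s).
  move: xs; rewrite !inE => /cellsP[j js Qx]; apply/cellsP; exists j => //.
  by rewrite inE js orbT.
have -> : gmax (i :: s) x = gmax s x.
  rewrite {1}/gmax big_cons -/(gmax s x) max_r//.
  move: xs; rewrite inE => /cellsP[j js Qx].
  apply: le_trans (gmax_ge x js); rewrite !indicE (mem_set Qx) mulr1.
  by case: (x \in _); rewrite ?mulr1 ?mulr0//; exact: imin.
by rewrite !mulr1 addrA subrK.
Qed.

Lemma measurable_layer e s b : measurable_fun setT (layer e s b).
Proof.
elim: s b => [|i s IH] b /=; first exact: measurable_cst.
apply: measurable_funD; first exact: IH.
by apply: measurable_funM => //; apply: measurable_indic; exact: measurable_cells.
Qed.

Lemma layer_ge0 e s b x : (0 <= e)%R -> (0 <= b)%R -> path (fun i j => i <= j)%R b (map a s) ->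
  (0 <= layer e s b x)%R.
Proof.
move=> e0; elim: s b => [//|i s IH] b b0 /= /andP[bi is_].
rewrite addr_ge0 ?IH// mulr_ge0 ?subr_ge0//.
by apply: ge0_ler_powR; rewrite ?nnegrE.
Qed.

Let layer_int e s b := \int[mu]_x (layer e s b x * v x)%:E.
Let flayer_int e s b := \int[mu]_x (f x * (layer e s b x * v x)%:E).

Lemma layer_int_cons e i s b : (0 <= e)%R -> (0 <= b)%R -> path (fun i j => i <= j)%R b (map a (i :: s)) ->
  layer_int e (i :: s) b = layer_int e s (a i) +
    (a i `^ e - b `^ e)%:E * wvol mu v (cells (i :: s)).
Proof.
move=> e0 b0 /= /andP[bi is_]; set U := cells (i :: s).
have mU : measurable U by exact: measurable_cells.
have c0 : (0 <= a i `^ e - b `^ e)%R.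
  by rewrite subr_ge0; apply: ge0_ler_powR; rewrite ?nnegrE.
rewrite /layer_int /wvol [in X in _ + _ * X]integral_mkcond.
rewrite -ge0_integralZl_EFin//; first last.
- by apply/(measurable_restrictT _ mU); apply: measurable_funTS; exact/measurable_EFinP.
- by move=> x _; apply: erestrict_ge0 => y _; rewrite lee_fin ltW.
rewrite -ge0_integralD//; first last.
- apply: measurable_funeM.
  by apply/(measurable_restrictT _ mU); apply: measurable_funTS; exact/measurable_EFinP.
- move=> x _; rewrite mule_ge0 ?lee_fin//; apply: erestrict_ge0 => y _.
  by rewrite lee_fin ltW.
- by apply/measurable_EFinP; apply: measurable_funM => //; exact: measurable_layer.
- by move=> x _; rewrite lee_fin mulr_ge0 ?layer_ge0// ltW.
apply: eq_integral => x _ /=; rewrite -/U mulrDl EFinD; congr (_ + _).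
rewrite patchE indicE; case: ifPn => _; rewrite ?mulr1 ?mulr0 ?mul0r ?mule0//.
Qed.

Lemma flayer_int_cons e i s b : (0 <= e)%R -> (0 <= b)%R -> path (fun i j => i <= j)%R b (map a (i :: s)) ->
  flayer_int e (i :: s) b = flayer_int e s (a i) +
    (a i `^ e - b `^ e)%:E * wint v f (cells (i :: s)).
Proof.
move=> e0 b0 /= /andP[bi is_]; set U := cells (i :: s).
have mU : measurable U by exact: measurable_cells.
have c0 : (0 <= a i `^ e - b `^ e)%R.
  by rewrite subr_ge0; apply: ge0_ler_powR; rewrite ?nnegrE.
have mfU : measurable_fun setT ((fun x => f x * (v x)%:E) \_ U).
  by apply/(measurable_restrictT _ mU); apply: measurable_funTS; exact: measurable_wprod.
rewrite /flayer_int /wint [in X in _ + _ * X]integral_mkcond.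
rewrite -ge0_integralZl_EFin//; last by move=> x _; exact: erestrict_ge0.
rewrite -ge0_integralD//; first last.
- exact: measurable_funeM.
- by move=> x _; rewrite mule_ge0 ?lee_fin//; exact: erestrict_ge0.
- apply: emeasurable_funM => //; apply/measurable_EFinP.
  by apply: measurable_funM => //; exact: measurable_layer.
- by move=> x _; rewrite mule_ge0// lee_fin mulr_ge0 ?layer_ge0// ltW.
apply: eq_integral => x _ /=; rewrite -/U mulrDl EFinD ge0_muleDr; last 2 first.
- by rewrite lee_fin mulr_ge0 ?layer_ge0// ltW.
- by rewrite lee_fin !mulr_ge0 ?indicE//; exact: ltW.
congr (_ + _).
rewrite patchE indicE; case: ifPn => _; rewrite ?mulr1 ?mulr0 ?mul0r ?mule0//.
by rewrite EFinM muleCA.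
Qed.

Lemma layer_int_fin e s b : (0 <= e)%R -> (0 <= b)%R -> path (fun i j => i <= j)%R b (map a s) ->
  layer_int e s b < +oo.
Proof.
move=> e0; elim: s b => [|i s IH] b b0 ps.
  by rewrite /layer_int; under eq_integral do rewrite mul0r; rewrite integral0 ltry.
rewrite layer_int_cons//; apply: lte_add_pinfty.
  by apply: IH => //; case/andP: ps.
rewrite lte_mul_pinfty//.
  case/andP: ps => bi _; rewrite lee_fin subr_ge0.
  by apply: ge0_ler_powR; rewrite ?nnegrE.
apply: (le_lt_trans (wvol_bigcup_le _ mv v0 (measurable_cell Q))).
by under eq_bigr do rewrite vfin; rewrite sumEFin ltry.
Qed.

(** Termwise: all remaining cells have level at least [a i], so [weak_type] applies to their union
    at that level, after [powR_sub_le] has extracted one factor [a i]. *)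
Lemma layer_int_le s b : (0 <= b)%R -> path (fun i j => i <= j)%R b (map a s) ->
  (forall i, i \in s -> (a i * rvol Q v i)%:E <= wint v f (Q i)) ->
  layer_int q s b <= (conj_exp q * C)%:E * flayer_int (q - 1) s b.
Proof.
have c1 := conj_exp_gt1 q1.
elim: s b => [|i s IH] b b0 ps Ha.
  rewrite /layer_int; under eq_integral do rewrite mul0r.
  rewrite integral0 mule_ge0//.
    by rewrite lee_fin mulr_ge0 ?(ltW C0)// ltW// (lt_trans _ c1).
  by apply: integral_ge0 => x _ /=; rewrite mul0r mule0.
have := ps; move=> /= /andP[bi is_].
rewrite layer_int_cons ?(ltW q0)// flayer_int_cons ?(ltW qq0)//.
have c0 : (0 <= a i `^ (q - 1) - b `^ (q - 1))%R.
  by rewrite subr_ge0; apply: ge0_ler_powR; rewrite ?nnegrE// ltW.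
rewrite [leRHS]ge0_muleDr; last 2 first.
- rewrite /flayer_int; apply: integral_ge0 => x _.
  rewrite mule_ge0// lee_fin mulr_ge0 ?(ltW (v0 x))//.
  by rewrite layer_ge0// ltW.
- by rewrite mule_ge0.
apply: leeD.
  by apply: IH => // j js; apply: Ha; rewrite inE js orbT.
have sa : sorted (fun i j => i <= j)%R (map a (i :: s)) by [].
have H := @weak_type (i :: s) (a i) (a0 i).
have {}H : (a i)%:E * wvol mu v (cells (i :: s)) <= C%:E * wint v f (cells (i :: s)).
  apply: H => j js; apply: le_trans (Ha _ js).
  rewrite lee_fin ler_wpM2r ?(ltW (rv0 j))//.
  move: js; rewrite inE => /orP[/eqP->//|js].
  have /allP := order_path_min le_trans is_; apply.
  exact: map_f.
have wU0 : 0 <= wvol mu v (cells (i :: s)) by apply: wvol_ge0 => x; exact: ltW.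
apply: (@le_trans _ _ ((conj_exp q * (a i `^ (q - 1) - b `^ (q - 1)))%:E *
    ((a i)%:E * wvol mu v (cells (i :: s))))).
  rewrite muleA -EFinM lee_wpmul2r// lee_fin.
  exact: powR_sub_le.
apply: (le_trans (lee_wpmul2l _ H)).
  by rewrite lee_fin mulr_ge0// ltW// (lt_trans _ c1).
rewrite !muleA -!EFinM le_eqVlt; apply/orP; left; apply/eqP.
by congr (_%:E * _); ring.
Qed.

Let B := (conj_exp q * C)%R.

(** From base level 0 the layers are powers of [gmax], so int g^q v <= B int f g^(q-1) v for g =
    [gmax]. [young_absorb] bounds the right side by half of the left plus a multiple of int f^q v,
    and the left side is finite because only finitely many cells occur. *)
Lemma gmax_bound s : sorted (fun i j => a i <= a j)%R s ->
  (forall i, i \in s -> (a i * rvol Q v i)%:E <= wint v f (Q i)) ->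
  \int[mu]_x (gmax s x `^ q * v x)%:E <=
  (2 * (B * (2 * B) `^ (q - 1)))%:E * \int[mu]_x (f x `^ q * (v x)%:E).
Proof.
move=> ss Ha; have B0 : (0 < B)%R.
  by rewrite mulr_gt0// (lt_trans _ (conj_exp_gt1 q1)).
have ps : path (fun i j => i <= j)%R 0%R (map a s).
  by case: s ss {Ha} => //= i s; rewrite a0/= path_map.
have layE e x : (0 < e)%R -> layer e s 0 x = (gmax s x `^ e)%R.
  move=> e0; rewrite layerE// powR0 ?gt_eqF// subr0 indicE.
  have [_|] := boolP (x \in cells s); first by rewrite mulr1.
  by rewrite notin_setE => /gmax_notin->; rewrite powR0 ?gt_eqF// mul0r.
have A0 : (0 <= B * (2 * B) `^ (q - 1))%R.
  by rewrite mulr_ge0 ?powR_ge0 ?(ltW B0).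
have mg e : (0 < e)%R -> measurable_fun setT (fun x => gmax s x `^ e)%R.
  by move=> e0; rewrite -(funext (fun x => layE e x e0)); exact: measurable_layer.
pose u1 x := (gmax s x `^ q * v x)%:E.
pose u2 x := f x `^ q * (v x)%:E.
pose u3 x := f x * (layer (q - 1) s 0 x * v x)%:E.
have mu1 : measurable_fun setT u1.
  by apply/measurable_EFinP; apply: measurable_funM => //; exact: mg.
have mu2 : measurable_fun setT u2 by apply: measurable_wprod => //; exact: measurable_poweRT.
have mu3 : measurable_fun setT u3.
  by apply: measurable_wprod => //; apply: measurable_funM => //; exact: measurable_layer.
have u10 x : 0 <= u1 x by rewrite lee_fin mulr_ge0 ?powR_ge0// ltW.
have u20 x : 0 <= u2 x by rewrite mule_ge0 ?poweR_ge0// lee_fin ltW.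
have u30 x : 0 <= u3 x.
  by rewrite mule_ge0// lee_fin mulr_ge0 ?(ltW (v0 x))// layer_ge0// ltW.
rewrite -/(u1 _) -/(u2 _); set I := \int[mu]_x u1 x; set F := \int[mu]_x u2 x.
have IE : I = layer_int q s 0.
  by rewrite /layer_int; under [RHS]eq_integral do rewrite layE//.
have Ioo : I < +oo by rewrite IE layer_int_fin// ltW.
have I0 : 0 <= I by exact: integral_ge0.
have F0 : 0 <= F by exact: integral_ge0.
have : I <= (2^-1)%:E * I + (B * (2 * B) `^ (q - 1))%:E * F.
  rewrite [leLHS]IE; apply: (le_trans (layer_int_le _ ps Ha)) => //.
  rewrite -/B /flayer_int -!integralZT ?(ltW B0)// -integralDT//; first last.
  - by move=> x; rewrite mule_ge0.
  - by move=> x; rewrite mule_ge0.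
  - exact: measurable_funeM.
  - exact: measurable_funeM.
  apply: le_integralT.
  - exact: measurable_funeM.
  - by apply: emeasurable_funD; exact: measurable_funeM.
  - by move=> x; rewrite mule_ge0 ?lee_fin ?(ltW B0)//; exact: u30.
  move=> x; rewrite layE// /u1 /u2.
  have := lee_wpmul2r (_ : 0 <= (v x)%:E) (young_absorb q1 B0 (gmax_ge0 s x) (f0 x)).
  rewrite ge0_muleDl ?mule_ge0 ?poweR_ge0 ?lee_fin ?mulr_ge0 ?powR_ge0 ?invr_ge0 ?ler0n ?(ltW B0)//.
  by rewrite -!muleA -!EFinM -mulrA; apply; exact: ltW.
1-3: exact: ltW.
case: F F0 => [F F0| _ _|//]; last first.
  by rewrite gt0_muley ?leey// lte_fin pmulr_rgt0// pmulr_rgt0// powR_gt0// pmulr_rgt0.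
case: I I0 Ioo {IE} => [I I0 _|//|//].
by rewrite -!EFinM -EFinD !lee_fin; lra.
Qed.

End levels.

End one_function.

Lemma measurable_gmax a s : measurable_fun setT (gmax a s).
Proof.
rewrite /gmax; elim: s => [|i s IH].
  by under eq_fun do rewrite big_nil; exact: measurable_cst.
under eq_fun do rewrite big_cons.
apply: measurable_maxr => //; apply: measurable_funM => //.
by apply: measurable_indic; exact: measurable_cell.
Qed.

Lemma gmax_subset (a : nat -> R) s t x : (forall i, 0 <= a i)%R -> {subset s <= t} ->
  (gmax a s x <= gmax a t x)%R.
Proof.
move=> a0 st; rewrite {1}/gmax; elim: s st => [|i s IH] st.
  by rewrite big_nil gmax_ge0.
rewrite big_cons ge_max IH ?andbT; last by move=> j js; apply: st; rewrite inE js orbT.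
by apply: gmax_ge; apply: st; rewrite mem_head.
Qed.

End strong_type.



Definition avg v f i : \bar R := wint v f (Q i) * ((rvol Q v i)^-1)%:E.

Definition maxop v f x : \bar R :=
  ereal_sup (range (fun i => avg v f i * (\1_(Q i) x)%:E)).

Lemma maxop_ge v f i x : Q i x -> avg v f i <= maxop v f x.
Proof.
by move=> Qx; apply: ereal_sup_ubound; exists i; rewrite // indicE mem_set// mule1.
Qed.

Lemma avg_ge0 v f i : (forall x, 0 < v x)%R -> (forall x, 0 <= f x) -> 0 <= avg v f i.
Proof.
move=> v0 f0; rewrite mule_ge0 ?lee_fin ?invr_ge0 ?fine_ge0//.
  by apply: integral_ge0 => x _; rewrite mule_ge0// lee_fin ltW.
by apply: wvol_ge0 => x; exact: ltW.
Qed.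

Lemma maxop_ge0 v f x : (forall x, 0 < v x)%R -> (forall x, 0 <= f x) -> 0 <= maxop v f x.
Proof.
move=> v0 f0; have [k Qx] := cell_iter_cover Q 0 x.
exact: le_trans (avg_ge0 _ v0 f0) (maxop_ge v f Qx).
Qed.

Lemma measurable_maxop v f : measurable_fun setT (maxop v f).
Proof.
rewrite (_ : maxop v f = fun x => esups (fun i => avg v f i * (\1_(Q i) x)%:E) 0%N).
  apply: measurable_fun_esups => i; apply: measurable_funeM.
  by apply/measurable_EFinP; apply: measurable_indic; exact: measurable_cell.
apply/funext => x; rewrite /maxop /esups; congr ereal_sup.
by apply/seteqP; split => [_ [i _ <-]|_ [i _ <-]]; exists i.
Qed.

(** [gmax_bound] for the first N cells, with the averages of f as levels, followed by monotone
    convergence in N. *)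
Lemma maxop_bound v q : doubling v -> (1 < q)%R -> exists2 A : R, (0 < A)%R &
  forall f, measurable_fun setT f -> (forall x, 0 <= f x) ->
  \int[mu]_x (maxop v f x `^ q * (v x)%:E) <= A%:E * \int[mu]_x (f x `^ q * (v x)%:E).
Proof.
move=> [mv v0 vfin rv0 [C C0 vC]] q1; have q0 : (0 < q)%R by lra.
pose B := (conj_exp q * C)%R; pose A := (2 * (B * (2 * B) `^ (q - 1)))%R.
have A0 : (0 < A)%R.
  have B0 : (0 < B)%R by rewrite mulr_gt0// (lt_trans _ (conj_exp_gt1 q1)).
  by rewrite pmulr_rgt0// pmulr_rgt0// powR_gt0// pmulr_rgt0.
exists A => // f mf f0; set F := \int[mu]_x (f x `^ q * _).
have F0 : 0 <= F.
  by apply: integral_ge0 => x _; rewrite mule_ge0 ?poweR_ge0// lee_fin ltW.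
have [->|Foo] := eqVneq F +oo; first by rewrite gt0_muley ?leey.
(* By f <= 1 + f^q, so that the averages are real numbers and can serve as levels. *)
have wfin i : wint v f (Q i) < +oo.
  apply: (@le_lt_trans _ _ (wvol mu v (Q i) + F)); last first.
    by rewrite vfin lte_add_pinfty ?ltry// ltey.
  apply: (@le_trans _ _ (\int[mu]_(x in Q i) ((v x)%:E + f x `^ q * (v x)%:E))).
    apply: ge0_le_integral => //; first exact: measurable_cell.
    - by move=> x _; rewrite mule_ge0// lee_fin ltW.
    - by apply: measurable_funTS; exact: measurable_wprod.
    - apply: measurable_funTS; apply: emeasurable_funD; first exact/measurable_EFinP.
      by apply: measurable_wprod => //; exact: measurable_poweRT.
    - move=> x _; rewrite -[X in X + _]mul1e -ge0_muleDl ?poweR_ge0//.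
      rewrite lee_wpmul2r ?lee_fin ?(ltW (v0 x))//.
      have := f0 x; case: (f x) => [r r0|_|//]; last by rewrite eqy_poweR// addey// leey.
      rewrite poweR_EFin -EFinD lee_fin; have [r1|r1] := leP r 1%R.
        by rewrite ler_wpDr// powR_ge0.
      by rewrite ler_wpDl// le1r_powR// ltW.
  have mfq : measurable_fun setT (fun x => f x `^ q * (v x)%:E).
    by apply: measurable_wprod => //; exact: measurable_poweRT.
  rewrite (ge0_integralD _ (measurable_cell Q i)).
  - rewrite leeD2l//; apply: ge0_integral_le => //; first exact: measurable_cell.
    by move=> x; rewrite mule_ge0 ?poweR_ge0// lee_fin ltW.
  - by move=> x _; rewrite lee_fin ltW.
  - by apply: measurable_funTS; exact/measurable_EFinP.
  - by move=> x _; rewrite mule_ge0 ?poweR_ge0// lee_fin ltW.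
  - exact: measurable_funTS.
have w0 i : 0 <= wint v f (Q i).
  by apply: integral_ge0 => x _; rewrite mule_ge0// lee_fin ltW.
pose a i := fine (avg v f i).
have wE i : wint v f (Q i) = (a i * rvol Q v i)%:E.
  have := wfin i; rewrite /a /avg; case: (wint _ _ _) (w0 i) => //= r _ _.
  by rewrite divfK// gt_eqF.
have a0 i : (0 <= a i)%R by apply: fine_ge0; exact: avg_ge0.
have aE i : avg v f i = (a i)%:E.
  by rewrite /avg wE -EFinM mulfK// gt_eqF.
pose s N := sort (fun i j => a i <= a j)%R (iota 0 N).
pose g N x := (gmax a (s N) x `^ q * v x)%:E.
have gN N : \int[mu]_x g N x <= A%:E * F.
  apply: gmax_bound => // [|i _]; last by rewrite wE.
  by apply: sort_sorted => i j; exact: le_total.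
have mg N : measurable_fun setT (g N).
  apply/measurable_EFinP; apply: measurable_funM => //; apply: measurable_powRT.
  exact: measurable_gmax.
have g0 N x : 0 <= g N x by rewrite lee_fin mulr_ge0 ?powR_ge0// ltW.
have nd x : nondecreasing_seq (g ^~ x).
  move=> M N MN; rewrite lee_fin ler_wpM2r ?(ltW (v0 x))//.
  apply: ge0_ler_powR; rewrite ?nnegrE ?gmax_ge0 ?(ltW q0)//.
  apply: gmax_subset => // i; rewrite !mem_sort !mem_iota /= !add0n.
  by move=> /leq_trans; exact.
have mono := monotone_convergence mu measurableT mg (fun n x _ => g0 n x) (fun x _ => nd x).
have cvgg x : g ^~ x @ \oo --> limn (g ^~ x).
  by apply: ereal_nondecreasing_is_cvgn; exact: nd.
apply: (@le_trans _ _ (\int[mu]_x limn (g ^~ x))); last first.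
  rewrite mono; apply: lime_le; last exact: nearW.
  apply: ereal_nondecreasing_is_cvgn => M N MN.
  by apply: le_integralT => // x; exact: nd.
have gL x N : g N x <= limn (g ^~ x).
  rewrite (cvg_lim _ (ereal_nondecreasing_cvgn (nd x)))//.
  by apply: ereal_sup_ubound; exists N.
apply: le_integralT.
- apply: measurable_wprod => //; apply: measurable_poweRT; exact: measurable_maxop.
- by apply: (emeasurable_fun_cvg _ _ mg) => x _; exact: cvgg.
- by move=> x; rewrite mule_ge0 ?poweR_ge0// lee_fin ltW.
move=> x; set L := limn _; have vx := v0 x.
have L0 : 0 <= L by exact: le_trans (g0 0%N x) (gL x 0%N).
(* Solving for the maximal function avoids computing the limit: cell i is among the first i + 1
   cells, so its average is at most [gmax] at stage i + 1. *)
have H : maxop v f x <= (L * ((v x)^-1)%:E) `^ q^-1.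
  apply: ge_ereal_sup => _ [i _ <-]; rewrite aE -EFinM.
  have : (gmax a (s i.+1) x)%:E <= (L * ((v x)^-1)%:E) `^ q^-1.
    rewrite -[leLHS]poweRe1 ?lee_fin ?gmax_ge0// -(mulfV (lt0r_neq0 q0)) poweRrM.
    apply: le_poweR; rewrite ?invr_ge0 ?(ltW q0) ?poweR_ge0//.
    by rewrite lee_pdivlMr// poweR_EFin -EFinM; exact: gL.
  apply: le_trans; rewrite lee_fin; apply: gmax_ge.
  by rewrite mem_sort mem_iota /= add0n.
have {}H : maxop v f x `^ q <= L * ((v x)^-1)%:E.
  rewrite -[leRHS]poweRe1; last by rewrite mule_ge0// lee_fin invr_ge0 ltW.
  rewrite -(mulVf (lt0r_neq0 q0)) poweRrM.
  by apply: le_poweR => //; [exact: ltW|exact: maxop_ge0].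
by rewrite -lee_pdivlMr.
Qed.

End maximal_operator.

(** * Muckenhoupt's theorem: the maximal operator on L_p(w) *)

Section Muckenhoupt_theorem.
Context d (T : measurableType d) (R : realType) (mu : {measure set T -> \bar R}).
Variable Q : covering_basis mu.
Implicit Types (f : T -> \bar R) (w : T -> R) (p : R).
Local Open Scope ereal_scope.

Definition hlmax := maxop Q (cst 1%R).

Lemma rvol_cst1 i : rvol Q (cst 1%R) i = vol Q i.
Proof.
rewrite /rvol /wvol /= integral_cst; last exact: measurable_cell.
by rewrite mul1e mu_cell.
Qed.

Lemma avg_cst1 f i : avg Q (cst 1%R) f i = (\int[mu]_(x in Q i) f x) * ((vol Q i)^-1)%:E.
Proof.
by rewrite /avg rvol_cst1 /wint; under eq_integral do rewrite mule1.
Qed.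

Lemma hlmax_ge f i x : Q i x -> \int[mu]_(y in Q i) f y <= (vol Q i)%:E * hlmax f x.
Proof.
move=> Qx; have := maxop_ge (cst 1%R) f Qx; rewrite avg_cst1.
by rewrite lee_pdivrMr ?vol_gt0// muleC.
Qed.

Lemma hlmax_ge0 f x : (forall x, 0 <= f x) -> 0 <= hlmax f x.
Proof. by move=> f0; apply: maxop_ge0 => // y; rewrite ltr01. Qed.

Lemma measurable_hlmax f : measurable_fun setT (hlmax f).
Proof. exact: measurable_maxop. Qed.

(* Lerner's pointwise bound (Mf)^(p-1) <= K M_w(M_sigma(f/sigma)^(p-1)/w). *)
Lemma hlmax_le_maxop p w : (1 < p)%R -> Muck Q p w -> exists2 K : R, (0 < K)%R &
  forall f, measurable_fun setT f -> (forall x, 0 <= f x) -> forall x,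
  hlmax f x <= (K%:E * maxop Q w (fun y =>
    maxop Q (dual_weight p w) (fun z => f z * ((dual_weight p w z)^-1)%:E) y `^ (p - 1)
    * ((w y)^-1)%:E) x) `^ (p - 1)^-1.
Proof.
move=> p1 Mw; have [K K0 HK] := Muck_rvol p1 Mw; exists K => // f mf f0 x.
have [mw w0 _] := Mw; have Ms := Muck_dual p1 Mw; have c1 := conj_exp_gt1 p1.
set s := dual_weight p w in HK Ms *.
have s0 y : (0 < s y)%R by exact: dual_weight_gt0.
set u := fun z => f z * _; set h := fun y => _ * _.
have u0 y : 0 <= u y by rewrite mule_ge0// lee_fin invr_ge0 ltW.
have h0 y : 0 <= h y by rewrite mule_ge0 ?poweR_ge0// lee_fin invr_ge0 ltW.
have p10 : (0 < p - 1)%R by lra.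
apply: ge_ereal_sup => _ [i _ <-]; rewrite -/(hlmax f) avg_cst1 indicE.
have [|_] := boolP (x \in Q i); last by rewrite mule0 poweR_ge0.
rewrite inE mule1 => Qx.
have v0 := vol_gt0 Q i.
have S0 := rvol_gt0 i c1 Ms; have W0 := rvol_gt0 i p1 Mw.
pose m := avg Q s u i.
have m0 : 0 <= m by exact: avg_ge0.
(* The plain average of f is the sigma-average m of f/sigma times sigma(Q)/|Q|. *)
have mE : (\int[mu]_(y in Q i) f y) * ((vol Q i)^-1)%:E =
    m * (rvol Q s i / vol Q i)%:E.
  rewrite /m /avg -muleA -EFinM mulrA mulVf ?gt_eqF// mul1r; congr (_ * _).
  apply: eq_integral => y _; rewrite /u -muleA -EFinM mulVf ?mule1// gt_eqF//.
(* M_sigma(f/sigma) is at least m at every point of the cell. The division by w inside [h] cancels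
   the weight of this integral, leaving the plain volume. *)
have hm : m `^ (p - 1) * (vol Q i)%:E <= wint mu w h (Q i).
  rewrite -(mu_cell Q i) -integral_cst; last exact: measurable_cell.
  apply: ge0_le_integral => //=.
  - exact: measurable_cell.
  - by move=> y _; exact: poweR_ge0.
  - apply: measurable_funTS; apply: measurable_wprod => //.
    apply: measurable_wprod; first by apply: measurable_poweRT; exact: measurable_maxop.
    exact: (measurable_invT w0 mw).
  - move=> y Qy; rewrite /h -muleA -EFinM mulVf ?gt_eqF// mule1.
    by apply: le_poweR => //; [exact: ltW|exact: maxop_ge].
have powK z : 0 <= z -> z = (z `^ (p - 1)) `^ (p - 1)^-1.
  by move=> z0; rewrite -poweRrM mulfV ?gt_eqF// poweRe1.
rewrite mE [leLHS]powK; last by rewrite mule_ge0// lee_fin divr_ge0// ltW.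
apply: le_poweR; rewrite ?invr_ge0 ?(ltW p10) ?poweR_ge0//.
rewrite poweRM ?lee_fin ?divr_ge0 ?(ltW S0) ?(ltW v0)// poweR_EFin.
apply: (@le_trans _ _ (K%:E * avg Q w h i)); last first.
  by rewrite lee_wpmul2l ?lee_fin ?(ltW K0)//; exact: maxop_ge.
rewrite /avg muleA lee_pdivlMr//.
apply: (@le_trans _ _ (K%:E * (m `^ (p - 1) * (vol Q i)%:E))); last first.
  by rewrite lee_wpmul2l ?lee_fin ?(ltW K0).
rewrite muleCA -muleA lee_wpmul2l ?poweR_ge0// -!EFinM lee_fin.
rewrite powRM ?(ltW S0) ?invr_ge0 ?(ltW v0)//.
rewrite -(ler_pM2r (powR_gt0 (p - 1) v0)).
have := HK i; rewrite -(mulr_powRB1 (ltW v0)); last lra.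
have -> : ((vol Q i)^-1 `^ (p - 1) = (vol Q i `^ (p - 1))^-1)%R.
  by rewrite powR_invr// ltW.
have := powR_gt0 (p - 1) v0; move: (powR (vol _ _) _) (powR (rvol _ _ _) _) => x1 x2 x10.
move=> H; have -> : (x2 / x1 * rvol Q w i * x1 = rvol Q w i * x2)%R by field; lra.
by rewrite -mulrA.
Qed.

(** The maximal theorem is used twice: for M_w on L_p'(w), then for M_sigma on L_p(sigma). The
    weights match because (p-1) p' = p, w^(-p') w = sigma and sigma^(-p) sigma = w. *)
Theorem hlmax_bound p w : (1 < p)%R -> Muck Q p w -> exists2 A : R, (0 < A)%R &
  forall f, measurable_fun setT f -> (forall x, 0 <= f x) ->
  \int[mu]_x (hlmax f x `^ p * (w x)%:E) <= A%:E * \int[mu]_x (f x `^ p * (w x)%:E).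
Proof.
move=> p1 Mw; have [K K0 HK] := hlmax_le_maxop p1 Mw.
have [mw w0 _] := Mw; have Ms := Muck_dual p1 Mw; have c1 := conj_exp_gt1 p1.
set s := dual_weight p w in HK Ms *.
have s0 y : (0 < s y)%R by exact: dual_weight_gt0.
have ms : measurable_fun setT s by exact: measurable_dual_weight.
have p0 : (0 < p)%R by lra.
have p10 : (0 < p - 1)%R by lra.
have [A1 A10 HA1] := maxop_bound (Muck_is_doubling p1 Mw) c1.
have [A2 A20 HA2] := maxop_bound (Muck_is_doubling c1 Ms) p1.
exists (K `^ conj_exp p * (A1 * A2))%R; first by rewrite !mulr_gt0// powR_gt0.
move=> f mf f0.
pose u z := f z * ((s z)^-1)%:E.
pose h y := maxop Q s u y `^ (p - 1) * ((w y)^-1)%:E.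
have u0 y : 0 <= u y by rewrite mule_ge0// lee_fin invr_ge0 ltW.
have mu' : measurable_fun setT u.
  by apply: measurable_wprod => //; exact: (measurable_invT s0 ms).
have h0 y : 0 <= h y by rewrite mule_ge0 ?poweR_ge0// lee_fin invr_ge0 ltW.
have mh : measurable_fun setT h.
  apply: measurable_wprod; first by apply: measurable_poweRT; exact: measurable_maxop.
  exact: (measurable_invT w0 mw).
have mm0 y : 0 <= maxop Q w h y by exact: maxop_ge0.
apply: (@le_trans _ _ (\int[mu]_x ((K `^ conj_exp p)%:E *
    (maxop Q w h x `^ conj_exp p * (w x)%:E)))).
  apply: le_integralT.
  - by apply: measurable_wprod => //; apply: measurable_poweRT; exact: measurable_hlmax.
  - apply: measurable_funeM; apply: measurable_wprod => //.
    by apply: measurable_poweRT; exact: measurable_maxop.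
  - by move=> x; rewrite mule_ge0 ?poweR_ge0// lee_fin ltW.
  move=> x; rewrite muleA lee_wpmul2r ?lee_fin ?(ltW (w0 x))//.
  have := le_poweR (ltW p0) (hlmax_ge0 x f0) (HK _ mf f0 x).
  rewrite -poweRrM mulrC -/(conj_exp p) poweRM ?poweR_EFin//.
  by rewrite lee_fin ltW.
rewrite integralZT ?powR_ge0//; last 2 first.
- apply: measurable_wprod => //.
  by apply: measurable_poweRT; exact: measurable_maxop.
- by move=> x; rewrite mule_ge0 ?poweR_ge0// lee_fin ltW.
rewrite [in leRHS]EFinM -muleA lee_wpmul2l ?lee_fin ?powR_ge0//.
apply: (le_trans (HA1 _ mh h0)).
rewrite EFinM -muleA lee_wpmul2l ?lee_fin ?(ltW A10)//.
have -> : \int[mu]_x (h x `^ conj_exp p * (w x)%:E) =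
    \int[mu]_x (maxop Q s u x `^ p * (s x)%:E).
  apply: eq_integral => x _; rewrite /h poweRM ?poweR_ge0//; last first.
    by rewrite lee_fin invr_ge0 ltW.
  rewrite -poweRrM conj_exp_mulp// poweR_EFin -muleA -EFinM; congr (_ * _%:E).
  rewrite /s /dual_weight -powR_inv1 ?(ltW (w0 x))// -powRrM mulN1r.
  rewrite -[X in (_ * X)%R = _]powRr1 ?(ltW (w0 x))// -powRD; last by apply/implyP => _; rewrite gt_eqF.
  by rewrite addrC.
apply: (le_trans (HA2 _ mu' u0)).
rewrite lee_wpmul2l ?lee_fin ?(ltW A20)// le_eqVlt; apply/orP; left; apply/eqP.
apply: eq_integral => x _; rewrite /u poweRM ?lee_fin ?invr_ge0 ?(ltW (s0 x))//.
rewrite poweR_EFin -muleA -EFinM; congr (_ * _%:E).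
rewrite -powR_inv1 ?(ltW (s0 x))// -powRrM mulN1r.
rewrite -[X in (_ * X)%R = _]powRr1 ?(ltW (s0 x))// -powRD; last by apply/implyP => _; rewrite gt_eqF.
rewrite /s /dual_weight -powRrM.
rewrite (_ : _ * _ = 1)%R ?powRr1 ?(ltW (w0 x))//.
by have := conj_exp_mul p1; lra.
Qed.

End Muckenhoupt_theorem.

(** * The Rubio de Francia algorithm *)

Section half_series.
Context d (T : measurableType d) (R : realType) (mu : {measure set T -> \bar R}).
Implicit Types (f : T -> \bar R) (w : T -> R) (v : nat -> T -> \bar R).
Local Open Scope ereal_scope.

Lemma ae_fin_num f : measurable_fun setT f -> (forall x, 0 <= f x) ->
  \int[mu]_x f x < +oo -> {ae mu, forall x, f x \is a fin_num}.
Proof.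
move=> mf f0 foo.
have If : mu.-integrable setT f.
  apply/integrableP; split=> //.
  by under eq_integral do rewrite gee0_abs//.
have := integrable_ae measurableT If.
by apply: filterS => x /(_ I).
Qed.

Lemma real_version f : measurable_fun setT f -> (forall x, 0 < f x) ->
  {ae mu, forall x, f x \is a fin_num} ->
  exists h : T -> R, [/\ measurable_fun setT h, forall x, (0 < h x)%R &
    {ae mu, forall x, f x = (h x)%:E}].
Proof.
move=> mf f0 ffin.
have mN : measurable (f @^-1` [set +oo]).
  by rewrite -[X in measurable X]setTI; apply: mf => //; exact: emeasurable_set1.
(* [fine +oo] is 0; the indicator keeps the real version positive at such points. *)
exists (fun x => fine (f x) + \1_(f @^-1` [set +oo%E]) x)%R; split.
- apply: measurable_funD; first exact: measurableT_comp.
  exact: measurable_indic.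
- move=> x; rewrite indicE; have := f0 x; case E : (f x) => [r| |]//.
    by rewrite lte_fin => r0; rewrite ltr_wpDr.
  by rewrite mem_set//= add0r ltr01.
- apply: filterS ffin => x xfin; rewrite indicE memNset ?addr0 ?fineK//.
  by move=> /= fx; rewrite fx in xfin.
Qed.

Definition half_series v x := \sum_(k <oo) (2^-1 ^+ k)%:E * v k x.

Lemma half_series_ge0 v x : (forall k, 0 <= v k x) -> 0 <= half_series v x.
Proof.
by move=> v0; apply: nneseries_ge0 => k _ _; rewrite mule_ge0// lee_fin exprn_ge0.
Qed.

Lemma half_series_ge v k x : (forall k, 0 <= v k x) ->
  (2^-1 ^+ k)%:E * v k x <= half_series v x.
Proof.
move=> v0; apply: (@nneseries_term_le _ (fun k => (2^-1 ^+ k)%:E * v k x)) => i.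
by rewrite mule_ge0// lee_fin exprn_ge0.
Qed.

Lemma measurable_half_series v : (forall k, measurable_fun setT (v k)) ->
  (forall k x, 0 <= v k x) -> measurable_fun setT (half_series v).
Proof.
move=> mv v0; apply: ge0_emeasurable_sum => [k x _ _|k _].
  by rewrite mule_ge0// lee_fin exprn_ge0.
exact: measurable_funeM.
Qed.

Lemma integral_half_series_le v w q (c : R) : (0 < q)%R -> (0 <= c)%R ->
  measurable_fun setT w -> (forall x, (0 < w x)%R) ->
  (forall k, measurable_fun setT (v k)) -> (forall k x, 0 <= v k x) ->
  (forall k, \int[mu]_x (v k x `^ q * (w x)%:E) <= (c * 2^-1 ^+ k)%:E) ->
  \int[mu]_x (half_series v x `^ q * (w x)%:E) < +oo.
Proof.
move=> q0 c0 mw w0 mv v0 vc.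
have mt k : measurable_fun setT (fun x => v k x `^ q * (w x)%:E).
  by apply: measurable_wprod => //; exact: measurable_poweRT.
have t0 k x : 0 <= v k x `^ q * (w x)%:E.
  by rewrite mule_ge0 ?poweR_ge0// lee_fin ltW.
have ms : measurable_fun setT (fun x => \sum_(k <oo) (v k x `^ q * (w x)%:E)).
  by apply: ge0_emeasurable_sum.
apply: (@le_lt_trans _ _ (\int[mu]_x ((2 `^ q)%:E * \sum_(k <oo) (v k x `^ q * (w x)%:E)))).
  apply: le_integralT.
  - apply: measurable_wprod => //; apply: measurable_poweRT.
    exact: measurable_half_series.
  - exact: measurable_funeM.
  - by move=> x; rewrite mule_ge0 ?poweR_ge0// lee_fin ltW.
  move=> x; under eq_eseriesr do rewrite muleC.
  rewrite nneseriesZl; last by move=> k _; exact: poweR_ge0.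
  rewrite muleCA muleC lee_wpmul2l ?lee_fin ?(ltW (w0 x))//.
  exact: poweR_nneseries_half_le.
rewrite integralZT ?powR_ge0//; last by move=> x; exact: nneseries_ge0.
rewrite integral_nneseries//.
rewrite lte_mul_pinfty ?lee_fin ?powR_ge0//.
apply: (@le_lt_trans _ _ (\sum_(k <oo) (c * 2^-1 ^+ k)%:E)).
  apply: lee_nneseries => [k _ _|k _]; last exact: vc.
  exact: integral_ge0.
by rewrite (le_lt_trans (nneseries_half c0))// ltry.
Qed.

End half_series.

Section Rubio_de_Francia.
Context d (T : measurableType d) (R : realType) (mu : {measure set T -> \bar R}).
Variable Q : covering_basis mu.
Implicit Types (f : T -> \bar R) (w : T -> R) (p : R).
Local Open Scope ereal_scope.

Definition A1_like (C : R) (h : T -> R) := forall i,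
  {ae mu, forall x, Q i x -> wvol mu h (Q i) <= (C * vol Q i * h x)%:E}.

(** The majorant is the sum of (2B)^-k M^k f. The lower bound by the indicator of one cell serves to
    make it positive everywhere. *)
Lemma rubio_de_francia p w : (1 < p)%R -> Muck Q p w -> exists2 C : R, (0 < C)%R &
  forall f, measurable_fun setT f -> (forall x, (\1_(Q 0%N) x)%:E <= f x) ->
  \int[mu]_x (f x `^ p * (w x)%:E) < +oo ->
  exists h : T -> R, [/\ measurable_fun setT h, forall x, (0 < h x)%R,
    {ae mu, forall x, f x <= (h x)%:E}, A1_like C h &
    \int[mu]_x (h x `^ p * w x)%:E < +oo].
Proof.
move=> p1 Mw; have [A A0 HA] := hlmax_bound p1 Mw; have [mw w0 _] := Mw.
have p0 : (0 < p)%R by lra.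
(* B^p is 2A rather than A, so that the integrals of the p-th powers of B^-k M^k f decay like 2^-k,
   as [integral_half_series_le] requires. *)
pose B := ((2 * A) `^ p^-1)%R.
have B0 : (0 < B)%R by rewrite powR_gt0// mulr_gt0.
have BE : (B `^ p = 2 * A)%R.
  by rewrite -powRrM mulVf ?gt_eqF// powRr1// mulr_ge0// ltW.
exists (2 * B)%R; first by rewrite mulr_gt0.
move=> f mf f1 foo.
have f0 x : 0 <= f x by apply: le_trans (f1 x); rewrite lee_fin indicE.
pose F k := iter k (hlmax Q) f.
have F0 k x : 0 <= F k x.
  by elim: k x => [//|k IH] x; rewrite /F iterS; exact: hlmax_ge0.
have mF k : measurable_fun setT (F k).
  by case: k => [//|k]; exact: measurable_hlmax.
pose v k x := (B^-1 ^+ k)%:E * F k x.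
have B0k k : (0 <= B^-1 ^+ k)%R by rewrite exprn_ge0// invr_ge0 ltW.
have v0 k x : 0 <= v k x by rewrite mule_ge0// lee_fin.
have mv k : measurable_fun setT (v k) by exact: measurable_funeM.
have IF0 k : 0 <= \int[mu]_x (F k x `^ p * (w x)%:E).
  by apply: integral_ge0 => x _; rewrite mule_ge0 ?poweR_ge0// lee_fin ltW.
pose c := fine (\int[mu]_x (f x `^ p * (w x)%:E)).
have cE : \int[mu]_x (f x `^ p * (w x)%:E) = c%:E.
  by rewrite /c fineK// ge0_fin_numE//; exact: (IF0 0%N).
have c0 : (0 <= c)%R by rewrite -lee_fin -cE; exact: (IF0 0%N).
have HF k : \int[mu]_x (F k x `^ p * (w x)%:E) <= (A ^+ k * c)%:E.
  elim: k => [|k IH]; first by rewrite mul1r cE.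
  rewrite /F iterS -/(F k) (le_trans (HA _ (mF k) (F0 k)))//.
  by rewrite exprS -mulrA EFinM lee_wpmul2l// lee_fin ltW.
have vc k : \int[mu]_x (v k x `^ p * (w x)%:E) <= (c * 2^-1 ^+ k)%:E.
  have -> : \int[mu]_x (v k x `^ p * (w x)%:E) =
      ((2 * A) ^- k)%:E * \int[mu]_x (F k x `^ p * (w x)%:E).
    rewrite -integralZT//.
    - apply: eq_integral => x _; rewrite /v poweRM ?lee_fin// poweR_EFin -muleA.
      congr (_%:E * _); rewrite -exprVn -BE.
      rewrite -powR_mulrn ?invr_ge0 ?(ltW B0)// -powRrM mulrC powRrM.
      rewrite powR_mulrn ?powR_ge0//; congr (_ ^+ _)%R.
      by rewrite -powR_inv1 ?(ltW B0)// -powRrM mulN1r powRN.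
    - by apply: measurable_wprod => //; exact: measurable_poweRT.
    - by move=> x; rewrite mule_ge0 ?poweR_ge0// lee_fin ltW.
    - by rewrite invr_ge0 exprn_ge0// mulr_ge0// ltW.
  apply: (le_trans (lee_wpmul2l _ (HF k))).
    by rewrite lee_fin invr_ge0 exprn_ge0// mulr_ge0// ltW.
  rewrite -EFinM lee_fin exprMn exprVn le_eqVlt; apply/orP; left; apply/eqP.
  by field; rewrite !expf_neq0// gt_eqF.
pose h' := half_series v.
have mh' : measurable_fun setT h' by exact: measurable_half_series.
have h'0 x : 0 <= h' x by exact: half_series_ge0.
have h'oo : \int[mu]_x (h' x `^ p * (w x)%:E) < +oo.
  exact: integral_half_series_le vc.
(* f may vanish at x, but x lies in an enlargement of cell 0 and f >= 1 on cell 0: the term k = 1 is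
   positive. *)
have h'gt0 x : 0 < h' x.
  have [k Qx] := cell_iter_cover Q 0 x.
  have H1 : 0 < F 1%N x.
    have := hlmax_ge f Qx; rewrite /F /=; set j := iter k _ _ => H.
    have : (vol Q 0)%:E <= (vol Q j)%:E * hlmax Q f x.
      apply: le_trans H; have -> : (vol Q 0)%:E = \int[mu]_(x in Q 0%N) cst 1 x.
        by rewrite integral_cst ?mul1e ?mu_cell//; exact: measurable_cell.
      apply: (@le_trans _ _ (\int[mu]_(x0 in Q 0%N) f x0)).
        apply: ge0_le_integral => //=; first exact: measurable_cell.
        - by apply: measurable_funTS.
        - by move=> y Qy; apply: le_trans (f1 y); rewrite indicE mem_set.
      apply: ge0_integral_le => //; try exact: measurable_cell.
      exact: (@cell_iter_le _ _ _ _ Q 0 0 k).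
    move=> HH; rewrite lt_def hlmax_ge0// andbT; apply/eqP => z0.
    by move: HH; rewrite z0 mule0 lee_fin leNgt vol_gt0.
  apply: lt_le_trans (half_series_ge 1 (fun k => v0 k x)).
  by rewrite mule_gt0 ?lte_fin// /v mule_gt0// lte_fin expr1 invr_gt0.
have h'fin : {ae mu, forall x, h' x \is a fin_num}.
  have := ae_fin_num _ _ h'oo.
  move=> /(_ _ _)H; have {H} : {ae mu, forall x, h' x `^ p * (w x)%:E \is a fin_num}.
    apply: H; first by apply: measurable_wprod => //; exact: measurable_poweRT.
    by move=> x; rewrite mule_ge0 ?poweR_ge0// lee_fin ltW.
  apply: filterS => x; have := h'gt0 x; case: (h' x) => // _.
  by rewrite eqy_poweR// gt0_mulye// lte_fin.
(* Averaging the k-th term gives at most 2B times the (k+1)-th term at x, so the average of the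
   series is bounded by 2B times its tail. *)
have h'A i x : Q i x -> \int[mu]_(y in Q i) h' y <= (2 * B * vol Q i)%:E * h' x.
  move=> Qx; rewrite /h' /half_series integral_nneseries; last 3 first.
  - exact: measurable_cell.
  - by move=> k; apply: measurable_funTS; exact: measurable_funeM.
  - by move=> k y _; rewrite mule_ge0// lee_fin exprn_ge0.
  apply: (@le_trans _ _ (\sum_(k <oo) ((2 * B * vol Q i)%:E *
      ((2^-1 ^+ (k + 1))%:E * v (k + 1)%N x)))).
    apply: lee_nneseries => [k _ _|k _].
      by apply: integral_ge0 => y _; rewrite mule_ge0// lee_fin exprn_ge0.
    rewrite ge0_integralZl_EFin ?exprn_ge0//; last 2 first.
    - exact: measurable_cell.
    - exact: measurable_funTS.
    rewrite /v ge0_integralZl_EFin//; last 2 first.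
    - exact: measurable_cell.
    - exact: measurable_funTS.
    apply: (@le_trans _ _ ((2^-1 ^+ k)%:E * ((B^-1 ^+ k)%:E * ((vol Q i)%:E * F k.+1 x)))).
      rewrite lee_wpmul2l ?lee_fin ?exprn_ge0// lee_wpmul2l ?lee_fin//.
      exact: hlmax_ge.
    rewrite addn1 !muleA -!EFinM le_eqVlt; apply/orP; left; apply/eqP.
    congr (_%:E * _); rewrite !exprS; field.
    by rewrite gt_eqF.
  rewrite nneseriesZl; last by move=> k _; rewrite mule_ge0 ?v0// lee_fin exprn_ge0.
  rewrite lee_wpmul2l//; first by rewrite lee_fin !mulr_ge0 ?(ltW B0) ?(ltW (vol_gt0 Q i)).
  pose t k := (2^-1 ^+ k)%:E * v k x.
  have t0 k : 0 <= t k by rewrite mule_ge0// lee_fin exprn_ge0.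
  rewrite -/(t _) (nneseries_addn 1 t0) [leRHS](@nneseries_recl _ xpredT t)//.
  by rewrite leeDr.
have [h [mh h0 hh']] := real_version mh' h'gt0 h'fin.
exists h; split=> //.
- apply: filterS hh' => x <-; apply: le_trans (half_series_ge 0 (fun k => v0 k x)).
  by rewrite expr0 /v expr0 !mul1e.
- move=> i; apply: filterS (hh') => x hx Qx.
  have -> : wvol mu h (Q i) = \int[mu]_(y in Q i) h' y.
    by apply: eq_integral_ae; apply: filterS hh' => y ->.
  by rewrite EFinM -hx; exact: h'A.
- have -> : \int[mu]_x (h x `^ p * w x)%:E = \int[mu]_x (h' x `^ p * (w x)%:E).
    by apply: eq_integral_ae; apply: filterS hh' => y ->.
  exact: h'oo.
Qed.

End Rubio_de_Francia.

(** * Extrapolation *)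

Section extrapolation.
Context d (T : measurableType d) (R : realType) (mu : {measure set T -> \bar R}).
Variable Q : covering_basis mu.
Implicit Types (f g h v w : T -> R) (p C e l : R) (F : set ((T -> R) * (T -> R))).
Local Open Scope ereal_scope.

Lemma ae_cell_exists i (P : T -> Prop) :
  {ae mu, forall x, Q i x -> P x} -> exists2 x, Q i x & P x.
Proof.
move=> [N [mN N0 PN]]; apply: contrapT => nP.
have : mu (Q i) <= mu N.
  apply: le_measure; rewrite ?inE//; first exact: measurable_cell.
  by move=> x Qx; apply: PN => /= /(_ Qx) Px; apply: nP; exists x.
by rewrite N0 mu_cell lee_fin leNgt vol_gt0.
Qed.

(** A cell has positive measure, so the A_1 bound holds at some point of it, where its right side is
    finite. *)
Lemma A1_like_wvol C h i : measurable_fun setT h -> (forall x, (0 < h x)%R) ->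
  A1_like Q C h -> wvol mu h (Q i) = (rvol Q h i)%:E /\ (0 < rvol Q h i)%R.
Proof.
move=> mh h0 /(_ i) /ae_cell_exists[x _ hx].
have hpos := wvol_cell_gt0 Q i mh h0.
have E : wvol mu h (Q i) = (rvol Q h i)%:E.
  by rewrite /rvol fineK// ge0_fin_numE ?(ltW hpos)// (le_lt_trans hx)// ltry.
by split=> //; rewrite -lte_fin -E.
Qed.

Lemma A1_like_powR C h i e : (0 < C)%R -> measurable_fun setT h ->
  (forall x, (0 < h x)%R) -> (e <= 0)%R -> A1_like Q C h ->
  {ae mu, forall x, Q i x -> (h x `^ e <= (rvol Q h i / (C * vol Q i)) `^ e)%R}.
Proof.
move=> C0 mh h0 e0 Ah; have [hE r0] := A1_like_wvol i mh h0 Ah.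
have m0 := vol_gt0 Q i.
apply: filterS (Ah i) => x H Qx; move: (H Qx); rewrite hE lee_fin => {}H.
have [k k0 ->] : exists2 k : R, (0 <= k)%R & e = (- k)%R.
  by exists (- e)%R; rewrite ?opprK ?oppr_ge0.
rewrite !powRN lef_pV2 ?posrE ?powR_gt0 ?divr_gt0 ?mulr_gt0//.
apply: ge0_ler_powR; rewrite ?nnegrE ?divr_ge0 ?mulr_ge0 ?(ltW r0) ?(ltW C0) ?(ltW m0) ?(ltW (h0 x))//.
by rewrite ler_pdivrMr ?mulr_gt0// mulrC.
Qed.

(** The easy half of the factorization of A_p weights. As (1-p)(1-p') = 1, the dual weight is h
    v^(1-p'). On a cell each negative power is bounded by that power of the average, and the
    averages cancel in the product. *)
Lemma Muck_A1_A1 p (C1 C2 : R) h v : (1 < p)%R -> (0 < C1)%R -> (0 < C2)%R ->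
  measurable_fun setT h -> (forall x, (0 < h x)%R) -> A1_like Q C1 h ->
  measurable_fun setT v -> (forall x, (0 < v x)%R) -> A1_like Q C2 v ->
  Muck Q p (fun x => h x `^ (1 - p) * v x)%R.
Proof.
move=> p1 C10 C20 mh h0 Ah mv v0 Av; have c1 := conj_exp_gt1 p1.
have W0 x : (0 < h x `^ (1 - p) * v x)%R by rewrite mulr_gt0 ?powR_gt0.
have mW : measurable_fun setT (fun x => h x `^ (1 - p) * v x)%R.
  by apply: measurable_funM => //; exact: measurable_powRT.
split=> //; exists (C1 `^ (p - 1) * C2)%R => i.
have [hE hr0] := A1_like_wvol i mh h0 Ah.
have [vE vr0] := A1_like_wvol i mv v0 Av.
set a := rvol Q h i in hE hr0; set b := rvol Q v i in vE vr0.
have m0 := vol_gt0 Q i; set m := vol Q i in m0 *.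
have mQ := measurable_cell Q i.
have ae_wvol (u1 u2 : T -> R) : measurable_fun setT u1 -> measurable_fun setT u2 ->
    (forall x, 0 < u1 x)%R -> (forall x, 0 < u2 x)%R ->
    {ae mu, forall x, Q i x -> (u1 x <= u2 x)%R} ->
    wvol mu u1 (Q i) <= wvol mu u2 (Q i).
  move=> mu1 mu2 u10 u20 u12; apply: ae_ge0_le_integral => //.
  - by move=> x _; rewrite lee_fin ltW.
  - by apply: measurable_funTS; exact/measurable_EFinP.
  - by move=> x _; rewrite lee_fin ltW.
  - by apply: measurable_funTS; exact/measurable_EFinP.
have H1 : wvol mu (fun x => h x `^ (1 - p) * v x)%R (Q i) <=
    ((a / (C1 * m)) `^ (1 - p))%:E * wvol mu v (Q i).
  rewrite (wvolZ mu mv (fun x => ltW (v0 x)) mQ (powR_ge0 _ _)).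
  apply: ae_wvol => //.
  - exact: measurable_funM.
  - by move=> x; rewrite mulr_gt0 ?powR_gt0 ?divr_gt0 ?mulr_gt0.
  apply: filterS (@A1_like_powR C1 h i (1 - p) C10 mh h0 _ Ah); last lra.
  by move=> x H Qx; rewrite ler_wpM2r ?(ltW (v0 x))//; exact: H.
have H2 : wvol mu (dual_weight p (fun x => h x `^ (1 - p) * v x)%R) (Q i) <=
    ((b / (C2 * m)) `^ (1 - conj_exp p))%:E * wvol mu h (Q i).
  rewrite (wvolZ mu mh (fun x => ltW (h0 x)) mQ (powR_ge0 _ _)).
  apply: ae_wvol.
  - exact: measurable_dual_weight.
  - exact: measurable_funM.
  - by move=> x; exact: dual_weight_gt0.
  - by move=> x; rewrite mulr_gt0 ?powR_gt0 ?divr_gt0 ?mulr_gt0.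
  apply: filterS (@A1_like_powR C2 v i (1 - conj_exp p) C20 mv v0 _ Av); last lra.
  move=> x H Qx; rewrite /dual_weight powRM ?powR_ge0 ?(ltW (v0 x))//.
  rewrite -powRrM (_ : (1 - p) * (1 - conj_exp p) = 1)%R; last first.
    by have := conj_exp_mul p1; lra.
  by rewrite powRr1 ?(ltW (h0 x))// mulrC ler_wpM2r ?(ltW (h0 x))//; exact: H.
rewrite vE -EFinM in H1; rewrite hE -EFinM mulrC in H2.
have wd0 : 0 <= wvol mu (dual_weight p (fun x => h x `^ (1 - p) * v x)%R) (Q i).
  by apply: wvol_ge0 => x; exact: powR_ge0.
apply: (@le_trans _ _ (((a / (C1 * m)) `^ (1 - p) * b)%:E *
    (a * (b / (C2 * m)) `^ (1 - conj_exp p))%:E `^ (p - 1))).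
  apply: lee_pmul => //; first by apply: wvol_ge0 => x; exact: ltW.
    exact: poweR_ge0.
  by apply: le_poweR => //; lra.
have Cm1 : (0 < C1 * m)%R by rewrite mulr_gt0.
have Cm2 : (0 < C2 * m)%R by rewrite mulr_gt0.
rewrite poweR_EFin -EFinM lee_fin [((a * (b / _) `^ _) `^ _)%R]powRM ?(ltW hr0) ?powR_ge0//.
rewrite -powRrM conj_exp_mul// powR_inv1; last by rewrite divr_ge0// ltW.
rewrite invf_div.
have -> : ((a / (C1 * m)) `^ (1 - p) = (C1 * m) `^ (p - 1) / a `^ (p - 1))%R.
  rewrite powR_div ?(ltW hr0) ?(ltW Cm1)//.
  by rewrite -(opprB p) !powRN invrK mulrC.
have a0 : (0 < a `^ (p - 1))%R by rewrite powR_gt0.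
rewrite [((C1 * m) `^ _)%R]powRM ?(ltW C10) ?(ltW m0)//.
rewrite -(mulr_powRB1 (ltW m0) (_ : 0 < p)%R); last lra.
rewrite le_eqVlt; apply/orP; left; apply/eqP; field.
by rewrite !gt_eqF.
Qed.

Definition weighted_ineq F p := forall w, Muck Q p w -> exists2 c : R, (0 < c)%R &
  forall g f, F (g, f) ->
  \int[mu]_x (g x `^ p * w x)%:E <= c%:E * \int[mu]_x (f x `^ p * w x)%:E.

Definition nonneg_pairs F := forall g f, F (g, f) ->
  [/\ measurable_fun setT g, forall x, (0 <= g x)%R, measurable_fun setT f &
      forall x, (0 <= f x)%R].

(** The weight and hence b = (1 + c) int h1 v depend on [f0] and [u0] only. For each pair, l g h <=
    l g v <= h1 v + (l g)^p1 W, and the hypothesis for W passes from g to f, where (l f)^p1 W <= h1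
    v. *)
Lemma extrapolation_step F p1 p w (f0 u0 : T -> \bar R) : nonneg_pairs F ->
  (1 < p1)%R -> weighted_ineq F p1 -> (1 < p)%R -> Muck Q p w ->
  measurable_fun setT f0 -> (forall x, (\1_(Q 0%N) x)%:E <= f0 x) ->
  \int[mu]_x (f0 x `^ p * (w x)%:E) < +oo ->
  measurable_fun setT u0 -> (forall x, (\1_(Q 0%N) x)%:E <= u0 x) ->
  \int[mu]_x (u0 x `^ conj_exp p * (dual_weight p w x)%:E) < +oo ->
  exists b : R, forall g f l h, F (g, f) -> (0 <= l)%R ->
    measurable_fun setT h -> (forall x, (0 <= h x)%R) ->
    (forall x, (l * f x)%:E <= f0 x) -> (forall x, (h x)%:E <= u0 x) ->
    \int[mu]_x (l * g x * h x)%:E <= b%:E.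
Proof.
move=> F0 p11 wF hp Mw mf0 f01 f0oo mu0 u01 u0oo.
have c1 := conj_exp_gt1 hp; have Ms := Muck_dual hp Mw.
have [C1 C10 /(_ f0 mf0 f01 f0oo)[h1 [mh h0 f0h Ah hoo]]] := rubio_de_francia hp Mw.
have [C2 C20 /(_ u0 mu0 u01 u0oo)[v [mv v0 u0v Av voo]]] := rubio_de_francia c1 Ms.
have [mw w0 _] := Mw.
have p10 : (0 < p1)%R by lra.
pose W x := (h1 x `^ (1 - p1) * v x)%R.
have MW : Muck Q p1 W by exact: Muck_A1_A1 Ah mv v0 Av.
have [mW W0 _] := MW.
have [c c0 Hc] := wF _ MW.
pose J := \int[mu]_x (h1 x * v x)%:E.
have hv0 x : (0 <= h1 x * v x)%R by rewrite mulr_ge0// ltW.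
have mhv : measurable_fun setT (fun x => (h1 x * v x)%:E).
  by apply/measurable_EFinP; exact: measurable_funM.
have J0 : 0 <= J by apply: integral_ge0 => x _; rewrite lee_fin.
have Joo : J < +oo.
  apply: (@le_lt_trans _ _ (\int[mu]_x ((h1 x `^ p * w x)%:E +
      (v x `^ conj_exp p * dual_weight p w x)%:E))).
    apply: le_integralT => //.
    - apply: emeasurable_funD; apply/measurable_EFinP; apply: measurable_funM => //.
      + exact: measurable_powRT.
      + exact: measurable_powRT.
      + exact: measurable_dual_weight.
    - by move=> x; rewrite -EFinD lee_fin mul_le_powR_weight.
  rewrite integralDT.
  - exact: lte_add_pinfty.
  - by apply/measurable_EFinP; apply: measurable_funM => //; exact: measurable_powRT.
  - apply/measurable_EFinP; apply: measurable_funM; first exact: measurable_powRT.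
    exact: measurable_dual_weight.
  - by move=> x; rewrite lee_fin mulr_ge0 ?powR_ge0// ltW.
  - by move=> x; rewrite lee_fin mulr_ge0 ?powR_ge0.
have JE : J = (fine J)%:E by rewrite fineK// ge0_fin_numE.
exists ((1 + c) * fine J)%R => g f l h Fgf l0 mh' h'0 lf hu.
have [mg g0 mf fge0] := F0 _ _ Fgf.
have mlgW (k : T -> R) : measurable_fun setT k -> measurable_fun setT (fun x => ((l * k x) `^ p1 * W x)%:E).
  move=> mk; apply/measurable_EFinP; apply: measurable_funM => //.
  by apply: measurable_powRT; exact: measurable_funM.
have lW (k : T -> R) : measurable_fun setT k -> (forall x, (0 <= k x)%R) -> \int[mu]_x ((l * k x) `^ p1 * W x)%:E =
    (l `^ p1)%:E * \int[mu]_x (k x `^ p1 * W x)%:E.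
  move=> mk k0; rewrite -integralZT ?powR_ge0//.
  - by apply: eq_integral => x _; rewrite powRM// -mulrA EFinM.
  - by apply/measurable_EFinP; apply: measurable_funM => //; exact: measurable_powRT.
  - by move=> x; rewrite lee_fin mulr_ge0 ?powR_ge0// ltW.
apply: (@le_trans _ _ (J + \int[mu]_x ((l * g x) `^ p1 * W x)%:E)).
  rewrite -integralDT//; last 2 first.
  - exact: mlgW.
  - by move=> x; rewrite lee_fin mulr_ge0 ?powR_ge0// ltW.
  apply: ae_ge0_le_integral => //.
  - by move=> x _; rewrite lee_fin !mulr_ge0.
  - by apply/measurable_EFinP; do 2?apply: measurable_funM.
  - by move=> x _; rewrite adde_ge0 ?lee_fin// mulr_ge0 ?powR_ge0// ltW.
  - by apply: emeasurable_funD => //; exact: mlgW.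
  apply: filterS u0v => x uv _; rewrite -EFinD lee_fin.
  have hv : (h x <= v x)%R by rewrite -lee_fin; exact: le_trans (hu x) uv.
  have lg0 : (0 <= l * g x)%R by rewrite mulr_ge0.
  apply: (@le_trans _ _ (l * g x * v x)%R); first by rewrite ler_wpM2l.
  by rewrite /W mulrA -mulrDl ler_wpM2r ?(ltW (v0 x))// le_add_powR_mul.
rewrite mulrDl mul1r EFinD -JE leeD2l// lW//.
apply: (le_trans (lee_wpmul2l _ (Hc _ _ Fgf))); first by rewrite lee_fin powR_ge0.
rewrite muleCA -lW// EFinM -JE lee_wpmul2l ?lee_fin ?(ltW c0)//.
apply: ae_ge0_le_integral => //.
- by move=> x _; rewrite lee_fin mulr_ge0 ?powR_ge0// ltW.
- exact: mlgW.
- by move=> x _; rewrite lee_fin.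
apply: filterS f0h => x fh _.
have lfh : (l * f x <= h1 x)%R by rewrite -lee_fin; exact: le_trans (lf x) fh.
rewrite lee_fin /W mulrA ler_wpM2r ?(ltW (v0 x))//.
apply: (@le_trans _ _ (h1 x `^ p1 * h1 x `^ (1 - p1))%R); last first.
  rewrite -powRD ?subrKC ?powRr1 ?(ltW (h0 x))//.
  by apply/implyP => _; rewrite gt_eqF.
rewrite ler_wpM2r ?powR_ge0//; apply: ge0_ler_powR; rewrite ?nnegrE ?mulr_ge0 ?(ltW (h0 x))//.
exact: ltW.
Qed.

End extrapolation.

(** * Packing counterexamples: extrapolation to every exponent *)

Section extrapolation_theorem.
Context d (T : measurableType d) (R : realType) (mu : {measure set T -> \bar R}).
Variable Q : covering_basis mu.
Implicit Types (f g h v w : T -> R) (p C e l : R) (F : set ((T -> R) * (T -> R))).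
Local Open Scope ereal_scope.

(** g may have infinite norm, which cannot be normalised. Bounded truncations on growing cells have
    finite norm, and by monotone convergence one of them still exceeds a. *)
Lemma truncation g w p (a : \bar R) : (0 < p)%R ->
  measurable_fun setT w -> (forall x, (0 < w x)%R) ->
  (forall i, wvol mu w (Q i) < +oo) ->
  measurable_fun setT g -> (forall x, (0 <= g x)%R) ->
  a < \int[mu]_x (g x `^ p * w x)%:E ->
  exists h, [/\ measurable_fun setT h, forall x, (0 <= h x <= g x)%R,
    a < \int[mu]_x (h x `^ p * w x)%:E & \int[mu]_x (h x `^ p * w x)%:E < +oo].
Proof.
move=> p0 mw w0 woo mg g0 ag.
pose q N := iter N (enl Q) 0%N.
pose t N x := (Num.min (g x) N%:R * \1_(Q (q N)) x)%R.
have mt N : measurable_fun setT (t N).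
  apply: measurable_funM; first exact: measurable_minr.
  by apply: measurable_indic; exact: measurable_cell.
have t0 N x : (0 <= t N x)%R.
  by rewrite mulr_ge0 ?indicE// le_min g0 ler0n.
have tg N x : (t N x <= g x)%R.
  rewrite /t indicE; case: (_ \in _); rewrite ?mulr1 ?mulr0 ?g0//.
  by rewrite ge_min lexx.
have tN N x : (t N x <= N%:R * \1_(Q (q N)) x)%R.
  by rewrite ler_wpM2r ?indicE// ge_min lexx orbT.
pose s N x := (t N x `^ p * w x)%:E.
have ms N : measurable_fun setT (s N).
  by apply/measurable_EFinP; apply: measurable_funM => //; exact: measurable_powRT.
have s0 N x : 0 <= s N x by rewrite lee_fin mulr_ge0 ?powR_ge0// ltW.
have nd x : nondecreasing_seq (s ^~ x).
  move=> M N MN; rewrite lee_fin ler_wpM2r ?(ltW (w0 x))//.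
  apply: ge0_ler_powR; rewrite ?nnegrE ?(ltW p0)// /t.
  apply: ler_pM; rewrite ?indicE ?le_min ?g0 ?ler0n//.
    by rewrite !ge_min lexx/= ler_nat MN orbT.
  have [Qx|] := boolP (x \in Q (q M)); last by [].
  by rewrite mem_set//; apply: (cell_iter_le MN); rewrite inE in Qx.
have soo N : \int[mu]_x s N x < +oo.
  apply: (@le_lt_trans _ _ ((N%:R `^ p)%:E * wvol mu w (Q (q N)))); last first.
    by rewrite lte_mul_pinfty ?lee_fin ?powR_ge0.
  rewrite (wvolZ mu mw (fun x => ltW (w0 x)) (measurable_cell Q _) (powR_ge0 _ _)).
  rewrite /wvol [leRHS]integral_mkcond; apply: le_integralT => //.
    apply/(measurable_restrictT _ (measurable_cell Q (q N))).
    by apply: measurable_funTS; apply/measurable_EFinP; exact: measurable_funM.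
  move=> x; rewrite patchE /s /t indicE; case: ifPn => _.
    rewrite mulr1 lee_fin ler_wpM2r ?(ltW (w0 x))//.
    apply: ge0_ler_powR; rewrite ?nnegrE ?(ltW p0) ?ler0n// ?le_min ?g0 ?ler0n//.
    by rewrite ge_min lexx orbT.
  by rewrite mulr0 powR0 ?gt_eqF// mul0r.
apply: contrapT => nh.
have sa N : \int[mu]_x s N x <= a.
  rewrite leNgt; apply/negP => aN; apply: nh; exists (t N); split=> //.
    by move=> x; rewrite t0 tg.
  exact: soo.
have mono := monotone_convergence mu measurableT ms (fun n x _ => s0 n x) (fun x _ => nd x).
have : \int[mu]_x limn (s ^~ x) <= a.
  rewrite mono; apply: lime_le; last by apply: nearW => j; exact: sa.
  apply: ereal_nondecreasing_is_cvgn => M N MN.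
  by apply: le_integralT => // x; exact: nd.
apply/negP; rewrite -ltNge; apply: (lt_le_trans ag).
apply: le_integralT.
- by apply/measurable_EFinP; apply: measurable_funM => //; exact: measurable_powRT.
- apply: (emeasurable_fun_cvg _ _ ms) => x _.
  by apply: ereal_nondecreasing_is_cvgn; exact: nd.
- by move=> x; rewrite lee_fin mulr_ge0 ?powR_ge0// ltW.
move=> x; have [k Qx] := cell_iter_cover Q 0 x.
pose N := maxn k (Num.bound (g x)).
have -> : (g x `^ p * w x)%:E = s N x.
  rewrite /s /t indicE mem_set ?mulr1; last by apply: cell_iter_le Qx; exact: leq_maxl.
  rewrite min_l//; apply: (@le_trans _ _ (Num.bound (g x))%:R).
    by apply/ltW/archi_boundP.
  by rewrite ler_nat leq_maxr.
rewrite (cvg_lim _ (ereal_nondecreasing_cvgn (nd x)))//.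
by apply: ereal_sup_ubound; exists N.
Qed.

(** The factor l gives the truncation of g the integral 1, which leaves at most 1/L for f. [F] is an
    arbitrary family, not closed under scaling, so l is kept apart from the pair. *)
Lemma extrapolation_failure F p w (L : R) : nonneg_pairs F -> (1 < p)%R -> Muck Q p w ->
  (0 < L)%R ->
  ~ (exists2 c : R, (0 < c)%R & forall g f, F (g, f) ->
    \int[mu]_x (g x `^ p * w x)%:E <= c%:E * \int[mu]_x (f x `^ p * w x)%:E) ->
  exists g f h l, [/\ F (g, f), (0 < l)%R, measurable_fun setT h,
    forall x, (0 <= h x <= l * g x)%R &
    \int[mu]_x (h x `^ p * w x)%:E = 1 /\
    L%:E * \int[mu]_x ((l * f x) `^ p * w x)%:E <= 1].
Proof.
move=> F0 p1 Mw L0 nF; have [mw w0 _] := Mw; have p0 : (0 < p)%R by lra.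
have [[g f] Fgf] : exists gf, F gf /\
    L%:E * \int[mu]_x (gf.2 x `^ p * w x)%:E < \int[mu]_x (gf.1 x `^ p * w x)%:E.
  apply: contrapT => nex; apply: nF; exists L => // g f Fgf.
  by rewrite leNgt; apply/negP => gf; apply: nex; exists (g, f).
have {Fgf}[Fgf /= Lgf] := Fgf.
have [mg g0 mf f0] := F0 _ _ Fgf.
have woo i : wvol mu w (Q i) < +oo by exact: Muck_fin p1 Mw.
have [h [mh hg Lh hoo]] := truncation p0 mw w0 woo mg g0 Lgf.
have h0 x : (0 <= h x)%R by case/andP: (hg x).
pose G := fine (\int[mu]_x (h x `^ p * w x)%:E).
have If0 : 0 <= \int[mu]_x (f x `^ p * w x)%:E.
  by apply: integral_ge0 => x _; rewrite lee_fin mulr_ge0 ?powR_ge0// ltW.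
have Lf0 : 0 <= L%:E * \int[mu]_x (f x `^ p * w x)%:E.
  by rewrite mule_ge0// lee_fin ltW.
have GE : \int[mu]_x (h x `^ p * w x)%:E = G%:E.
  rewrite /G fineK; first by [].
  by rewrite (ge0_fin_numE (le_trans Lf0 (ltW Lh))); exact: hoo.
have G0 : (0 < G)%R by rewrite -lte_fin -GE (le_lt_trans Lf0 Lh).
pose l := (G `^ - p^-1)%R.
have l0 : (0 < l)%R by rewrite powR_gt0.
have lp : (l `^ p = G^-1)%R.
  by rewrite /l -powRrM mulNr mulVf ?gt_eqF// powR_inv1// ltW.
have scal (u : T -> R) : measurable_fun setT u -> (forall x, (0 <= u x)%R) ->
   \int[mu]_x ((l * u x) `^ p * w x)%:E = (G^-1)%:E * \int[mu]_x (u x `^ p * w x)%:E.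
  move=> mu_ u0; rewrite -integralZT ?invr_ge0 ?(ltW G0)//.
  - by apply: eq_integral => x _; rewrite powRM ?(ltW l0)// lp -mulrA EFinM.
  - by apply/measurable_EFinP; apply: measurable_funM => //; exact: measurable_powRT.
  - by move=> x; rewrite lee_fin mulr_ge0 ?powR_ge0// ltW.
exists g, f, (fun x => l * h x)%R, l; split=> //.
- exact: measurable_funM.
- by move=> x; rewrite mulr_ge0 ?(ltW l0)// ler_wpM2l ?(ltW l0)//; case/andP: (hg x).
- rewrite !scal// GE -EFinM mulVf ?gt_eqF//; split => //.
  rewrite muleCA; apply: (@le_trans _ _ ((G^-1)%:E * G%:E)).
    apply: lee_wpmul2l; first by rewrite lee_fin invr_ge0 ltW.
    by move: (ltW Lh); rewrite GE.
  by rewrite -EFinM mulVf ?gt_eqF.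
Qed.

Theorem extrapolation F p1 p : nonneg_pairs F -> (1 < p1)%R -> (1 < p)%R ->
  weighted_ineq Q F p1 -> weighted_ineq Q F p.
Proof.
move=> F0 p11 hp wF w Mw; have [mw w0 _] := Mw.
have p0 : (0 < p)%R by lra.
have c1 := conj_exp_gt1 hp; have Ms := Muck_dual hp Mw.
have [ms s0 _] := Ms.
apply: contrapT => nF.
(* This [L k] makes [2^(k+1) 16^k l_k f_k] of norm at most [2^(-k/p)] in L_p(w);
   the factor [16^k] beats the powers of 2 lost on the [h k] and in [half_series]. *)
pose L k := ((2 ^+ k.+1 * 16 ^+ k) `^ p * 2 ^+ k : R)%R.
have L0 k : (0 < L k)%R by rewrite mulr_gt0 ?powR_gt0// ?mulr_gt0 ?exprn_gt0.
have /choice[G HG] : forall k, exists y : ((T -> R) * (T -> R)) * ((T -> R) * R),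
    [/\ F y.1, (0 < y.2.2)%R, measurable_fun setT y.2.1,
    forall x, (0 <= y.2.1 x <= y.2.2 * y.1.1 x)%R &
    \int[mu]_x (y.2.1 x `^ p * w x)%:E = 1 /\
    (L k)%:E * \int[mu]_x ((y.2.2 * y.1.2 x) `^ p * w x)%:E <= 1].
  move=> k; have [g [f [h [l [? ? ? ? ?]]]]] := extrapolation_failure F0 hp Mw (L0 k) nF.
  by exists ((g, f), (h, l)).
pose g k := (G k).1.1; pose f k := (G k).1.2; pose h k := (G k).2.1; pose l k := (G k).2.2.
have Fk k : F (g k, f k) by have [+ _ _ _ _] := HG k; rewrite /g /f; case: (G k).1.
have l0 k : (0 < l k)%R by case: (HG k).
have mh k : measurable_fun setT (h k) by case: (HG k).
have h0 k x : (0 <= h k x)%R by have [_ _ _ /(_ x)/andP[]] := HG k.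
have hg k x : (h k x <= l k * g k x)%R by have [_ _ _ /(_ x)/andP[]] := HG k.
have h1 k : \int[mu]_x (h k x `^ p * w x)%:E = 1 by have [_ _ _ _ []] := HG k.
have f1 k : (L k)%:E * \int[mu]_x ((l k * f k x) `^ p * w x)%:E <= 1 by have [_ _ _ _ []] := HG k.
have mf k : measurable_fun setT (f k) by have [] := F0 _ _ (Fk k).
have f0 k x : (0 <= f k x)%R by have [] := F0 _ _ (Fk k).
have mg k : measurable_fun setT (g k) by have [] := F0 _ _ (Fk k).
have g0 k x : (0 <= g k x)%R by have [] := F0 _ _ (Fk k).
have m1 : measurable_fun setT (\1_(Q 0%N) : T -> R).
  by apply: measurable_indic; exact: measurable_cell.
have int1 q v : (0 < q)%R -> \int[mu]_x ((\1_(Q 0%N) x)%:E `^ q * (v x)%:E) = wvol mu v (Q 0%N).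
  move=> q0; rewrite /wvol [RHS]integral_mkcond; apply: eq_integral => x _.
  rewrite patchE indicE poweR_EFin -EFinM; case: ifPn => _; first by rewrite powR1 mul1r.
  by rewrite powR0 ?mul0r// gt_eqF.
pose a k : R := (2 ^+ k.+1 * 16 ^+ k)%R.
have a0 k : (0 <= a k)%R by rewrite mulr_ge0 ?exprn_ge0.
(* Slot 0 holds the indicator that [rubio_de_francia] wants below its input; the packed functions
   start at slot 1. *)
pose V k x : \bar R := if k is j.+1 then (a j * (l j * f j x))%:E else (\1_(Q 0%N) x)%:E.
(* h^(p-1) w is dual to h: its p'-th power integrates against sigma to int h^p w, because (p-1) p' =
   p and w^p' sigma = w. *)
pose Z k x : \bar R := if k is j.+1 then (2^-1 ^+ j * (h j x `^ (p - 1) * w x))%:E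
  else (\1_(Q 0%N) x)%:E.
have V0 k x : 0 <= V k x.
  by case: k => [|k]; rewrite lee_fin ?indicE// !mulr_ge0// ltW.
have Z0 k x : 0 <= Z k x.
  by case: k => [|k]; rewrite lee_fin ?indicE// !mulr_ge0 ?exprn_ge0 ?powR_ge0// ltW.
have mV k : measurable_fun setT (V k).
  case: k => [|k]; apply/measurable_EFinP => //.
  by apply: measurable_funM => //; exact: measurable_funM.
have mZ k : measurable_fun setT (Z k).
  case: k => [|k]; apply/measurable_EFinP => //.
  apply: measurable_funM => //; apply: measurable_funM => //; exact: measurable_powRT.
have Vc k : \int[mu]_x (V k x `^ p * (w x)%:E) <= ((rvol Q w 0 + 2) * 2^-1 ^+ k)%:E.
  case: k => [|k].
    by rewrite int1// (wvol_rvol 0 hp Mw) expr0 mulr1 lee_fin lerDl.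
  have -> : \int[mu]_x (V k.+1 x `^ p * (w x)%:E) =
      (a k `^ p)%:E * \int[mu]_x ((l k * f k x) `^ p * w x)%:E.
    rewrite -integralZT ?powR_ge0//.
    - apply: eq_integral => x _; rewrite /V poweR_EFin -EFinM powRM ?mulr_ge0 ?(ltW (l0 k))//.
      by rewrite -mulrA EFinM.
    - apply/measurable_EFinP; apply: measurable_funM => //; apply: measurable_powRT.
      exact: measurable_funM.
    - by move=> x; rewrite lee_fin mulr_ge0 ?powR_ge0// ltW.
  apply: (@le_trans _ _ ((2^-1 ^+ k)%:E * 1)).
    rewrite -(@lee_pmul2l _ (2 ^+ k)%:E)// ?lte_fin ?exprn_gt0//.
    rewrite !muleA -!EFinM -exprMn mulfV// expr1n mulr1.
    by rewrite [X in X%:E * _]mulrC; exact: f1.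
  rewrite mule1 lee_fin exprS mulrA ler_peMl ?exprn_ge0//.
  by have := rvol_gt0 0 hp Mw; lra.
have Zc k : \int[mu]_x (Z k x `^ conj_exp p * (dual_weight p w x)%:E) <=
    ((rvol Q (dual_weight p w) 0 + 2) * 2^-1 ^+ k)%:E.
  case: k => [|k].
    rewrite int1; last lra.
    by rewrite (wvol_rvol 0 c1 Ms) expr0 mulr1 lee_fin lerDl.
  have -> : \int[mu]_x (Z k.+1 x `^ conj_exp p * (dual_weight p w x)%:E) =
      ((2^-1 ^+ k) `^ conj_exp p)%:E * \int[mu]_x (h k x `^ p * w x)%:E.
    rewrite -integralZT ?powR_ge0//.
    - apply: eq_integral => x _; rewrite /Z poweR_EFin -!EFinM; congr (_%:E).
      rewrite !powRM ?exprn_ge0 ?mulr_ge0 ?powR_ge0 ?(ltW (w0 x))//.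
      rewrite -!mulrA; congr (_ * _)%R; rewrite -powRrM conj_exp_mulp//; congr (_ * _)%R.
      rewrite /dual_weight -powRD ?subrKC ?powRr1 ?(ltW (w0 x))//.
      by apply/implyP => _; rewrite gt_eqF.
    - by apply/measurable_EFinP; apply: measurable_funM => //; exact: measurable_powRT.
    - by move=> x; rewrite lee_fin mulr_ge0 ?powR_ge0// ltW.
  rewrite h1 mule1 lee_fin; apply: (@le_trans _ _ (2^-1 ^+ k)%R).
    apply: ge1r_powR; last exact: ltW.
    by rewrite exprn_gt0//= exprn_ile1// invf_le1// ler1n.
  rewrite exprS mulrA ler_peMl ?exprn_ge0//.
  by have := rvol_gt0 0 c1 Ms; lra.
have half_ge1 (v : nat -> T -> \bar R) (v0 : forall k x, 0 <= v k x) : v 0%N = (fun x => (\1_(Q 0%N) x)%:E) ->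
    forall x, (\1_(Q 0%N) x)%:E <= half_series v x.
  by move=> v1 x; have := half_series_ge 0 (v0 ^~ x); rewrite v1 expr0 mul1e.
have [||b Hb] := extrapolation_step F0 p11 wF hp Mw
  (measurable_half_series mV V0) (half_ge1 _ V0 erefl) _
  (measurable_half_series mZ Z0) (half_ge1 _ Z0 erefl) _.
- apply: (integral_half_series_le _ _ _ _ mV V0 Vc) => //.
  by rewrite addr_ge0// ltW// (rvol_gt0 _ hp Mw).
- apply: (integral_half_series_le _ _ _ _ mZ Z0 Zc) => //; first lra.
  by rewrite addr_ge0// ltW// (rvol_gt0 _ c1 Ms).
(* The (k+1)-th terms of the two half series are 16^k l f and 2^-(k+1) 2^-k h^(p-1) w. As l g >= h,
   pairing 16^k l g with the latter gives at least 16^k 2^-(2k+1) int h^p w = 4^k / 2. *)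
have key k : (4 ^+ k / 2 <= b)%R.
  rewrite -lee_fin.
  pose hh x := (2^-1 ^+ k.+1 * (2^-1 ^+ k * (h k x `^ (p - 1) * w x)))%R.
  have hh0 x : (0 <= hh x)%R by rewrite !mulr_ge0 ?exprn_ge0 ?powR_ge0// ltW.
  have mhh : measurable_fun setT hh.
    do 3!apply: measurable_funM => //; exact: measurable_powRT.
  apply: le_trans (Hb (g k) (f k) (16 ^+ k * l k)%R hh (Fk k) _ mhh hh0 _ _); first last.
  - by move=> x; apply: le_trans (half_series_ge k.+1 (Z0 ^~ x)).
  - move=> x; apply: le_trans (half_series_ge k.+1 (V0 ^~ x)).
    rewrite /V /a -EFinM lee_fin le_eqVlt; apply/orP; left; apply/eqP.
    by rewrite -!mulrA exprVn mulKf ?expf_neq0// mulrA.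
  - by rewrite mulr_ge0 ?exprn_ge0// ltW.
  have -> : (4 ^+ k / 2)%:E = (16 ^+ k * (2^-1 ^+ k.+1 * 2^-1 ^+ k))%:E * \int[mu]_x (h k x `^ p * w x)%:E.
    rewrite h1 mule1; congr (_%:E).
    rewrite exprS -(_ : (4 * 2 * 2 = 16 :> R)%R); last by ring.
    by rewrite !exprMn !exprVn; field; rewrite expf_neq0.
  rewrite -integralZT; first last.
  - by rewrite !mulr_ge0 ?exprn_ge0.
  - by move=> x; rewrite lee_fin mulr_ge0 ?powR_ge0// ltW.
  - by apply/measurable_EFinP; apply: measurable_funM => //; exact: measurable_powRT.
  apply: le_integralT.
  - apply: measurable_funeM; apply/measurable_EFinP; apply: measurable_funM => //.
    exact: measurable_powRT.
  - by apply/measurable_EFinP; apply: measurable_funM => //; exact: measurable_funM.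
  - move=> x; apply: mule_ge0; rewrite lee_fin; first by rewrite !mulr_ge0 ?exprn_ge0.
    by rewrite mulr_ge0 ?powR_ge0// ltW.
  move=> x; rewrite -EFinM lee_fin /hh.
  rewrite -(powRsubK (h0 k x) p0).
  set c2 := (2^-1 ^+ k.+1)%R; set c3 := (2^-1 ^+ k)%R; set c4 := (16 ^+ k)%R.
  have -> : (c4 * (c2 * c3) * (h k x `^ (p - 1) * h k x * w x) =
     (c4 * (c2 * (c3 * (h k x `^ (p - 1) * w x)))) * h k x)%R by ring.
  have -> : (c4 * l k * g k x * (c2 * (c3 * (h k x `^ (p - 1) * w x))) =
     (c4 * (c2 * (c3 * (h k x `^ (p - 1) * w x)))) * (l k * g k x))%R by ring.
  rewrite ler_wpM2l//.
  by rewrite !mulr_ge0 ?exprn_ge0 ?powR_ge0// ltW.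
have := key (Num.bound (2 * b)%R); apply/negP; rewrite -ltNge ltr_pdivlMr// mulrC.
apply: (@lt_le_trans _ _ (2 ^+ Num.bound (2 * b))%R); first exact: upper_nthrootP.
by apply: lerXn2r; rewrite ?nnegrE// ler_nat.
Qed.

End extrapolation_theorem.

(** * Morrey norms *)

Section decaying_weights.
Context d (T : measurableType d) (R : realType) (mu : {measure set T -> \bar R}).
Variable Q : covering_basis mu.
Variables (p : R) (w : T -> R).
Hypotheses (hp : 1 < p) (Mw : Muck Q p w).
Local Notation W := (rvol Q w).
Local Notation q := (fun i k => iter k (enl Q) i).
Variables (x0 Cd : R).
Hypotheses (x01 : 0 < x0 < 1) (Wgrowth : forall i, W i <= x0 * W (enl Q i)).
Hypotheses (Cd0 : 0 < Cd) (Wdbl : forall i, W (enl Q i) <= Cd * W i).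

Let W0 i : 0 < W i. Proof. exact: rvol_gt0 hp Mw. Qed.
Let x00 : 0 < x0. Proof. by case/andP: x01. Qed.
Let mw : measurable_fun setT w. Proof. by case: Mw. Qed.
Let w0 x : 0 < w x. Proof. by case: Mw. Qed.
Let wE i : wvol mu w (Q i) = (W i)%:E. Proof. exact: wvol_rvol hp Mw. Qed.

Lemma rvol_iter_le i k l : (k <= l)%N -> W (q i k) <= x0 ^+ (l - k) * W (q i l).
Proof.
move=> /subnK; move: (l - k)%N => m <- {l}; elim: m => [|m IH].
  by rewrite add0n expr0 mul1r.
apply: (le_trans IH); rewrite addSn iterS exprSr -mulrA.
by rewrite ler_wpM2l// exprn_ge0// ltW.
Qed.

Definition decay_coef (e : R) i k := (W i / W (q i k)) `^ e.

Lemma decay_coef_gt0 e i k : 0 < decay_coef e i k.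
Proof. by rewrite powR_gt0// divr_gt0. Qed.

Lemma decay_coef_ge0 e i k : 0 <= decay_coef e i k.
Proof. exact: powR_ge0. Qed.

Lemma decay_coef_le e i k l : 0 <= e -> (k <= l)%N ->
  decay_coef e i l <= (x0 `^ e) ^+ (l - k) * decay_coef e i k.
Proof.
move=> e0 kl.
rewrite -powR_mulrn ?powR_ge0// powRAC -powRM; last 2 first.
- exact: powR_ge0.
- by rewrite divr_ge0// ltW.
rewrite /decay_coef; apply: ge0_ler_powR => //; rewrite ?nnegrE.
- by rewrite divr_ge0// ltW.
- by rewrite mulr_ge0 ?powR_ge0 ?divr_ge0// ltW.
rewrite powR_mulrn ?(ltW x00)// mulrCA ler_wpM2l ?(ltW (W0 i))//.
rewrite ler_pdivlMr// mulrC ler_pdivrMr//; exact: rvol_iter_le.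
Qed.

Lemma decay_coef_succ e i k : 0 <= e ->
  decay_coef e i k <= Cd `^ e * decay_coef e i k.+1.
Proof.
move=> e0; rewrite -powRM ?(ltW Cd0) ?divr_ge0 ?(ltW (W0 _))//.
apply: ge0_ler_powR => //; rewrite ?nnegrE ?mulr_ge0 ?divr_ge0 ?(ltW (W0 _)) ?(ltW Cd0)//.
1,2: by rewrite invr_ge0 ltW.
rewrite mulrCA ler_wpM2l ?(ltW (W0 _))// ler_pdivlMr// mulrC ler_pdivrMr//.
exact: Wdbl.
Qed.

Local Open Scope ereal_scope.

(* The function [phi_Q] of the header, for the cell [Q] of index [i]. *)
Definition decay (e : R) i x := \sum_(k <oo) (decay_coef e i k * \1_(Q (q i k)) x)%:E.

Let indic1 (A : set T) x : A x -> (\1_A x = 1 :> R)%R.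
Proof. by move=> Ax; rewrite indicE mem_set. Qed.

Let bterm0 e i k x : 0 <= (decay_coef e i k * \1_(Q (q i k)) x)%:E.
Proof. by rewrite lee_fin mulr_ge0 ?indicE// ltW// decay_coef_gt0. Qed.

Lemma decay_ge0 e i x : 0 <= decay e i x.
Proof. by apply: nneseries_ge0 => *. Qed.

Lemma decay_ge e i k x : Q (q i k) x -> (decay_coef e i k)%:E <= decay e i x.
Proof.
move=> Qx; apply: le_trans (@nneseries_term_le _ _ k (fun k => bterm0 e i k x)).
by rewrite (indic1 Qx) mulr1 lexx.
Qed.

Lemma measurable_decay e i : measurable_fun setT (decay e i).
Proof.
apply: ge0_emeasurable_sum => // k _; apply/measurable_EFinP.
by apply: measurable_funM => //; apply: measurable_indic; exact: measurable_cell.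
Qed.

Lemma integral_decay e i (h : T -> \bar R) : measurable_fun setT h -> (forall x, 0 <= h x) ->
  \int[mu]_x (h x * decay e i x) =
  \sum_(k <oo) (decay_coef e i k)%:E * \int[mu]_(x in Q (q i k)) h x.
Proof.
move=> mh h0.
have mb k : measurable_fun setT (fun x => (decay_coef e i k)%:E * (h \_ (Q (q i k))) x).
  apply: measurable_funeM; apply/(measurable_restrictT _ (measurable_cell Q _)).
  exact: measurable_funTS.
transitivity (\int[mu]_x \sum_(k <oo) (decay_coef e i k)%:E * (h \_ (Q (q i k))) x).
  apply: eq_integral => x _; rewrite /decay.
  have E k : (decay_coef e i k)%:E * (h \_ (Q (q i k))) x = h x * (decay_coef e i k * \1_(Q (q i k)) x)%:E.
    rewrite patchE indicE; case: ifPn => _; last by rewrite mulr0 !mule0.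
    by rewrite mulr1 muleC.
  under [RHS]eq_eseriesr do rewrite E.
  have := h0 x; case: (h x) => [r r0|_|//].
    by rewrite nneseriesZl.
  (* Where h is infinite the constant cannot be pulled out of the series; instead both sides are
     infinite, since some coefficient is positive at x. *)
  have [k Qx] := cell_iter_cover Q i x.
  have bp : 0 < decay e i x.
    by apply: lt_le_trans (decay_ge e Qx); rewrite lte_fin decay_coef_gt0.
  rewrite gt0_mulye//; apply/esym/eqP; rewrite -leye_eq.
  apply: (le_trans _ (@nneseries_term_le _
    (fun k => +oo * (decay_coef e i k * \1_(Q (q i k)) x)%:E) k _)).
    rewrite (indic1 Qx) mulr1 gt0_mulye; first exact: lexx.
    by rewrite lte_fin decay_coef_gt0.
  by move=> j; apply: mule_ge0.
rewrite integral_nneseries//; last first.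
  move=> k x _; rewrite mule_ge0 ?lee_fin ?decay_coef_ge0//.
  exact: erestrict_ge0.
apply: eq_eseriesr => k _; rewrite integralZT ?(ltW (decay_coef_gt0 _ _ _))//.
- by rewrite [in RHS]integral_mkcond.
- apply/(measurable_restrictT _ (measurable_cell Q _)); exact: measurable_funTS.
- by move=> x; exact: erestrict_ge0.
Qed.

Lemma powR_lt1 e : (0 < e)%R -> (0 <= x0 `^ e < 1)%R.
Proof.
move=> e0; rewrite powR_ge0/= (_ : 1 = 1 `^ e)%R; last by rewrite powR1.
by apply: gt0_ltr_powR => //; rewrite ?nnegrE ?(ltW x00)//; case/andP: x01.
Qed.

(** (W_i/W_k)^e W_k^b = W_i^b (W_i/W_k)^(e-b), where W_k is the weight of the k-th enlargement, and
    this is summable in k because e > b. *)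
Lemma decay_Morrey e b : (0 <= b)%R -> (b < e)%R -> exists2 C : R, (0 < C)%R &
  forall i (h : T -> \bar R) (X : R), measurable_fun setT h -> (forall x, 0 <= h x) ->
  (0 <= X)%R -> (forall j, \int[mu]_(x in Q j) h x <= (X * W j `^ b)%:E) ->
  \int[mu]_x (h x * decay e i x) <= (C * X * W i `^ b)%:E.
Proof.
move=> b0 be; have eb0 : (0 < e - b)%R by lra.
have xx := powR_lt1 eb0; have [xx0 xx1] := andP xx.
exists (1 - x0 `^ (e - b))^-1%R; first by rewrite invr_gt0; lra.
move=> i h X mh h0 X0 hX; rewrite integral_decay//.
apply: (@le_trans _ _ (\sum_(k <oo) ((X * W i `^ b) * (x0 `^ (e - b)) ^+ k)%:E)); last first.
  apply: (le_trans (nneseries_geometric_bound xx _)); first by rewrite mulr_ge0// powR_ge0.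
  by rewrite lee_fin -[leRHS]mulrA [leRHS]mulrC.
apply: lee_nneseries => [k _ _|k _].
  by rewrite mule_ge0 ?integral_ge0// lee_fin decay_coef_ge0.
apply: (le_trans (lee_wpmul2l _ (hX _))); first by rewrite lee_fin decay_coef_ge0.
rewrite -EFinM lee_fin.
have -> : (decay_coef e i k * (X * W (q i k) `^ b) = (X * W i `^ b) * decay_coef (e - b) i k)%R.
  have Wp z : (0 < W z `^ b)%R by exact: powR_gt0.
  rewrite /decay_coef powRB; last by apply/implyP => _; rewrite gt_eqF// divr_gt0.
  rewrite [((W i / _) `^ b)%R]powR_div ?(ltW (W0 _))//.
  rewrite invf_div; have := gt_eqF (Wp i); have := gt_eqF (Wp (q i k)).
  move: (powR (W i) _) (powR (W (q i k)) _) (powR (W i / _) _) => z1 z2 z3 z10 z20.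
  by field; rewrite ?z10 ?z20.
rewrite ler_wpM2l ?mulr_ge0 ?powR_ge0//.
have := @decay_coef_le (e - b)%R i 0 k (ltW eb0) (leq0n k).
by rewrite subn0 {2}/decay_coef /= divff ?gt_eqF// powR1 mulr1.
Qed.

(** The product of coefficient and weight is W_i^e W_k^(1-e), which inherits the geometric growth of
    W_k. *)
Lemma decay_coef_rvol e i k l : (e <= 1)%R -> (k <= l)%N ->
  (decay_coef e i k * W (q i k) <=
   (x0 `^ (1 - e)) ^+ (l - k) * (decay_coef e i l * W (q i l)))%R.
Proof.
move=> e1 kl.
have E k' : (decay_coef e i k' * W (q i k') = W i `^ e * W (q i k') `^ (1 - e))%R.
  have Wk := W0 (q i k').
  rewrite /decay_coef powR_div ?(ltW (W0 _))// -mulrA; congr (_ * _)%R.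
  rewrite powRB; last by apply/implyP => _; rewrite gt_eqF.
  by rewrite powRr1 ?(ltW Wk)// mulrC.
rewrite (E k) (E l) [leRHS]mulrCA; apply: ler_wpM2l; first exact: powR_ge0.
rewrite -powR_mulrn ?powR_ge0// powRAC -powRM ?powR_ge0 ?(ltW (W0 _))//.
apply: ge0_ler_powR; rewrite ?nnegrE ?subr_ge0 ?(ltW (W0 _))//.
  by rewrite mulr_ge0 ?powR_ge0 ?(ltW (W0 _)).
by rewrite powR_mulrn ?(ltW x00)//; exact: rvol_iter_le.
Qed.

Definition cell_weight j (x : T) : \bar R := (w x * \1_(Q j) x)%:E.

Lemma cell_weight_ge0 j x : 0 <= cell_weight j x.
Proof. by rewrite lee_fin mulr_ge0 ?indicE// ltW. Qed.

Lemma measurable_cell_weight j : measurable_fun setT (cell_weight j).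
Proof.
apply/measurable_EFinP; apply: measurable_funM => //; apply: measurable_indic.
exact: measurable_cell.
Qed.

Lemma integral_cell_weight j (h : T -> \bar R) :
  \int[mu]_x (cell_weight j x * h x) = \int[mu]_(x in Q j) ((w x)%:E * h x).
Proof.
rewrite [RHS]integral_mkcond; apply: eq_integral => x _.
rewrite patchE /cell_weight indicE; case: ifPn => _; first by rewrite mulr1.
by rewrite mulr0 mul0e.
Qed.

Lemma cell_weight_le_left j k : \int[mu]_(x in Q k) cell_weight j x <= (W j)%:E.
Proof.
apply: (@le_trans _ _ (\int[mu]_x cell_weight j x)).
  apply: ge0_integral_le => //.
  - exact: measurable_cell.
  - exact: measurable_cell_weight.
  - exact: cell_weight_ge0.
have := integral_cell_weight j (cst 1); under eq_integral do rewrite mule1; move=> ->.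
by under eq_integral do rewrite mule1; rewrite -/(wvol mu w _) wE lexx.
Qed.

Lemma cell_weight_le_right j k : \int[mu]_(x in Q k) cell_weight j x <= (W k)%:E.
Proof.
rewrite -wE; apply: ge0_le_integral => //; first exact: measurable_cell.
- by move=> x _; exact: cell_weight_ge0.
- by apply: measurable_funTS; exact: measurable_cell_weight.
- by apply: measurable_funTS; exact/measurable_EFinP.
move=> x _; rewrite lee_fin indicE; case: (_ \in _); rewrite ?mulr1 ?mulr0//.
exact: ltW.
Qed.

Lemma cell_weight_disjoint j k : ~ (Q k `&` Q j !=set0) ->
  \int[mu]_(x in Q k) cell_weight j x = 0.
Proof.
move=> kj; rewrite -[RHS](integral0 mu (Q k)); apply: eq_integral => x.
rewrite inE => Qkx; rewrite /cell_weight indicE memNset ?mulr0// => Qjx.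
by apply: kj; exists x.
Qed.

(** The series is split at the first enlargement of i that meets Q_j and is at least as large as
    Q_j. Both parts are geometric sums dominated by their terms next to the split, and these are
    comparable with W_j times the coefficient that bounds [decay] from below at x. *)
Lemma decay_A1 e : (0 < e < 1)%R -> exists2 C : R, (0 < C)%R & forall i j x, Q j x ->
  \int[mu]_y (cell_weight j y * decay e i y) <= (C * W j)%:E * decay e i x.
Proof.
move=> /andP[e0 e1]; have e10 : (0 < 1 - e)%R by lra.
have r1 := powR_lt1 e0; have r2 := powR_lt1 e10.
have [r10 r11] := andP r1; have [r20 r21] := andP r2.
have Ce0 : (0 < Cd `^ e)%R by exact: powR_gt0.
have D1 : (0 < 1 - x0 `^ e)%R by lra.
have D2 : (0 < 1 - x0 `^ (1 - e))%R by lra.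
pose A := (Cd `^ e * Cd `^ e * Cd / (1 - x0 `^ (1 - e)))%R.
pose B := (Cd `^ e / (1 - x0 `^ e))%R.
have A0 : (0 < A)%R by rewrite divr_gt0// !mulr_gt0.
have B0 : (0 < B)%R by rewrite divr_gt0.
exists (A + B)%R; first by rewrite addr_gt0.
move=> i j x Qjx; rewrite integral_decay; [|exact: measurable_cell_weight|exact: cell_weight_ge0].
have meets : exists k, `[< Q (q i k) `&` Q j !=set0 >].
  by have [k Qx] := cell_iter_cover Q i x; exists k; apply/asboolP; exists x.
pose k0 := ex_minn meets.
have [k0m k0min] : Q (q i k0) `&` Q j !=set0 /\
    forall k, (k < k0)%N -> ~ (Q (q i k) `&` Q j !=set0).
  rewrite /k0; case: ex_minnP => k /asboolP kj kmin; split=> // l lk lj.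
  by have := kmin l (asboolT lj); rewrite leqNgt lk.
have large : exists m, (k0 <= m)%N && (vol Q j <= vol Q (q i m))%R.
  have [m mj] := vol_iter_large Q i (vol Q j); exists (maxn k0 m); rewrite leq_maxl/=.
  apply: (le_trans mj); rewrite !vol_iter ler_wpM2r ?(ltW (vol_gt0 _ _))//.
  by rewrite ler_eXn2l ?leq_maxr// dilation_gt1.
have [m [k0m' mj mmin]] : exists m, [/\ (k0 <= m)%N, (vol Q j <= vol Q (q i m))%R &
    forall k, (k0 <= k)%N -> (k < m)%N -> (vol Q (q i k) < vol Q j)%R].
  case: (ex_minnP large) => m /andP[k0m' mj] mmin; exists m; split=> // k k0k km.
  by rewrite ltNge; apply/negP => jk; have := mmin k; rewrite k0k jk leqNgt km => /(_ isT).
have meet_ge k : (k0 <= k)%N -> Q (q i k) `&` Q j !=set0.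
  by move=> k0k; case: k0m => y [Qy Qjy]; exists y; split=> //; exact: (cell_iter_le k0k).
(* Enlargement m may only meet Q_j; the next one contains it, hence the index m + 1. *)
have bx : (decay_coef e i m.+1)%:E <= decay e i x.
  apply: decay_ge; rewrite iterS; apply: (cell_engulf mj _ Qjx); exact: meet_ge.
pose b := decay_coef e i m.+1.
have b0 : (0 < b)%R by exact: decay_coef_gt0.
have bm : (decay_coef e i m <= Cd `^ e * b)%R by apply: decay_coef_succ; exact: ltW.
pose t k := (decay_coef e i k)%:E * \int[mu]_(y in Q (q i k)) cell_weight j y.
have t0 k : 0 <= t k.
  rewrite mule_ge0 ?lee_fin ?decay_coef_ge0//.
  by apply: integral_ge0 => y _; exact: cell_weight_ge0.
(* For large cells the mass is at most W_j and the coefficients decay. *)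
have tge k : (m <= k)%N -> t k <= ((Cd `^ e * b * W j) * (x0 `^ e) ^+ (k - m))%:E.
  move=> mk; apply: (@le_trans _ _ ((decay_coef e i k)%:E * (W j)%:E)).
    apply: lee_wpmul2l; last exact: cell_weight_le_left.
    by rewrite lee_fin decay_coef_ge0.
  rewrite -EFinM lee_fin mulrAC ler_wpM2r ?(ltW (W0 j))//.
  apply: (le_trans (decay_coef_le i (ltW e0) mk)).
  by rewrite mulrC ler_wpM2r// exprn_ge0.
(* For small cells the mass is at most that of the cell, and coefficient times mass grows up to
   index m - 1. That cell is smaller than Q_j, so it lies in the enlargement of Q_j, which costs
   [Cd]; two steps from m - 1 to m + 1 cost [Cd^e] each. Cells that miss Q_j contribute 0. *)
have tlt k : (k < m)%N ->
    t k <= ((Cd `^ e * Cd `^ e * Cd * b * W j) * (x0 `^ (1 - e)) ^+ (m.-1 - k))%:E.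
  move=> km; have [kk0|k0k] := ltnP k k0.
    rewrite /t (cell_weight_disjoint (k0min _ kk0)) mule0 lee_fin.
    by rewrite !mulr_ge0 ?exprn_ge0 ?(ltW b0) ?(ltW Cd0) ?(ltW Ce0) ?(ltW (W0 j)).
  have [m1 Em] : exists m1, m = m1.+1.
    by exists m.-1; rewrite prednK//; exact: leq_ltn_trans km.
  have -> : m.-1 = m1 by rewrite Em.
  have m1m : (m1 < m)%N by rewrite Em.
  have km1 : (k <= m1)%N by rewrite -ltnS -Em.
  have k0m1 : (k0 <= m1)%N by exact: leq_trans km1.
  apply: (@le_trans _ _ ((decay_coef e i k)%:E * (W (q i k))%:E)).
    apply: lee_wpmul2l; last exact: cell_weight_le_right.
    by rewrite lee_fin decay_coef_ge0.
  rewrite -EFinM lee_fin; apply: (le_trans (decay_coef_rvol i (ltW e1) km1)).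
  rewrite mulrC; apply: ler_wpM2r; first by rewrite exprn_ge0.
  have Wm1 : (W (q i m1) <= Cd * W j)%R.
    apply: le_trans (Wdbl j); rewrite -lee_fin -!wE; apply: wvol_le => //.
    - by move=> y; exact: ltW.
    - exact: measurable_cell.
    - exact: measurable_cell.
    apply: cell_engulf; first by apply: ltW; exact: mmin.
    by rewrite setIC; exact: meet_ge.
  have bm1 : (decay_coef e i m1 <= Cd `^ e * (Cd `^ e * b))%R.
    have bs := decay_coef_succ i m1 (ltW e0); rewrite -Em in bs.
    by apply: (le_trans bs); apply: ler_wpM2l; [exact: ltW|exact: bm].
  have -> : (Cd `^ e * Cd `^ e * Cd * b * W j = (Cd `^ e * (Cd `^ e * b)) * (Cd * W j))%R by ring.
  by apply: ler_pM; [exact: decay_coef_ge0|exact: ltW|exact: bm1|exact: Wm1].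
apply: (@le_trans _ _ ((A + B) * W j * b)%:E); last first.
  rewrite [leLHS]EFinM; apply: lee_wpmul2l => //.
  by rewrite lee_fin mulr_ge0 ?(ltW (W0 j))// ltW// addr_gt0.
have -> : \sum_(k <oo) t k = \sum_(0 <= k < m) t k + \sum_(m <= k <oo) t k.
  by apply: (@nneseries_split _ t 0%N m) => k _; exact: t0.
have -> : ((A + B) * W j * b)%:E = (A * b * W j)%:E + (B * b * W j)%:E.
  by rewrite -EFinD; congr (_%:E); ring.
apply: leeD.
  rewrite big_nat; apply: (@le_trans _ _ (\sum_(0 <= k < m | (0 <= k < m)%N)
      ((Cd `^ e * Cd `^ e * Cd * b * W j) * (x0 `^ (1 - e)) ^+ (m.-1 - k))%:E)).
    by apply: lee_sum => k /andP[_ km]; exact: tlt.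
  rewrite -big_nat sumEFin lee_fin big_nat_rev/= add0n.
  have -> : (A * b * W j = (Cd `^ e * Cd `^ e * Cd * b * W j) / (1 - x0 `^ (1 - e)))%R.
    by rewrite /A; field; rewrite gt_eqF.
  apply: le_trans (sum_geometric_le m r2 _); last first.
    by rewrite !mulr_ge0 ?(ltW b0) ?(ltW Cd0) ?(ltW Ce0) ?(ltW (W0 j)).
  rewrite le_eqVlt; apply/orP; left; apply/eqP.
  apply: eq_big_nat => k /andP[_ km]; congr (_ * _ ^+ _)%R.
  by case: (m) km => // m'; rewrite subSS ltnS => /subKn.
rewrite -nneseries_addn//.
apply: (@le_trans _ _ (\sum_(k <oo) ((Cd `^ e * b * W j) * (x0 `^ e) ^+ k)%:E)).
  apply: lee_nneseries => [k _ _|k _]; first exact: t0.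
  by have := tge (k + m)%N; rewrite addnK leq_addl => /(_ isT).
apply: (le_trans (nneseries_geometric_bound r1 _)).
  by rewrite !mulr_ge0 ?(ltW b0) ?(ltW Ce0) ?(ltW (W0 j)).
rewrite lee_fin le_eqVlt; apply/orP; left; apply/eqP; rewrite /B.
by field; rewrite gt_eqF.
Qed.

End decaying_weights.

(** * From weighted L_p bounds to Morrey bounds *)

Section Morrey_extrapolation.
Context d (T : measurableType d) (R : realType) (mu : {measure set T -> \bar R}).
Variable Q : covering_basis mu.
Implicit Types (F : set ((T -> R) * (T -> R))) (p : R) (w : T -> R).
Local Open Scope ereal_scope.

Lemma integral_half_series (r : T -> R) (v : nat -> T -> \bar R) :
  measurable_fun setT r -> (forall x, (0 <= r x)%R) ->
  (forall k, measurable_fun setT (v k)) -> (forall k x, 0 <= v k x) ->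
  \int[mu]_x ((r x)%:E * half_series v x) =
  \sum_(k <oo) (2^-1 ^+ k)%:E * \int[mu]_x ((r x)%:E * v k x).
Proof.
move=> mr r0 mv v0.
have e0 k : (0 <= 2^-1 ^+ k :> R)%R by rewrite exprn_ge0.
have mt k : measurable_fun setT (fun x => (r x)%:E * v k x).
  by apply: emeasurable_funM => //; exact/measurable_EFinP.
have t0 k x : 0 <= (r x)%:E * v k x by apply: mule_ge0; rewrite ?lee_fin.
transitivity (\int[mu]_x \sum_(k <oo) (2^-1 ^+ k)%:E * ((r x)%:E * v k x)).
  apply: eq_integral => x _; rewrite /half_series -nneseriesZl; last first.
    by move=> k _; apply: mule_ge0; rewrite ?lee_fin.
  by apply: eq_eseriesr => k _; rewrite muleCA.
rewrite integral_nneseries//; last 2 first.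
- by move=> k; exact: measurable_funeM.
- by move=> k x _; apply: mule_ge0; rewrite ?lee_fin.
by apply: eq_eseriesr => k _; rewrite integralZT.
Qed.

(** The integral of w 1_(Q_j) over Q_l is at most w(Q_j) and at most w(Q_l); interpolation turns
    this into a Morrey bound with exponent b. *)
Lemma powR_interpolation (a b e : R) : (0 < a)%R -> (0 < b)%R -> (0 <= e <= 1)%R ->
  (Num.min a b <= a `^ (1 - e) * b `^ e)%R.
Proof.
move=> a0 b0 /andP[e0 e1].
have E c : (0 < c)%R -> (c = c `^ (1 - e) * c `^ e)%R.
  move=> c0; rewrite -powRD ?subrK ?powRr1 ?(ltW c0)//.
  by apply/implyP => _; rewrite gt_eqF.
have [ab|ba] := leP a b.
  rewrite {1}(E a a0); apply: ler_wpM2l; first exact: powR_ge0.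
  by apply: ge0_ler_powR; rewrite ?nnegrE ?(ltW a0) ?(ltW b0).
rewrite {1}(E b b0); apply: ler_wpM2r; first exact: powR_ge0.
by apply: ge0_ler_powR; rewrite ?nnegrE ?subr_ge0 ?(ltW a0) ?(ltW b0) ?(ltW ba).
Qed.

(** phi satisfies an A_1 condition relative to w: on a cell it acts like the constant t, whose
    powers t and (t^(1-p'))^(p-1) = 1/t cancel in the product. *)
Lemma Muck_mul p w (C : R) (phi : T -> R) : (1 < p)%R -> Muck Q p w -> (0 < C)%R ->
  measurable_fun setT phi -> (forall x, (0 < phi x)%R) ->
  (forall j, exists2 t : R, (0 < t)%R &
    wvol mu (fun x => w x * phi x)%R (Q j) <= (C * rvol Q w j * t)%:E /\
    {ae mu, forall x, Q j x -> (t <= phi x)%R}) ->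
  Muck Q p (fun x => w x * phi x)%R.
Proof.
move=> p1 Mw C0 mphi phi0 H; have [mw w0 _] := Mw.
have c1 := conj_exp_gt1 p1; have Ms := Muck_dual p1 Mw.
have [K K0 HK] := Muck_rvol p1 Mw.
have mW : measurable_fun setT (fun x => w x * phi x)%R by exact: measurable_funM.
have W0 x : (0 < w x * phi x)%R by rewrite mulr_gt0.
split => //; exists (C * K)%R => j; have [t t0 [H1 tphi]] := H j.
set s := dual_weight p w in Ms HK.
have ms : measurable_fun setT s by exact: measurable_dual_weight.
have s0 x : (0 < s x)%R by exact: dual_weight_gt0.
have mQ := measurable_cell Q j.
have H2 : wvol mu (dual_weight p (fun x => w x * phi x)%R) (Q j) <=
    (t `^ (1 - conj_exp p))%:E * wvol mu s (Q j).
  rewrite (wvolZ mu ms (fun x => ltW (s0 x)) mQ (powR_ge0 _ _)).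
  apply: ae_ge0_le_integral => //.
  - by move=> x _; rewrite lee_fin powR_ge0.
  - by apply: measurable_funTS; apply/measurable_EFinP; exact: measurable_dual_weight.
  - by move=> x _; rewrite lee_fin mulr_ge0 ?powR_ge0.
  - by apply: measurable_funTS; apply/measurable_EFinP; exact: measurable_funM.
  apply: filterS tphi => x tx Qx; rewrite lee_fin.
  rewrite /s /dual_weight powRM ?(ltW (w0 x)) ?(ltW (phi0 x))// mulrC.
  apply: ler_wpM2r; first exact: powR_ge0.
  rewrite -(opprB (conj_exp p)) !powRN lef_pV2 ?posrE ?powR_gt0//.
  by apply: ge0_ler_powR; rewrite ?nnegrE ?(ltW t0) ?(ltW (phi0 x)) ?tx//; lra.
rewrite (wvol_rvol j c1 Ms) -EFinM in H2.
apply: (@le_trans _ _ ((C * rvol Q w j * t)%:E *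
    ((t `^ (1 - conj_exp p) * rvol Q s j)%:E `^ (p - 1)))).
  apply: lee_pmul; [|exact: poweR_ge0|exact: H1|].
    by apply: wvol_ge0 => x; exact: ltW.
  apply: le_poweR; [lra| |exact: H2].
  by apply: wvol_ge0 => x; exact: powR_ge0.
rewrite poweR_EFin -EFinM lee_fin powRM ?powR_ge0//; last first.
  exact: ltW (rvol_gt0 j c1 Ms).
rewrite -powRrM conj_exp_mul// powR_inv1 ?(ltW t0)//.
have -> : (C * rvol Q w j * t * (t^-1 * rvol Q s j `^ (p - 1)) =
   C * (rvol Q w j * rvol Q s j `^ (p - 1)))%R by field; rewrite gt_eqF.
by rewrite -mulrA ler_wpM2l ?(ltW C0)//; exact: HK.
Qed.

Theorem Morrey_extrapolation F p w (b : R) : nonneg_pairs F -> weighted_ineq Q F p ->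
  (1 < p)%R -> Muck Q p w -> (0 <= b < 1)%R ->
  exists2 c : R, (0 < c)%R & forall g f (X : R), F (g, f) -> (0 <= X)%R ->
    (forall j, \int[mu]_(x in Q j) (f x `^ p * w x)%:E <= (X * rvol Q w j `^ b)%:E) ->
    forall j, \int[mu]_(x in Q j) (g x `^ p * w x)%:E <= (c * X * rvol Q w j `^ b)%:E.
Proof.
move=> F0 wF p1 Mw /andP[b0 b1]; have [mw w0 _] := Mw.
have [x0 x01 Hg] := Muck_growth p1 Mw.
have [Cd Cd0 Hd] := Muck_doubling p1 Mw.
pose e := ((1 + b) / 2)%R.
have be : (b < e)%R by rewrite /e; lra.
have e01 : (0 < e < 1)%R by rewrite /e; apply/andP; split; lra.
have [C1 C10 HC1] := decay_Morrey p1 Mw x01 Hg b0 be.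
have [C2 C20 HC2] := decay_A1 p1 Mw x01 Hg Cd0 Hd e01.
have W0 i : (0 < rvol Q w i)%R by exact: rvol_gt0 p1 Mw.
apply: contrapT => nc.
have /choice[G HG] : forall k, exists y : ((T -> R) * (T -> R)) * (R * nat),
    [/\ F y.1, (0 <= y.2.1)%R,
    forall j, \int[mu]_(x in Q j) (y.1.2 x `^ p * w x)%:E <= (y.2.1 * rvol Q w j `^ b)%:E &
    (4 ^+ k * y.2.1 * rvol Q w y.2.2 `^ b)%:E <
      \int[mu]_(x in Q y.2.2) (y.1.1 x `^ p * w x)%:E].
  move=> k; apply: contrapT => nex; apply: nc; exists (4 ^+ k)%R; first by rewrite exprn_gt0.
  move=> g f X Fgf X0 fX j; rewrite leNgt; apply/negP => gj; apply: nex.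
  by exists ((g, f), (X, j)).
pose g k := (G k).1.1; pose f k := (G k).1.2; pose X k := (G k).2.1; pose i k := (G k).2.2.
have Fk k : F (g k, f k) by have [+ _ _ _] := HG k; rewrite /g /f; case: (G k).1.
have X0 k : (0 <= X k)%R by case: (HG k).
have fX k : forall j, \int[mu]_(x in Q j) (f k x `^ p * w x)%:E <= (X k * rvol Q w j `^ b)%:E.
  by case: (HG k).
have gX k : (4 ^+ k * X k * rvol Q w (i k) `^ b)%:E <
   \int[mu]_(x in Q (i k)) (g k x `^ p * w x)%:E by case: (HG k).
(* This normalisation makes the pairing with a function of Morrey bound Y at most C1 Y, uniformly in
   k. *)
pose a k := (rvol Q w (i k) `^ (- b))%R.
have a0 k : (0 < a k)%R by exact: powR_gt0.
have aE k : (a k * rvol Q w (i k) `^ b = 1)%R.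
  by rewrite /a powRN mulVf// gt_eqF// powR_gt0.
pose v k x := (a k)%:E * decay Q w e (i k) x.
have v0 k x : 0 <= v k x.
  by apply: mule_ge0; [rewrite lee_fin; exact: ltW|exact: (decay_ge0 p1 Mw)].
have mv k : measurable_fun setT (v k).
  by apply: measurable_funeM; exact: (measurable_decay p1 Mw).
pose Phi := half_series v.
have mPhi : measurable_fun setT Phi by exact: measurable_half_series.
have Phi_gt0 x : 0 < Phi x.
  have [k Qx] := cell_iter_cover Q (i 0%N) x.
  apply: lt_le_trans (half_series_ge 0 (v0 ^~ x)); rewrite expr0 mul1e /v.
  rewrite mule_gt0 ?lte_fin//; apply: lt_le_trans (decay_ge p1 Mw e Qx).
  by rewrite lte_fin; exact: decay_coef_gt0 p1 Mw _ _ _.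
have PhiM (r : T -> R) Y : measurable_fun setT r -> (forall x, (0 <= r x)%R) -> (0 <= Y)%R ->
    (forall j, \int[mu]_(x in Q j) (r x)%:E <= (Y * rvol Q w j `^ b)%:E) ->
    \int[mu]_x ((r x)%:E * Phi x) <= (2 * (C1 * Y))%:E.
  move=> mr r0 Y0 rY; rewrite integral_half_series//.
  have mr' : measurable_fun setT (fun x => (r x)%:E) by exact/measurable_EFinP.
  have CY0 : (0 <= C1 * Y)%R by rewrite mulr_ge0// ltW.
  apply: le_trans (nneseries_half CY0); apply: lee_nneseries => [k _ _|k _].
    apply: mule_ge0; first by rewrite lee_fin exprn_ge0.
    by apply: integral_ge0 => x _; apply: mule_ge0; rewrite ?lee_fin.
  rewrite mulrC [leRHS]EFinM; apply: lee_wpmul2l; first by rewrite lee_fin exprn_ge0.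
  have -> : \int[mu]_x ((r x)%:E * v k x) = (a k)%:E * \int[mu]_x ((r x)%:E * decay Q w e (i k) x).
    rewrite -integralZT ?(ltW (a0 k))//.
    - by apply: eq_integral => x _; rewrite muleCA.
    - by apply: emeasurable_funM => //; exact: (measurable_decay p1 Mw).
    - by move=> x; apply: mule_ge0; [rewrite lee_fin|exact: (decay_ge0 p1 Mw)].
  apply: (le_trans (lee_wpmul2l _ (HC1 (i k) _ Y mr' _ Y0 rY))).
  - by rewrite lee_fin ltW.
  - by move=> x; rewrite lee_fin.
  by rewrite -EFinM lee_fin mulrCA aE mulr1.
have PhiA j x : Q j x -> \int[mu]_y (cell_weight Q w j y * Phi y) <= (C2 * rvol Q w j)%:E * Phi x.
  move=> Qx; rewrite /cell_weight integral_half_series//; last 2 first.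
  - by apply: measurable_funM => //; apply: measurable_indic; exact: measurable_cell.
  - by move=> y; rewrite mulr_ge0 ?indicE ?(ltW (w0 y)).
  rewrite /Phi /half_series -nneseriesZl; last first.
    by move=> k _; apply: mule_ge0; rewrite ?lee_fin ?exprn_ge0.
  apply: lee_nneseries => [k _ _|k _].
    apply: mule_ge0; first by rewrite lee_fin exprn_ge0.
    apply: integral_ge0 => y _; apply: mule_ge0 => //.
    exact: cell_weight_ge0 Mw _ _.
  rewrite muleCA; apply: lee_wpmul2l; first by rewrite lee_fin exprn_ge0.
  have -> : \int[mu]_y ((w y * \1_(Q j) y)%:E * v k y) =
      (a k)%:E * \int[mu]_y (cell_weight Q w j y * decay Q w e (i k) y).
    rewrite -integralZT ?(ltW (a0 k))//.
    - by apply: eq_integral => y _; rewrite muleCA.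
    - apply: emeasurable_funM; last exact: (measurable_decay p1 Mw).
      exact: measurable_cell_weight Mw _.
    - move=> y; apply: mule_ge0; [exact: cell_weight_ge0 Mw _ _|exact: (decay_ge0 p1 Mw)].
  rewrite /v muleCA; apply: lee_wpmul2l; first by rewrite lee_fin ltW.
  exact: HC2.
have cwE j : cell_weight Q w j = fun x => (w x * \1_(Q j) x)%:E by [].
(* Since w 1_(Q_j) has a Morrey bound, Phi w is integrable on cells, so the packed series is finite
   almost everywhere. *)
have Phi_cell j : \int[mu]_y (cell_weight Q w j y * Phi y) < +oo.
  rewrite cwE; apply: le_lt_trans (ltry (2 * (C1 * rvol Q w j `^ (1 - b)))%R).
  apply: PhiM.
  - by apply: measurable_funM => //; apply: measurable_indic; exact: measurable_cell.
  - by move=> y; rewrite mulr_ge0 ?indicE ?(ltW (w0 y)).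
  - exact: powR_ge0.
  move=> l; apply: (@le_trans _ _ (Num.min (rvol Q w j) (rvol Q w l))%:E); last first.
    by rewrite lee_fin; apply: powR_interpolation => //; rewrite b0 ltW.
  rewrite /Num.min; case: ifPn => _.
    exact: cell_weight_le_left p1 Mw _ _.
  exact: cell_weight_le_right p1 Mw _ _.
have Phi_fin_cell j : {ae mu, forall x, Q j x -> Phi x \is a fin_num}.
  have := ae_fin_num _ _ (Phi_cell j).
  move=> /(_ _ _)H; have {H} : {ae mu, forall x, cell_weight Q w j x * Phi x \is a fin_num}.
    apply: H; first by apply: emeasurable_funM => //; exact: measurable_cell_weight Mw _.
    by move=> x; apply: mule_ge0; [exact: cell_weight_ge0 Mw _ _|exact: ltW].
  apply: filterS => x; rewrite /cell_weight indicE => + Qx; rewrite mem_set// mulr1.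
  have := Phi_gt0 x; case: (Phi x) => // _.
  by rewrite gt0_muley// lte_fin.
have Phi_fin : {ae mu, forall x, Phi x \is a fin_num}.
  have := ae_foralln (fun k => Phi_fin_cell (iter k (enl Q) 0%N)).
  apply: filterS => x H; have [k Qx] := cell_iter_cover Q 0 x.
  exact: H Qx.
have [phi [mphi phi0 Pphi]] := real_version mPhi Phi_gt0 Phi_fin.
have phiE (r : T -> R) : \int[mu]_x (r x * phi x)%:E = \int[mu]_x ((r x)%:E * Phi x).
  by apply: eq_integral_ae; apply: filterS Pphi => x ->.
have wphiE j : wvol mu (fun x => w x * phi x)%R (Q j) = \int[mu]_y (cell_weight Q w j y * Phi y).
  rewrite cwE -phiE /wvol integral_mkcond; apply: eq_integral => x _.
  rewrite patchE indicE; case: ifPn => _; first by rewrite mulr1.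
  by rewrite mulr0 mul0r.
have MW : Muck Q p (fun x => w x * phi x)%R.
  apply: (Muck_mul p1 Mw C20 mphi phi0) => j.
  have Wp0 : 0 < wvol mu (fun x => w x * phi x)%R (Q j).
    have mwphi : measurable_fun setT (fun x => w x * phi x)%R by exact: measurable_funM.
    by apply: (wvol_cell_gt0 Q j mwphi) => x; rewrite mulr_gt0.
  pose I := fine (wvol mu (fun x => w x * phi x)%R (Q j)).
  have IE : wvol mu (fun x => w x * phi x)%R (Q j) = I%:E.
    by rewrite /I fineK// ge0_fin_numE ?(ltW Wp0)// wphiE.
  have I0 : (0 < I)%R by rewrite -lte_fin -IE.
  have CW0 : (0 < C2 * rvol Q w j)%R by rewrite mulr_gt0.
  (* The choice of t that makes the upper bound an equality; the lower bound on phi is then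
     [PhiA]. *)
  exists (I / (C2 * rvol Q w j))%R; first by rewrite divr_gt0.
  split; first by rewrite IE lee_fin mulrC divfK// gt_eqF.
  apply: filterS Pphi => x xphi Qx; have := PhiA j x Qx.
  by rewrite -wphiE IE xphi -EFinM lee_fin ler_pdivrMr// mulrC.
have [c c0 Hc] := wF _ MW.
have key k : (2 ^+ k * X k < c * (2 * C1) * X k)%R.
  have [mg g0 mf f0] := F0 _ _ (Fk k).
  have mP (r : T -> R) : measurable_fun setT r -> measurable_fun setT (fun x => r x `^ p * w x)%R.
    by move=> mr; apply: measurable_funM => //; exact: measurable_powRT.
  have P0 (r : T -> R) x : (0 <= r x `^ p * w x)%R by rewrite mulr_ge0 ?powR_ge0// ltW.
  have E (r : T -> R) : \int[mu]_x (r x `^ p * (w x * phi x))%:E =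
      \int[mu]_x ((r x `^ p * w x)%:E * Phi x).
    by rewrite -phiE; apply: eq_integral => x _; rewrite mulrA.
  have fb : \int[mu]_x (f k x `^ p * (w x * phi x))%:E <= (2 * (C1 * X k))%:E.
    by rewrite E; apply: PhiM; [exact: mP|exact: P0|exact: X0|exact: fX].
  (* Only the k-th summand of Phi is kept and, in it, the cell Q^k itself, whose coefficient is 1.
     The failure factor 4^k against the weight 2^-k leaves 2^k. *)
  have gb : (2 ^+ k * X k)%:E < \int[mu]_x (g k x `^ p * (w x * phi x))%:E.
    have cg : (2^-1 ^+ k * a k)%:E * \int[mu]_(x in Q (i k)) (g k x `^ p * w x)%:E <=
        \int[mu]_x (g k x `^ p * (w x * phi x))%:E.
      rewrite E -[X in X <= _]ge0_integralZl_EFin; first last.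
      - by rewrite mulr_ge0 ?exprn_ge0// ltW.
      - by apply: measurable_funTS; apply/measurable_EFinP; exact: mP.
      - by move=> x _; rewrite lee_fin.
      - exact: measurable_cell.
      apply: (@le_trans _ _ (\int[mu]_(x in Q (i k)) ((g k x `^ p * w x)%:E * Phi x))).
        apply: ge0_le_integral.
        - exact: measurable_cell.
        - move=> x _; apply: mule_ge0; rewrite lee_fin//.
          by rewrite mulr_ge0 ?exprn_ge0// ltW.
        - apply: measurable_funTS; apply: measurable_funeM.
          by apply/measurable_EFinP; exact: mP.
        - apply: measurable_funTS; apply: emeasurable_funM => //.
          by apply/measurable_EFinP; exact: mP.
        move=> x Qx; rewrite muleC; apply: lee_wpmul2l; first by rewrite lee_fin.
        apply: le_trans (half_series_ge k (v0 ^~ x)).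
        rewrite EFinM; apply: lee_wpmul2l; first by rewrite lee_fin exprn_ge0.
        rewrite /v -[leLHS]mule1; apply: lee_wpmul2l; first by rewrite lee_fin ltW.
        apply: le_trans (@decay_ge _ _ _ _ _ _ _ p1 Mw e (i k) 0%N x Qx).
        by rewrite /decay_coef /= divff ?gt_eqF// powR1.
      apply: ge0_integral_le => //.
      - exact: measurable_cell.
      - apply: emeasurable_funM => //.
        by apply/measurable_EFinP; exact: mP.
      by move=> x; apply: mule_ge0; rewrite ?lee_fin// ltW.
    apply: lt_le_trans cg.
    have -> : (2 ^+ k * X k)%:E = (2^-1 ^+ k * a k)%:E * (4 ^+ k * X k * rvol Q w (i k) `^ b)%:E.
      rewrite -EFinM; congr (_%:E).
      rewrite [RHS](_ : _ = (2^-1 ^+ k * 4 ^+ k) * X k * (a k * rvol Q w (i k) `^ b))%R; last by ring.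
      by rewrite aE mulr1 -exprMn; congr (_ ^+ _ * _)%R; field.
    rewrite lte_pmul2l//; last by rewrite lte_fin mulr_gt0 ?exprn_gt0.
  have := lt_le_trans gb (le_trans (Hc _ _ (Fk k)) (lee_wpmul2l _ fb)).
  rewrite lee_fin => /(_ (ltW c0)); rewrite -EFinM lte_fin => /lt_le_trans; apply.
  by rewrite le_eqVlt; apply/orP; left; apply/eqP; ring.
pose k := Num.bound (c * (2 * C1)).
(* [key] is strict, so [X k = 0] is already contradictory. *)
have := key k; have [Xk|Xk] := eqVneq (X k) 0%R.
  by rewrite Xk !mulr0 ltxx.
rewrite ltr_pM2r; last by rewrite lt_def Xk X0.
by apply/negP; rewrite -leNgt ltW// upper_nthrootP.
Qed.

End Morrey_extrapolation.

(** * Dyadic cubes *)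

Lemma prod_EFin_cst {R : realType} m (a : R) :
  (\prod_(i < m) a%:E = (a ^+ m)%:E)%E.
Proof.
elim: m => [|m IH]; first by rewrite big_ord0 expr0.
by rewrite big_ord_recl IH -EFinM exprS.
Qed.

Section dyadic_basis.
Context {R : realType} {n : nat}.
Hypothesis n_gt0 : (0 < n)%N.
Local Notation mu := (@lebesgue_Rn R n).
Implicit Types (c x : Rn R n) (h : R) (J : int) (M : n.-tuple int).

Lemma cube_box c h : cube c h =
  [set x : Rn R n | forall i, `[(tnth c i : R) - h, (tnth c i : R) + h]%classic (tnth x i)].
Proof.
apply/seteqP; split => x H i; have := H i; rewrite /= in_itv/= ler_distl//.
Qed.

Lemma measurable_cube c h : measurable (cube c h).
Proof.
rewrite cube_box (_ : [set x | _] = \bigcap_(i in [set: 'I_n])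
    ((@tnth n (measurableTypeR R) ^~ i) @^-1` `[(tnth c i : R) - h, (tnth c i : R) + h]%classic)).
  apply: fin_bigcap_measurable => // i _.
  by rewrite -[X in measurable X]setTI; exact: measurable_tnth.
by apply/seteqP; split => [x Ax i _|x Ax i]; [exact: Ax|exact: (Ax i I)].
Qed.

Lemma lebesgue_cube c h : 0 < h -> mu (cube c h) = ((2 * h) ^+ n)%:E.
Proof.
move=> h0; rewrite cube_box (@lebesgue_Rn_box R n (fun i =>
    `[(tnth c i : R) - h, (tnth c i : R) + h]%classic)); last first.
  by move=> i; exact: measurable_itv.
have -> : (\prod_(i < n) lebesgue_measure `[((tnth c i : R) - h)%R, ((tnth c i : R) + h)%R]%classic =
    \prod_(i < n) (2 * h)%:E)%E.
  apply: eq_bigr => i _; rewrite lebesgue_measure_itv/= lte_fin.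
  rewrite ifT; last by lra.
  by rewrite -EFinB; congr (_%:E); ring.
exact: prod_EFin_cst.
Qed.

Definition dyadic_size J : R := 2 ^ (- J).

Lemma dyadic_size_gt0 J : 0 < dyadic_size J.
Proof. by rewrite /dyadic_size exprz_gt0. Qed.

Lemma dyadic_cubeP J M x : dyadic_cube J M x <->
  forall i, `|(tnth x i : R) - dyadic_size J * (tnth M i)%:~R| <= dyadic_size J.
Proof. by split => H i; have := H i; rewrite /= tnth_mktuple. Qed.

(* Rounding [M / 8] to a nearest integer [M'] puts the triple of the cube [(J, M)]
   inside the cube [(J - 3, M')]; with 4 instead of 8 this fails for [M = 2 mod 4]. *)
Definition dyadic_parent (a : int * n.-tuple int) : int * n.-tuple int :=
  (a.1 - 3, [tuple ((tnth a.2 i + 4) %/ 8)%Z | i < n]).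

Lemma round8_bound (m : int) : `|m%:~R - 8 * ((m + 4) %/ 8)%Z%:~R| <= 4 :> R.
Proof.
have E := divz_eq (m + 4) 8.
have r0 := modz_ge0 (m + 4) (isT : 8%:Z != 0).
have r8 := ltz_pmod (m + 4) (isT : (0 < 8 :> int)).
move: ((m + 4) %/ 8)%Z ((m + 4) %% 8)%Z E r0 r8 => a r E r0 r8.
have -> : m = a * 8 + r - 4 by rewrite -E addrK.
have r0' : 0 <= r%:~R :> R by rewrite ler0z.
have r8' : r%:~R <= 8 :> R by rewrite (_ : 8 = 8%:~R)// ler_int ltW.
rewrite ler_distl !(rmorphD, rmorphB, rmorphM, rmorphN)/=.
by apply/andP; split; lra.
Qed.

Lemma dyadic_parent_size J M : dyadic_size (dyadic_parent (J, M)).1 = 8 * dyadic_size J.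
Proof.
rewrite /dyadic_size /= opprB expfzDr// -exprnP.
by congr (_ * _); rewrite !exprS expr0; ring.
Qed.

Lemma dyadic_parent_sub J M x :
  (forall i, `|(tnth x i : R) - dyadic_size J * (tnth M i)%:~R| <= 3 * dyadic_size J) ->
  dyadic_cube (dyadic_parent (J, M)).1 (dyadic_parent (J, M)).2 x.
Proof.
move=> H; apply/dyadic_cubeP => i; rewrite dyadic_parent_size /= tnth_mktuple.
have s0 := dyadic_size_gt0 J; set s := dyadic_size J in s0 H *.
have := H i; have := round8_bound (tnth M i).
set a := ((_ %/ _)%Z)%:~R; set b := (tnth M i)%:~R.
rewrite !ler_distl => /andP[h1 h2] /andP[h3 h4].
have := ler_wpM2l (ltW s0) h1; have := ler_wpM2l (ltW s0) h2.
by move=> h5 h6; apply/andP; split; lra.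
Qed.

Definition dyadic_index k : int * n.-tuple int :=
  odflt (0, [tuple 0 | i < n]) (unpickle k).

Lemma dyadic_indexK a : dyadic_index (pickle a) = a.
Proof. by rewrite /dyadic_index pickleK. Qed.

Let cellD k := dyadic_cube (R := R) (dyadic_index k).1 (dyadic_index k).2.
Let enlD k := pickle (dyadic_parent (dyadic_index k)).
Let volD k : R := (2 * dyadic_size (dyadic_index k).1) ^+ n.

Let measurable_cellD k : measurable (cellD k).
Proof. exact: measurable_cube. Qed.

Let volD_gt0 k : 0 < volD k.
Proof. by rewrite exprn_gt0// mulr_gt0// dyadic_size_gt0. Qed.

Let mu_cellD k : mu (cellD k) = (volD k)%:E.
Proof. by rewrite /cellD /dyadic_cube lebesgue_cube// dyadic_size_gt0. Qed.

Let dilationD : 1 < 8 ^+ n :> R.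
Proof. by rewrite exprn_egt1// -?lt0n// ltr1n. Qed.

Let vol_enlD k : volD (enlD k) = 8 ^+ n * volD k.
Proof.
rewrite /volD /enlD dyadic_indexK; case: (dyadic_index k) => J M.
by rewrite dyadic_parent_size -exprMn; congr (_ ^+ _); rewrite /=; ring.
Qed.

Let cell_engulfD i j : volD j <= volD i -> cellD i `&` cellD j !=set0 ->
  cellD j `<=` cellD (enlD i).
Proof.
rewrite /volD /cellD /enlD dyadic_indexK.
case: (dyadic_index i) => J M; case: (dyadic_index j) => J' M' /= v.
move=> [z [/dyadic_cubeP z1 /dyadic_cubeP z2]] x /dyadic_cubeP x1.
(* From the centre of cell i to x: at most s to the common point z, then 2 s' across cell j, hence
   at most 3 s. *)
apply: dyadic_parent_sub => l.
have s0 := dyadic_size_gt0 J; have s0' := dyadic_size_gt0 J'.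
have ss : dyadic_size J' <= dyadic_size J.
  by move: v; rewrite ler_pXn2r// ?nnegrE ?mulr_ge0 ?(ltW s0) ?(ltW s0')// ler_pM2l.
have := x1 l; have := z1 l; have := z2 l; rewrite !ler_distl.
by move=> /andP[? ?] /andP[? ?] /andP[? ?]; apply/andP; split; lra.
Qed.

Lemma dyadic_cover (b : R) : exists J, forall x,
  (forall i, `|tnth x i : R| <= b) -> dyadic_cube J [tuple 0 | i < n] x.
Proof.
exists (- (Num.bound b)%:Z) => x xb; apply/dyadic_cubeP => i.
rewrite tnth_mktuple mulr0 subr0 (le_trans (xb i))//.
rewrite /dyadic_size opprK -exprnP ltW//; exact: upper_nthrootP.
Qed.

Let cell_reachD i x : exists2 j, cellD j x & cellD i `&` cellD j !=set0.
Proof.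
pose y : Rn R n := [tuple dyadic_size (dyadic_index i).1 * (tnth (dyadic_index i).2 l)%:~R | l < n].
have [J HJ] := dyadic_cover (\sum_(l < n) (`|tnth x l : R| + `|tnth y l : R|)).
have le1 (l : 'I_n) : `|tnth x l : R| + `|tnth y l : R| <=
    \sum_(l < n) (`|tnth x l : R| + `|tnth y l : R|).
  by rewrite (bigD1 l)//= lerDl sumr_ge0// => k _; rewrite addr_ge0.
exists (pickle (J, [tuple (0 : int) | i < n])); rewrite /cellD dyadic_indexK/=.
  by apply: HJ => l; apply: le_trans (le1 l); rewrite lerDl.
exists y; split.
  by apply/dyadic_cubeP => l; rewrite tnth_mktuple subrr normr0 ltW// dyadic_size_gt0.
by apply: HJ => l; apply: le_trans (le1 l); rewrite lerDr.
Qed.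

Definition dyadic_basis : covering_basis mu :=
  CoveringBasis measurable_cellD volD_gt0 mu_cellD dilationD vol_enlD
    cell_engulfD cell_reachD.

Lemma dyadic_basisE J M : dyadic_basis (pickle (J, M)) = dyadic_cube J M.
Proof. by rewrite /= /cellD dyadic_indexK. Qed.

Lemma dyadic_basis_cell k : exists J M, dyadic_basis k = dyadic_cube J M.
Proof. by exists (dyadic_index k).1, (dyadic_index k).2. Qed.

Lemma dyadic_vol k : exists2 s, 0 < s & exists c,
  dyadic_basis k = cube c s /\ vol dyadic_basis k = (2 * s) ^+ n.
Proof.
exists (dyadic_size (dyadic_index k).1); first exact: dyadic_size_gt0.
by eexists; split; [reflexivity|].
Qed.

(** The largest power of 2 not exceeding 4h is at least 2h. *)
Lemma dyadic_scale h : 0 < h -> exists J, 2 * h <= dyadic_size J <= 4 * h.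
Proof.
move=> h0; have ln2 : 0 < ln (2 : R) by rewrite ln_gt0// ltr1n.
pose y := ln (4 * h) / ln 2; exists (- Num.floor y).
have h40 : 0 < 4 * h by rewrite mulr_gt0.
have E : 4 * h = 2 `^ y.
  by rewrite /powR ifF ?pnatr_eq0// /y divfK ?gt_eqF// lnK.
have -> : dyadic_size (- Num.floor y) = 2 `^ (Num.floor y)%:~R.
  by rewrite /dyadic_size opprK powR_intmul.
have f1 : (Num.floor y)%:~R <= y by exact: floor_le_tmp.
have f2 : y < (Num.floor y)%:~R + 1 by rewrite -intrD1; exact: floorD1_gt.
apply/andP; split; last by rewrite E; apply: ler_powR => //; rewrite ler1n.
have : 2 `^ y <= 2 `^ ((Num.floor y)%:~R + 1) :> R.
  by apply: ler_powR; [rewrite ler1n|exact: ltW].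
rewrite -E powRD ?powRr1//; last by apply/implyP => _; rewrite pnatr_eq0.
lra.
Qed.

(** With size s >= 2h, rounding c to the nearest point of the lattice s Z^n moves each coordinate by
    at most s/2, and the cube adds h <= s/2. *)
Lemma cube_sub_dyadic c h : 0 < h -> exists2 k, cube c h `<=` dyadic_basis k &
  vol dyadic_basis k <= 4 ^+ n * (2 * h) ^+ n.
Proof.
move=> h0; have [J /andP[J1 J2]] := dyadic_scale h0.
have s0 := dyadic_size_gt0 J.
pose M := [tuple Num.floor ((tnth c i : R) / dyadic_size J + 2^-1) | i < n].
exists (pickle (J, M)).
  rewrite dyadic_basisE => x xc; apply/dyadic_cubeP => i; rewrite tnth_mktuple.
  have := xc i; set s := dyadic_size J in s0 J1 J2 *.
  set m := Num.floor _; pose y := (tnth c i : R) / s + 2^-1.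
  have f1 : m%:~R <= y by exact: floor_le_tmp.
  have f2 : y < m%:~R + 1 by rewrite -intrD1; exact: floorD1_gt.
  have cE : (tnth c i : R) = s * (y - 2^-1).
    by rewrite /y addrK mulrC divfK// gt_eqF.
  rewrite !ler_distl cE => /andP[h1 h2].
  have := ler_wpM2l (ltW s0) f1; have := ler_wpM2l (ltW s0) (ltW f2).
  by move=> h3 h4; apply/andP; split; lra.
rewrite /= /volD dyadic_indexK /= -exprMn; apply: lerXn2r; rewrite ?nnegrE.
- by rewrite mulr_ge0// ltW.
- by rewrite !mulr_ge0// ltW.
- lra.
Qed.

End dyadic_basis.

(** The integral of a non-negative function is a supremum over simple functions below it, hence
    monotone as such. Applied to integrals over a compact set, for which no measurability is at
    hand. *)
Lemma ge0_le_integral_nonmeasurable d (T : measurableType d) (R : realType)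
    (mu : {measure set T -> \bar R}) (f g : T -> \bar R) :
  (forall x, (0 <= f x)%E) -> (forall x, (f x <= g x)%E) ->
  (\int[mu]_x f x <= \int[mu]_x g x)%E.
Proof.
move=> f0 fg; have g0 x : (0 <= g x)%E by exact: le_trans (fg x).
rewrite !ge0_integralTE//; apply: ge_ereal_sup => _ [h /= hf <-].
by apply: ereal_sup_ubound; exists h => // x; exact: le_trans (fg x).
Qed.

(** * A_p over all cubes against the condition over dyadic cells *)

Section Ap_Muck.
Context {R : realType} {n : nat}.
Hypothesis n_gt0 : (0 < n)%N.
Local Notation mu := (@lebesgue_Rn R n).
Local Notation Q := (@dyadic_basis R n n_gt0).
Implicit Types (f g w : Rn R n -> R) (p r : R).

Lemma compact_sub_cell (K : set (Rn R n)) : compact_Rn K ->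
  exists k, K `<=` Q k.
Proof.
move=> cK; have [b Hb] : exists b : R, forall x, K x -> forall i, `|tnth x i : R| <= b.
  have [M [Mreal HM]] := compact_bounded cK.
  exists (M + 1) => x Kx i.
  have := HM (M + 1) (ltr_pwDr ltr01 (lexx M)) _ (ex_intro2 _ _ x Kx erefl).
  apply: le_trans; rewrite [leRHS]/Num.norm /= mx_normrE; apply/bigmax_geP; right.
  by exists (ord0, i) => //=; rewrite mxE.
have [J HJ] := @dyadic_cover R n b.
exists (pickle (J, [tuple (0 : int) | i < n])); rewrite dyadic_basisE => x Kx.
by apply: HJ => i; exact: Hb.
Qed.

Lemma wmeas_ae w w' (A : set (Rn R n)) : {ae mu, forall x, w x = w' x} ->
  wmeas w A = wvol mu w' A.
Proof. by move=> ww'; apply: eq_integral_ae; apply: filterS ww' => x ->. Qed.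

Lemma Ap_Muck p w : 1 < p -> Ap p w ->
  exists2 w', Muck Q p w' & {ae mu, forall x, w x = w' x}.
Proof.
move=> p1 [[[g mg wg] _] w0 wAp].
(* The Borel version may fail to be positive on a null set; it is replaced by 1 there. *)
pose w' x := if 0 < g x then g x else 1.
have ww' : {ae mu, forall x, w x = w' x}.
  by apply: filterS2 wg w0 => x -> g0; rewrite /w' g0.
have w'0 x : 0 < w' x by rewrite /w'; case: ifPn.
exists w' => //; split=> //.
  by apply: measurable_fun_ifT => //; exact: measurable_fun_ltr.
have dual_ae : {ae mu, forall x, w x `^ (1 - conj_exp p) = dual_weight p w' x}.
  by apply: filterS ww' => x ->.
have Ap_ge c h : 0 < h -> (wvol mu w' (cube c h) / mu (cube c h) *
    (wvol mu (dual_weight p w') (cube c h) / mu (cube c h)) `^ (p - 1) <= Ap_const p w)%E.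
  move=> h0; rewrite -(wmeas_ae _ ww') -(wmeas_ae _ dual_ae).
  by apply: ereal_sup_ubound; exists c => //; exists h.
have Ap0 : (0 <= Ap_const p w)%E.
  apply: le_trans (Ap_ge [tuple 0 | i < n] 1 ltr01).
  rewrite lebesgue_cube// !inver gt_eqF ?exprn_gt0//.
  rewrite !mule_ge0 ?poweR_ge0// ?lee_fin ?invr_ge0 ?exprn_ge0//.
  by apply: wvol_ge0 => x; exact: ltW.
have KE : Ap_const p w \is a fin_num by rewrite ge0_fin_numE.
exists (fine (Ap_const p w)) => i.
have [s s0 [c [Qi vi]]] := @dyadic_vol R n n_gt0 i.
have V0 := vol_gt0 Q i; set V := vol Q i in vi V0 *.
have H : (wvol mu w' (Q i) * V^-1%:E *
    (wvol mu (dual_weight p w') (Q i) * V^-1%:E) `^ (p - 1) <= Ap_const p w)%E.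
  have -> : V^-1%:E = ((mu (cube c s))^-1)%E.
    by rewrite lebesgue_cube// inver gt_eqF ?exprn_gt0 ?mulr_gt0// vi.
  by rewrite Qi; exact: Ap_ge.
have S0 : (0 <= wvol mu (dual_weight p w') (Q i))%E.
  by apply: wvol_ge0 => x; exact: powR_ge0.
have W0 : (0 <= wvol mu w' (Q i))%E by apply: wvol_ge0 => x; exact: ltW.
have p0 : 0 < p by lra.
have Vp0 : (0 < V `^ p) by rewrite powR_gt0.
rewrite EFinM (fineK KE) -lee_pdivrMr//; apply: le_trans H.
rewrite poweRM// ?lee_fin ?invr_ge0 ?(ltW V0)// poweR_EFin powR_invr ?(ltW V0)//.
rewrite -(mulr_powRB1 (ltW V0) p0) invfM EFinM.
by rewrite muleACA le_eqVlt; apply/orP; left; apply/eqP; rewrite !muleA.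
Qed.

(** Needed to feed the hypothesis of the theorem, which speaks of all cubes. Each cube lies in a
    cell of at most 4^n times its volume, which costs a factor (4^n)^p. *)
Lemma Muck_Ap p w : 1 < p -> Muck Q p w -> Ap p w.
Proof.
move=> p1 Mw; have [mw w0 _] := Mw; have p0 : 0 < p by lra.
have c1 := conj_exp_gt1 p1; have Ms := Muck_dual p1 Mw.
have ms : measurable_fun setT (dual_weight p w) by case: Ms.
have s0 x : 0 < dual_weight p w x by case: Ms => _ + _; exact.
split.
- split; first by exists w => //; exact: aeW.
  move=> K /compact_sub_cell[k Kk].
  apply: (@le_lt_trans _ _ (wvol mu w (Q k))); last exact: Muck_fin p1 Mw.
  rewrite /wvol [leLHS]integral_mkcond [leRHS]integral_mkcond.
  apply: ge0_le_integral_nonmeasurable => x.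
    by apply: erestrict_ge0 => y _; rewrite lee_fin.
  rewrite !patchE; case: ifPn => [|_]; last first.
    by case: ifPn => _ //; rewrite lee_fin ltW.
  by rewrite inE => /Kk Qx; rewrite mem_set// gtr0_norm.
- exact: aeW.
have [K K0 HK] := Muck_rvol p1 Mw.
apply: (@le_lt_trans _ _ (K * (4 ^+ n) `^ p)%:E); last exact: ltry.
apply: ge_ereal_sup => _ [c _ [h /= h0 <-]].
have [k ck vk] := cube_sub_dyadic n_gt0 c h0.
have mc : measurable (cube c h) by exact: measurable_cube.
have mk := measurable_cell Q k.
have H1 : (wmeas w (cube c h) <= (rvol Q w k)%:E)%E.
  rewrite -(wvol_rvol k p1 Mw) -[leLHS]/(wvol mu w (cube c h)).
  by apply: wvol_le => // x; exact: ltW.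
have H2 : (wmeas (fun x => w x `^ (1 - conj_exp p))%R (cube c h) <=
    (rvol Q (dual_weight p w) k)%:E)%E.
  rewrite -(wvol_rvol k c1 Ms) -[leLHS]/(wvol mu (dual_weight p w) (cube c h)).
  by apply: wvol_le => // x; exact: ltW.
rewrite lebesgue_cube//; set m := (2 * h) ^+ n in vk *.
have m0 : 0 < m by rewrite exprn_gt0// mulr_gt0.
rewrite inver gt_eqF//.
have mV0 : (0 <= (m^-1)%:E :> \bar R)%E by rewrite lee_fin invr_ge0 ltW.
have W0 := rvol_gt0 k p1 Mw; have S0 := rvol_gt0 k c1 Ms.
apply: (@le_trans _ _ ((rvol Q w k / m) * (rvol Q (dual_weight p w) k / m) `^ (p - 1))%:E).
  rewrite EFinM -poweR_EFin !EFinM; apply: lee_pmul.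
  - by rewrite mule_ge0//; apply: wvol_ge0 => x; exact: ltW.
  - exact: poweR_ge0.
  - by apply: lee_wpmul2r.
  apply: le_poweR; first lra.
    by rewrite mule_ge0//; apply: wvol_ge0 => x; exact: powR_ge0.
  by apply: lee_wpmul2r.
rewrite lee_fin powR_div ?(ltW S0) ?(ltW m0)//.
have mp0 : 0 < m `^ p by rewrite powR_gt0.
have -> : rvol Q w k / m * (rvol Q (dual_weight p w) k `^ (p - 1) / m `^ (p - 1)) =
    (rvol Q w k * rvol Q (dual_weight p w) k `^ (p - 1)) / m `^ p.
  by rewrite mulrACA -invfM mulr_powRB1// ltW.
rewrite ler_pdivrMr//; apply: (le_trans (HK k)).
rewrite -mulrA ler_wpM2l ?(ltW K0)// -powRM ?(ltW m0) ?exprn_ge0//.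
apply: ge0_ler_powR; rewrite ?nnegrE ?(ltW p0) ?(ltW (vol_gt0 _ _))//.
by apply: mulr_ge0; [exact: exprn_ge0|exact: ltW].
Qed.

End Ap_Muck.

Lemma le_root_poweR {R : realType} (p c : R) (x y : \bar R) : 0 < p -> 0 <= c ->
  (0 <= x -> 0 <= y -> x `^ p^-1 <= c%:E * y `^ p^-1 -> x <= (c `^ p)%:E * y)%E.
Proof.
move=> p0 c0 x0 y0 /(le_poweR (ltW p0) (poweR_ge0 _ _)).
rewrite poweRM ?poweR_ge0//.
by rewrite -!poweRrM mulVf ?gt_eqF// !poweRe1// poweR_EFin.
Qed.

(** * Borel representatives and the passage to norms *)

Section Borel_pairs.
Context {R : realType} {n : nat}.
Local Notation mu := (@lebesgue_Rn R n).
Implicit Types (f g w : Rn R n -> R) (p r : R).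

(** The abstract part works with measurable functions that are non-negative everywhere, while
    members of [F] are only Lebesgue measurable. Replacing them by almost everywhere equal Borel
    functions changes no integral. *)
Definition Borel_pairs (F : set ((Rn R n -> R) * (Rn R n -> R))) :
    set ((Rn R n -> R) * (Rn R n -> R)) :=
  [set u : (Rn R n -> R) * (Rn R n -> R) | [/\ measurable_fun setT u.1, forall x, 0 <= u.1 x,
    measurable_fun setT u.2, forall x, 0 <= u.2 x &
    exists g f, [/\ F (g, f), {ae mu, forall x, g x = u.1 x} &
      {ae mu, forall x, f x = u.2 x}]]].

Lemma Borel_pairs_nonneg F : nonneg_pairs (Borel_pairs F).
Proof. by move=> g f []. Qed.

Lemma Borel_version f : (forall x, 0 <= f x) -> Lebesgue_measurable f ->
  exists h : Rn R n -> R, [/\ measurable_fun setT h, forall x, 0 <= h x &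
    {ae mu, forall x, f x = h x}].
Proof.
move=> f0 [h mh fh]; exists (fun x => `|h x|); split=> //.
- exact: measurableT_comp.
- by apply: filterS fh => x fx; rewrite -fx ger0_norm.
Qed.

Lemma wLnorm_ae p w (w' : Rn R n -> R) f (f' : Rn R n -> R) (A : set (Rn R n)) : {ae mu, forall x, w x = w' x} ->
  {ae mu, forall x, f x = f' x} -> (forall x, 0 <= f' x) ->
  wLnorm p w A f = ((\int[mu]_(x in A) (f' x `^ p * w' x)%:E) `^ p^-1)%E.
Proof.
move=> ww' ff' f'0; rewrite /wLnorm; congr (_ `^ _)%E; apply: eq_integral_ae.
by apply: filterS2 ww' ff' => x -> ->; rewrite ger0_norm.
Qed.

End Borel_pairs.

Theorem theorem5p3 (R : realType) (n : nat) (n_gt0 : (0 < n)%N)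
    (F : set ((Rn R n -> R) * (Rn R n -> R)))
    (F_ge0_loc : forall g f, F (g, f) ->
      [/\ forall x, 0 <= g x, L1loc g, forall x, 0 <= f x & L1loc f])
    (p1 : R) (p1_gt1 : 1 < p1)
    (F_bound : forall w : Rn R n -> R, Ap p1 w ->
      exists2 c1 : R, 0 < c1 & forall g f, F (g, f) ->
        (wLnorm p1 w setT g <= c1%:E * wLnorm p1 w setT f)%E) :
  forall p r : R, 1 < p -> - (n%:R / p) <= r -> r < 0 ->
  forall w : Rn R n -> R, Ap p w ->
    exists2 c2 : R, 0 < c2 & forall g f, F (g, f) ->
      (Morrey_norm p r w g <= c2%:E * Morrey_norm p r w f)%E.
Proof.
move=> p r p_gt1 r_ge r_lt0 w Apw.
have p0 : 0 < p by lra.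
have p10 : 0 < p1 by lra.
have n0 : 0 < n%:R :> R by rewrite ltr0n.
set Q := @dyadic_basis R n n_gt0; pose mu := @lebesgue_Rn R n.
have F1 : weighted_ineq Q (Borel_pairs F) p1.
  move=> W MW; have [_ W0 _] := MW.
  have [c c0 Hc] := F_bound _ (Muck_Ap p1_gt1 MW).
  exists (c `^ p1); first exact: powR_gt0.
  move=> g' f' [/= mg g0 mf f0 [g [f [Fgf gg' ff']]]].
  have WW : {ae mu, forall x, W x = W x} by exact: aeW.
  have := Hc _ _ Fgf; rewrite (wLnorm_ae _ _ WW gg' g0) (wLnorm_ae _ _ WW ff' f0).
  have I0 (h : Rn R n -> R) : (0 <= \int[mu]_x (h x `^ p1 * W x)%:E)%E.
    by apply: integral_ge0 => x _; rewrite lee_fin mulr_ge0 ?powR_ge0// ltW.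
  exact: (le_root_poweR p10 (ltW c0) (I0 g') (I0 f')).
have Fp := extrapolation (@Borel_pairs_nonneg R n F) p1_gt1 p_gt1 F1.
have [w' Mw' ww'] := Ap_Muck n_gt0 p_gt1 Apw.
have [_ w'0 _] := Mw'.
(* a p = 1 + p r / n is the exponent b of the Morrey step: it is at least 0 because r >= -n/p and
   below 1 because r < 0. *)
pose a := p^-1 + r / n%:R.
have a0 : 0 <= a.
  have : - p^-1 <= r / n%:R by rewrite ler_pdivlMr// mulNr mulrC.
  rewrite /a; lra.
have ap1 : 0 <= a * p < 1.
  rewrite mulr_ge0 ?(ltW p0)//= /a mulrDl mulVf ?gt_eqF//.
  have : r / n%:R * p < 0 by rewrite !pmulr_llt0// invr_gt0.
  lra.
have [c c0 Hc] := Morrey_extrapolation (@Borel_pairs_nonneg R n F) Fp p_gt1 Mw' ap1.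
exists (c `^ p^-1); first exact: powR_gt0.
have W0 k : 0 < rvol Q w' k by exact: rvol_gt0 p_gt1 Mw'.
have termE (h h' : Rn R n -> R) k : {ae mu, forall x, h x = h' x} -> (forall x, 0 <= h' x) ->
    (wmeas w (Q k) `^ (- a) * wLnorm p w (Q k) h =
     (rvol Q w' k `^ (- a))%:E * (\int[mu]_(x in Q k) (h' x `^ p * w' x)%:E) `^ p^-1)%E.
  move=> hh' h'0; rewrite (wLnorm_ae _ _ ww' hh' h'0) (wmeas_ae _ ww').
  by rewrite (wvol_rvol k p_gt1 Mw') poweR_EFin.
have I0 (h : Rn R n -> R) k : (0 <= \int[mu]_(x in Q k) (h x `^ p * w' x)%:E)%E.
  by apply: integral_ge0 => x _; rewrite lee_fin mulr_ge0 ?powR_ge0// ltW.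
move=> g f Fgf; have [g0 [mg _] f0 [mf _]] := F_ge0_loc _ _ Fgf.
have [g' [mg' g'0 gg']] := Borel_version g0 mg.
have [f' [mf' f'0 ff']] := Borel_version f0 mf.
have Fgf' : Borel_pairs F (g', f') by split=> //; exists g, f.
have term_le k : ((rvol Q w' k `^ (- a))%:E *
    (\int[mu]_(x in Q k) (f' x `^ p * w' x)%:E) `^ p^-1 <= Morrey_norm p r w f)%E.
  rewrite -(termE _ _ _ ff' f'0); have [J [M ->]] := @dyadic_basis_cell R n n_gt0 k.
  by apply: ereal_sup_ubound; exists J => //; exists M.
have X0 : (0 <= Morrey_norm p r w f)%E.
  by apply: le_trans (term_le 0%N); rewrite mule_ge0 ?poweR_ge0// lee_fin powR_ge0.
move: X0 term_le; case: (Morrey_norm p r w f) => [X|_ _|//]; last first.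
  by rewrite gt0_muley ?leey// lte_fin powR_gt0.
rewrite lee_fin => X0 term_le.
(* The Morrey bound raised to the power p, so X^p takes the place of X in [Hc]; the p-th root at the
   end restores X and the exponent a. *)
have fX k : (\int[mu]_(x in Q k) (f' x `^ p * w' x)%:E <=
    (X `^ p * rvol Q w' k `^ (a * p))%:E)%E.
  have := term_le k; rewrite powRN -lee_pdivlMl ?invr_gt0 ?powR_gt0// invrK -EFinM.
  move=> /(le_poweR (ltW p0) (poweR_ge0 _ _)).
  rewrite -poweRrM mulVf ?gt_eqF// poweRe1// poweR_EFin powRM ?powR_ge0//.
  by rewrite -powRrM mulrC.
have gX := Hc _ _ _ Fgf' (powR_ge0 X p) fX.
apply: ge_ereal_sup => _ [J _ [M _ <-]].
rewrite -(dyadic_basisE n_gt0 J M) -/Q; set k := pickle (J, M).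
rewrite -/a (termE _ _ _ gg' g'0) -EFinM.
rewrite powRN -lee_pdivlMl ?invr_gt0 ?powR_gt0// invrK.
have := le_poweR (_ : 0 <= p^-1) (I0 g' k) (gX k).
rewrite invr_ge0 => /(_ (ltW p0)) /le_trans; apply.
rewrite poweR_EFin -EFinM lee_fin powRM ?powR_ge0 ?mulr_ge0 ?powR_ge0 ?(ltW c0)//.
rewrite [((c * _) `^ _)]powRM ?powR_ge0 ?(ltW c0)//.
have -> : (X `^ p) `^ p^-1 = X by rewrite -powRrM mulfV ?gt_eqF// powRr1.
have -> : (rvol Q w' k `^ (a * p)) `^ p^-1 = rvol Q w' k `^ a.
  by rewrite -powRrM mulfK// gt_eqF.
by rewrite mulrC.
Qed.
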